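(* Let $p>0$, $\alpha\ge-1$ and suppose $f\in A_\alpha^p(\mathbb{D})$ is a conformal mapping on the unit disk $\mathbb{D}$. For $r\in(0,1)$ let $M(r)=\max_{|z|=r}|f(z)|$ and $\psi(r)=\mathrm{area}\left(f(D(0,r))\right)$, where $D(0,r)$ is the disk centered at $0$ of radius $r$. Then (1) $\displaystyle\lim_{r\to1}(1-r)M(r)^{\frac{p}{\alpha+2}}=0$; (2) $\displaystyle\lim_{r\to1}(1-r)\psi(r)^{\frac{p}{2(\alpha+2)}}=0$.
   Context: A conformal mapping on $\mathbb{D}$ is an injective holomorphic function $f:\mathbb{D}\to\mathbb{C}$. For $p>0$, $\alpha>-1$, the weighted Bergman space $A_\alpha^p(\mathbb{D})$ is the set of holomorphic $f$ on $\mathbb{D}$ with $\int_{\mathbb{D}}|f(z)|^p(1-|z|^2)^\alpha\,dA(z)<\infty$, where $dA$ is Lebesgue area measure. The Hardy space $H^p(\mathbb{D})$ is the set of holomorphic $f$ on $\mathbb{D}$ with $\sup_{0<r<1}\int_0^{2\pi}|f(re^{it})|^p\,dt<\infty$. Convention: $A_{-1}^p(\mathbb{D})=H^p(\mathbb{D})$. $\mathrm{area}$ is Euclidean area; limits as $r\to1$ are from the left. *)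

(* Defs.v *)
From HB Require Import structures.
From mathcomp Require Import all_boot all_order all_algebra.
From mathcomp Require Import complex.
From mathcomp Require Import all_classical all_reals all_analysis.

Set Implicit Arguments.
Unset Strict Implicit.
Unset Printing Implicit Defensive.

Import Order.TTheory GRing.Theory Num.Theory.
Import numFieldNormedType.Exports.

Local Open Scope classical_set_scope.
Local Open Scope complex_scope.
Local Open Scope ring_scope.

(* In [R[i]] the norm [`|z|] is again an element of [R[i]]; [cmod z] is the
   modulus as an element of [R], and [`|z| = (cmod z)%:C]. *)
Definition cmod (R : realType) (z : R[i]) : R := ComplexField.Normc.normc z.

Definition disk (R : realType) (r : R) : set R[i] := [set z | cmod z < r].

(* [derivable] is taken over the scalar field [R[i]]: the difference quotient
   converges as the increment tends to 0 in [R[i]], so this is complex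
   differentiability. Functions on the disk are total functions on [R[i]] whose
   values outside the disk are never used. *)
Definition holomorphic_on (R : realType) (D : set R[i]) (f : R[i] -> R[i]) :
    Prop :=
  forall z, D z -> derivable (f : R[i]^o -> R[i]^o) z 1.

Definition conformal_on (R : realType) (D : set R[i]) (f : R[i] -> R[i]) :
    Prop :=
  holomorphic_on D f /\ set_inj D f.

Definition to_complex (R : realType) (xy : R * R) : R[i] := xy.1 +i* xy.2.

Definition area (R : realType) (A : set R[i]) : \bar R :=
  (lebesgue_measure \x lebesgue_measure)%E (@to_complex R @^-1` A).

Definition weighted_bergman (R : realType) (p alpha : R) (f : R[i] -> R[i]) :
    Prop :=
  holomorphic_on (disk 1) f /\
  (\int[lebesgue_measure \x lebesgue_measure]_(xy in @to_complex R @^-1` disk 1)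
     (cmod (f (to_complex xy)) `^ p *
      (1 - cmod (to_complex xy) ^+ 2) `^ alpha)%R%:E < +oo)%E.

Definition circle_pt (R : realType) (r t : R) : R[i] :=
  (r * cos t) +i* (r * sin t).

Definition hardy (R : realType) (p : R) (f : R[i] -> R[i]) : Prop :=
  holomorphic_on (disk 1) f /\
  (ereal_sup [set \int[lebesgue_measure]_(t in `[0%R, (2 * pi)%R])
                    (cmod (f (circle_pt r t)) `^ p)%R%:E
             | r in `]0%R, 1%R[%classic] < +oo)%E.

Definition bergman (R : realType) (p alpha : R) (f : R[i] -> R[i]) : Prop :=
  if alpha == -1 then hardy p f else weighted_bergman p alpha f.

(* The supremum is a maximum whenever [f] is continuous on the circle, the
   circle being compact. *)
Definition max_modulus (R : realType) (f : R[i] -> R[i]) (r : R) : R :=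
  sup [set cmod (f z) | z in [set z | cmod z = r]].

(* Extended-real valued: finiteness for [r < 1] is not built into the
   definition. *)
Definition image_area (R : realType) (f : R[i] -> R[i]) (r : R) : \bar R :=
  area (f @` disk r).

(* Main.v *)
Require Import Defs.
From mathcomp Require Import all_boot all_order all_algebra.
From mathcomp Require Import complex.
From mathcomp Require Import all_classical all_reals all_analysis.
From mathcomp Require Import measurable_realfun ring lra.
Import Order.TTheory GRing.Theory Num.Theory.
Import numFieldNormedType.Exports.
Local Open Scope classical_set_scope.
Local Open Scope ring_scope.
Set Implicit Arguments.
Unset Strict Implicit.
Unset Printing Implicit Defensive.

(* Both limits follow from [|f z|^p (1 - |z|)^(alpha + 2) --> 0] as [|z| --> 1], since
   [f (disk r)] lies in a square of half side [sup_(|z| <= r) |f z|]. By the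
   Hardy-Littlewood trick, [|f z|^p] is at most a constant times its mean over a square
   centered at [z]; in the Bergman case this mean is controlled by the tail of a
   convergent integral.
   In the Hardy case univalence leaves at most one zero, so that in logarithmic
   coordinates [F = f \o exp] is zero free on a strip [A < s < 0] and [|F|^p = |G|^2]
   with [G] holomorphic. Since [G z * conj (G (2 m - conj z))] is holomorphic,
   the integral of [|G_s - G_s'|^2] over a period is [I s + I s' - 2 I ((s + s') / 2)]
   for [I s] the integral of [|F_s|^p]. Thus [I] is bounded and midpoint convex, it
   converges at [0], and the densities [|F_s|^p] are uniformly integrable, which is the
   missing little-o. *)

(** A bound on the [p]-means alone yields only a big-O. In the weighted case the gain is the tail of
    the integral near the circle; in the Hardy case the mass could a priori concentrate on ever
    shorter arcs, and excluding this is the hard point. All lines [Re z = s] near [0] are compared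
    with one fixed line, on which the density is bounded. The comparison is an [L^2] identity, so
    [|F|^p] has to be a square: this is why [G = exp ((p / 2) log F)], and hence a logarithm of [F],
    is built. [G] is periodic only up to a unimodular factor, which cancels in the product of [G]
    with its conjugate reflection. The exponent [alpha + 2] counts dimensions: a square of side
    comparable to [1 - |z|] gives [2] by its area and [alpha] by the weight. In the Hardy case the
    slices of the square have mass [o(1)], so its area integral is [o(1 - |z|)] and the exponent is
    [1]. Contours are rectangles throughout: line integrals become integrals over intervals, and
    bisection is the compactness argument. A Cauchy inequality suffices, so the value [2 pi] of the
    contour integral of [1 / z] is never computed. *)

Section ComplexModulus.
Context {R : realType}.
Implicit Types z w : R[i].

Lemma normCE z : `|z| = (cmod z)%:C%C.
Proof. by []. Qed.

Lemma cmodE z : cmod z = Num.sqrt (complex.Re z ^+ 2 + complex.Im z ^+ 2).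
Proof. by case: z. Qed.

Lemma cmod_ge0 z : 0 <= cmod z.
Proof. by rewrite cmodE sqrtr_ge0. Qed.

Lemma cmod0 : cmod (0 : R[i]) = 0.
Proof. exact: ComplexField.Normc.normc0. Qed.

Lemma cmod1 : cmod (1 : R[i]) = 1.
Proof. exact: ComplexField.Normc.normc1. Qed.

Lemma cmod_eq0 z : (cmod z == 0) = (z == 0).
Proof.
apply/eqP/eqP => [|->]; last exact: cmod0.
exact: ComplexField.Normc.eq0_normc.
Qed.

Lemma cmod_gt0 z : (0 < cmod z) = (z != 0).
Proof. by rewrite lt_def cmod_eq0 cmod_ge0 andbT. Qed.

Lemma cmodD z w : cmod (z + w) <= cmod z + cmod w.
Proof. exact: le_normcD. Qed.

Lemma cmodN z : cmod (- z) = cmod z.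
Proof. exact: normcN. Qed.

Lemma cmod_distC z w : cmod (z - w) = cmod (w - z).
Proof. by rewrite -cmodN opprB. Qed.

Lemma cmodM z w : cmod (z * w) = cmod z * cmod w.
Proof. exact: ComplexField.Normc.normcM. Qed.

Lemma cmodV z : cmod z^-1 = (cmod z)^-1.
Proof. exact: ComplexField.Normc.normcV. Qed.

Lemma cmodX z n : cmod (z ^+ n) = cmod z ^+ n.
Proof.
by elim: n => [|n IH]; rewrite ?expr0 ?cmod1// !exprS cmodM IH.
Qed.

Lemma sqr_cmod z : cmod z ^+ 2 = complex.Re z ^+ 2 + complex.Im z ^+ 2.
Proof. by rewrite cmodE sqr_sqrtr// addr_ge0// sqr_ge0. Qed.

Lemma cmod_real (x : R) : cmod x%:C%C = `|x|.
Proof. by rewrite cmodE /= expr0n addr0 sqrtr_sqr. Qed.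

Lemma cmod_Re z : `|complex.Re z| <= cmod z.
Proof.
rewrite -(ler_sqr (y := cmod z)) ?nnegrE ?normr_ge0 ?cmod_ge0//.
by rewrite sqr_cmod real_normK ?num_real// lerDl sqr_ge0.
Qed.

Lemma cmod_Im z : `|complex.Im z| <= cmod z.
Proof.
rewrite -(ler_sqr (y := cmod z)) ?nnegrE ?normr_ge0 ?cmod_ge0//.
by rewrite sqr_cmod real_normK ?num_real// lerDr sqr_ge0.
Qed.

Lemma cmod_le_ReIm z : cmod z <= `|complex.Re z| + `|complex.Im z|.
Proof.
rewrite -ler_sqr ?nnegrE ?addr_ge0 ?normr_ge0 ?cmod_ge0//.
rewrite sqr_cmod sqrrD !real_normK ?num_real//.
by rewrite addrAC lerDl mulrn_wge0// mulr_ge0.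
Qed.

Lemma cmod_conj z : cmod (conjc z) = cmod z.
Proof. by case: z => a b; rewrite !cmodE /= sqrrN. Qed.

Lemma ler_dist_cmod z w : `|cmod z - cmod w| <= cmod (z - w).
Proof.
have h1 := cmodD (z - w) w; rewrite subrK in h1.
have h2 := cmodD (w - z) z; rewrite subrK cmod_distC in h2.
by rewrite ler_norml; apply/andP; split; lra.
Qed.

End ComplexModulus.

(** * Continuity and complex differentiability relative to a set *)

Section WithinCalculus.
Context {R : realType}.
Implicit Types (D : set R[i]) (f g : R[i] -> R[i]) (w z : R[i]).

Definition ccont D f w : Prop :=
  (f z : R[i]^o) @[z --> within D (nbhs (w : R[i]^o))] --> (f w : R[i]^o).

(* Caratheodory's form of complex differentiability relative to [D]. *)
Definition cdiff D f w : Prop :=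
  exists2 q : R[i] -> R[i], ccont D q w &
    forall z, D z -> f z - f w = q z * (z - w).

(** The norm of [R[i]] takes values in [R[i]], where a positive element has zero imaginary part.
    Radii and tolerances can therefore be moved to [R]. *)
Lemma ccontP D f w : ccont D f w <->
  forall e : R, 0 < e -> exists2 d : R, 0 < d &
    forall z, D z -> cmod (z - w) < d -> cmod (f z - f w) <= e.
Proof.
rewrite /ccont; split=> [/cvgrPdist_le H e e0|H].
  have /H : (0 : R[i]) < e%:C%C by rewrite ltcR.
  rewrite near_withinE => /nbhs_ballP[d /= d0 dP].
  have [Re0 Ed] : 0 < complex.Re d /\ d = (complex.Re d)%:C%C.
    by move: d0; case: (d) => a b; rewrite ltcE /= => /andP[/eqP -> ->].
  exists (complex.Re d) => // z Dz zd.
  have := dP z; rewrite /ball /= Ed !normCE ltcR (cmod_distC w) => /(_ zd Dz).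
  by rewrite lecR (cmod_distC (f w)).
apply/cvgrPdist_le => e e0.
have [Re0 Ee] : 0 < complex.Re e /\ e = (complex.Re e)%:C%C.
  by move: e0; case: (e) => a b; rewrite ltcE /= => /andP[/eqP -> ->].
have [d d0 dP] := H _ Re0.
rewrite near_withinE; apply/nbhs_ballP; exists d%:C%C => /=; first by rewrite ltcR.
move=> z; rewrite /ball /= normCE ltcR => zd Dz.
by rewrite Ee normCE lecR cmod_distC; apply: dP => //; rewrite cmod_distC.
Qed.

Lemma ccontS D D' f w : D `<=` D' -> ccont D' f w -> ccont D f w.
Proof.
move=> DD' /ccontP H; apply/ccontP => e /H[d d0 P]; exists d => // z Dz.
by apply: P; exact: DD'.
Qed.

Lemma ccont_cst D (c : R[i]) w : ccont D (fun=> c) w.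
Proof. exact: cvg_cst. Qed.

Lemma ccont_id D w : ccont D id w.
Proof. by apply/ccontP => e e0; exists e => // z _ /ltW. Qed.

Lemma ccontD D f g w : ccont D f w -> ccont D g w -> ccont D (f \+ g) w.
Proof. by move=> hf hg; apply: (cvgD hf hg). Qed.

Lemma ccontM D f g w : ccont D f w -> ccont D g w -> ccont D (f \* g) w.
Proof. by move=> hf hg; apply: (cvgM hf hg). Qed.

Lemma ccontV D f w : f w != 0 -> ccont D f w -> ccont D (fun z => (f z)^-1) w.
Proof. by move=> f0 hf; apply: (cvgV f0 hf). Qed.

Lemma eq_ccont D f g w : (forall z, D z -> f z = g z) -> f w = g w ->
  ccont D f w -> ccont D g w.
Proof.
move=> fg fgw /ccontP H; apply/ccontP => e /H[d d0 P]; exists d => // z Dz.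
by rewrite -fg// -fgw; exact: P.
Qed.

Lemma ccont_comp D E f g w : (forall z, D z -> E (f z)) ->
  ccont D f w -> ccont E g (f w) -> ccont D (g \o f) w.
Proof.
move=> DE /ccontP hf /ccontP hg; apply/ccontP => e /hg[d d0 P].
have [d' d'0 P'] := hf (d / 2) (ltac:(lra)); exists d' => // z Dz zd /=.
apply: P; first exact: DE.
by have := P' z Dz zd; lra.
Qed.

Lemma cdiff_ccont D f w : cdiff D f w -> ccont D f w.
Proof.
move=> [q qc qE].
have : ccont D ((fun=> f w) \+ (q \* (id \+ (fun=> - w)))) w.
  exact (ccontD (@ccont_cst _ _ _) (ccontM qc (ccontD (@ccont_id _ _) (@ccont_cst _ _ _)))).
apply: eq_ccont => [z Dz|] /=; last by rewrite subrr mulr0 addr0.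
by rewrite -qE// subrKC.
Qed.

Lemma cdiffS D D' f w : D `<=` D' -> cdiff D' f w -> cdiff D f w.
Proof.
move=> DD' [q qc qE]; exists q; first exact: ccontS qc.
by move=> z /DD'/qE.
Qed.

Lemma eq_cdiff D f g w : (forall z, D z -> f z = g z) -> f w = g w ->
  cdiff D f w -> cdiff D g w.
Proof. by move=> fg fgw [q qc qE]; exists q => // z Dz; rewrite -fg// -fgw qE. Qed.

Lemma cdiff_cst D (c : R[i]) w : cdiff D (fun=> c) w.
Proof.
by exists (fun=> 0); [exact: ccont_cst|move=> z _; rewrite subrr mul0r].
Qed.

Lemma cdiff_id D w : cdiff D id w.
Proof. by exists (fun=> 1); [exact: ccont_cst|move=> z _; rewrite mul1r]. Qed.

Lemma cdiffD D f g w : cdiff D f w -> cdiff D g w -> cdiff D (f \+ g) w.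
Proof.
move=> [q qc qE] [r rc rE]; exists (q \+ r); first exact (ccontD qc rc).
by move=> z Dz /=; rewrite mulrDl -(qE z Dz) -(rE z Dz) addrACA opprD.
Qed.

Lemma cdiffM D f g w : cdiff D f w -> cdiff D g w -> cdiff D (f \* g) w.
Proof.
move=> hf hg; have gc := cdiff_ccont hg.
move: hf hg => [q qc qE] [r rc rE]; exists ((q \* g) \+ ((fun=> f w) \* r)).
  exact (ccontD (ccontM qc gc) (ccontM (@ccont_cst _ _ _) rc)).
move=> z Dz /=; rewrite mulrDl [X in _ = X + _]mulrAC -(qE z Dz) -[X in _ = _ + X]mulrA -(rE z Dz).
by rewrite mulrBl mulrBr addrA subrK.
Qed.

Lemma cdiffX D f n w : cdiff D f w -> cdiff D (fun z => f z ^+ n) w.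
Proof.
move=> hf; elim: n => [|n IH]; first exact: cdiff_cst.
have := cdiffM hf IH; apply: eq_cdiff => [z _|] /=; by rewrite exprS.
Qed.

Lemma cdiffV D f w : (forall z, D z -> f z != 0) -> f w != 0 ->
  cdiff D f w -> cdiff D (fun z => (f z)^-1) w.
Proof.
move=> f0 fw0 hf; have fc := cdiff_ccont hf; move: hf => [q qc qE].
exists (((fun=> - (f w)^-1) \* (fun z => (f z)^-1)) \* q).
  exact (ccontM (ccontM (@ccont_cst _ _ _) (ccontV fw0 fc)) qc).
move=> z Dz /=; rewrite -[RHS]mulrA -(qE z Dz) mulrBr -mulrA mulVf ?f0// mulr1.
by rewrite [X in _ = _ - X]mulrAC mulNr mulVf// mulN1r opprK addrC.
Qed.

Lemma cdiff_comp D E f g w : (forall z, D z -> E (f z)) ->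
  cdiff D f w -> cdiff E g (f w) -> cdiff D (g \o f) w.
Proof.
move=> DE hf; have fc := cdiff_ccont hf; move: hf => [q qc qE] [r rc rE].
exists ((r \o f) \* q); first exact (ccontM (ccont_comp DE fc rc) qc).
by move=> z Dz /=; rewrite rE ?qE ?mulrA//; exact: DE.
Qed.

(* The difference quotient is extended by its limit at [w] itself. *)
Lemma derivable_cdiff D f w : derivable (f : R[i]^o -> R[i]^o) w 1 ->
  cdiff D f w.
Proof.
move=> /cvg_ex[/= l /cvgrPdist_le H].
exists (fun z => if z == w then l else (f z - f w) / (z - w)); last first.
  move=> z Dz; case: eqVneq => [->|zw]; first by rewrite !subrr mulr0.
  by rewrite divfK// subr_eq0.
apply/ccontP => e e0.
have /H : (0 : R[i]) < e%:C%C by rewrite ltcR.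
rewrite near_withinE => /nbhs_ballP[d /= d0 dP].
have [Re0 Ed] : 0 < complex.Re d /\ d = (complex.Re d)%:C%C.
  by move: d0; case: (d) => a b; rewrite ltcE /= => /andP[/eqP -> ->].
exists (complex.Re d) => // z Dz zd; rewrite eqxx.
case: eqVneq => [_|zw]; first by rewrite subrr cmod0 ltW.
have := dP (z - w); rewrite /ball /= sub0r normrN Ed !normCE ltcR => /(_ zd).
rewrite subr_eq0 => /(_ zw); rewrite lecR cmod_distC.
by rewrite /GRing.scale /= mulr1 subrK mulrC.
Qed.

End WithinCalculus.

#[global] Opaque ccont.

(** * Bisection of rectangles *)

Section RectangleInduction.
Context {R : realType}.

Definition rect (a b c d : R) : set R[i] :=
  [set z | a <= complex.Re z <= b /\ c <= complex.Im z <= d].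

Lemma rectS (a b c d a' b' c' d' : R) : a' <= a -> b <= b' -> c' <= c -> d <= d' ->
  rect a b c d `<=` rect a' b' c' d'.
Proof.
move=> h1 h2 h3 h4 z [/andP[z1 z2] /andP[z3 z4]].
by split; apply/andP; split; lra.
Qed.

Lemma nested_intervals (u v : nat -> R) :
  (forall n, u n <= u n.+1) -> (forall n, v n.+1 <= v n) ->
  (forall n, u n <= v n) -> exists x, forall n, u n <= x <= v n.
Proof.
move=> hu hv uv; have um m n : (m <= n)%N -> u m <= u n.
  by apply: (homo_leq (r := fun x y => x <= y)) => // ? ? ?; exact: le_trans.
have vm m n : (m <= n)%N -> v n <= v m.
  apply: (homo_leq (r := fun x y => y <= x)) => // x y z h1 h2.
  exact: le_trans h2 h1.
have ub n : ubound (range u) (v n).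
  move=> _ [m _ <-]; have [mn|/ltnW nm] := leqP m n.
    exact: le_trans (um _ _ mn) (uv n).
  exact: le_trans (uv m) (vm _ _ nm).
exists (sup (range u)) => n; apply/andP; split.
  by apply: ub_le_sup; [exists (v 0%N); exact: ub|exists n].
by apply: ge_sup; [exists (u 0%N), 0%N|exact: ub].
Qed.

Lemma exists_half_pow_lt (x e : R) : 0 < e -> exists n, x / 2 ^+ n < e.
Proof.
move=> e0; have [n hn] : exists n : nat, `|x| / e < n%:R.
  by exists (Num.bound (`|x| / e)); rewrite archi_boundP// divr_ge0// ltW.
exists n; rewrite ltr_pdivrMr ?exprn_gt0//.
apply: le_lt_trans (ler_norm x) _; rewrite mulrC -ltr_pdivrMr//.
apply: lt_trans hn _; rewrite -natrX ltr_nat; exact: ltn_expl.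
Qed.

(** If [P] failed, it would fail on one of the four quarters, then on a quarter of that, and so on;
    the nested rectangles shrink to a point [w], where the local hypothesis is contradicted. This
    one principle serves for Goursat's theorem, for boundedness on compact sets and for gluing
    logarithms. *)
Lemma rectangle_ind (P : R -> R -> R -> R -> Prop) (a b c d : R) :
  a <= b -> c <= d ->
  (forall a' b' c' d', a' <= b' -> c' <= d' ->
     let m := (a' + b') / 2 in let n := (c' + d') / 2 in
     P a' m c' n -> P m b' c' n -> P a' m n d' -> P m b' n d' ->
     P a' b' c' d') ->
  (forall w, rect a b c d w -> exists2 e, 0 < e & forall a' b' c' d',
     a <= a' -> b' <= b -> c <= c' -> d' <= d -> rect a' b' c' d' w ->
     b' - a' < e -> d' - c' < e -> P a' b' c' d') ->
  P a b c d.
Proof.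
move=> ab cd Hsplit Hloc; apply: contrapT => nP.
pose bad (s : R * R * R * R) := [/\ s.1.1.1 <= s.1.1.2, s.1.2 <= s.2 &
  ~ P s.1.1.1 s.1.1.2 s.1.2 s.2].
pose half (u v u' v' : R) := u' = u /\ v' = (u + v) / 2 \/ u' = (u + v) / 2 /\ v' = v.
(* Badness is placed after the existential so that [choice] yields a total map that can be
   iterated. *)
have step s : exists s', bad s -> [/\ bad s', half s.1.1.1 s.1.1.2 s'.1.1.1 s'.1.1.2
    & half s.1.2 s.2 s'.1.2 s'.2].
  case: s => [[[a' b'] c'] d']; have [[/= ab' cd' nP']|?] := pselect (bad (a', b', c', d')); last first.
    by exists (a', b', c', d').
  pose m := (a' + b') / 2; pose n := (c' + d') / 2.
  have [am mb] : a' <= m /\ m <= b' by rewrite /m; split; lra.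
  have [cn nd] : c' <= n /\ n <= d' by rewrite /n; split; lra.
  have [p1|p1] := pselect (P a' m c' n); last first.
    by exists (a', m, c', n) => _; split; [split|left|left].
  have [p2|p2] := pselect (P m b' c' n); last first.
    by exists (m, b', c', n) => _; split; [split|right|left].
  have [p3|p3] := pselect (P a' m n d'); last first.
    by exists (a', m, n, d') => _; split; [split|left|right].
  have [p4|p4] := pselect (P m b' n d'); last first.
    by exists (m, b', n, d') => _; split; [split|right|right].
  by case: nP'; apply: Hsplit.
have [nxt nxtP] := choice step.
pose s n := iter n nxt (a, b, c, d).
have sbad n : bad (s n).
  by elim: n => [|n IH] //=; have [] := nxtP _ IH.
have sh n : half (s n).1.1.1 (s n).1.1.2 (s n.+1).1.1.1 (s n.+1).1.1.2 /\
     half (s n).1.2 (s n).2 (s n.+1).1.2 (s n.+1).2.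
  by have [] := nxtP _ (sbad n).
have wid n : (s n).1.1.2 - (s n).1.1.1 = (b - a) / 2 ^+ n /\
    (s n).2 - (s n).1.2 = (d - c) / 2 ^+ n.
  elim: n => [|n [IH1 IH2]]; first by rewrite !expr0 !divr1.
  have e1 : (b - a) / 2 ^+ n.+1 = ((b - a) / 2 ^+ n) / 2.
    by rewrite exprS invfM mulrA mulrAC.
  have e2 : (d - c) / 2 ^+ n.+1 = ((d - c) / 2 ^+ n) / 2.
    by rewrite exprS invfM mulrA mulrAC.
  rewrite e1 e2 -IH1 -IH2.
  by have [[[-> ->]|[-> ->]] [[-> ->]|[-> ->]]] := sh n; split; lra.
have mono n : [/\ (s n).1.1.1 <= (s n.+1).1.1.1, (s n.+1).1.1.2 <= (s n).1.1.2,
   (s n).1.2 <= (s n.+1).1.2 & (s n.+1).2 <= (s n).2].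
  have [h1 h2 _] := sbad n.
  by have [[[-> ->]|[-> ->]] [[-> ->]|[-> ->]]] := sh n; split; lra.
have [x xP] : exists x, forall n, (s n).1.1.1 <= x <= (s n).1.1.2.
  by apply: nested_intervals => n; have [] := mono n; have [] := sbad n.
have [y yP] : exists y, forall n, (s n).1.2 <= y <= (s n).2.
  by apply: nested_intervals => n; have [] := mono n; have [] := sbad n.
have [e e0 He] := Hloc (x +i* y)%C (conj (xP 0%N) (yP 0%N)).
have [n1 hn1] := exists_half_pow_lt (b - a) e0.
have [n2 hn2] := exists_half_pow_lt (d - c) e0.
have [w1 _] := wid (n1 + n2)%N; have [_ w2] := wid (n1 + n2)%N.
have incl n : [/\ a <= (s n).1.1.1, (s n).1.1.2 <= b, c <= (s n).1.2 & (s n).2 <= d].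
  elim: n => [//|n [h1 h2 h3 h4]]; have [k1 k2 k3 k4] := mono n.
  by split; lra.
have [_ _] := sbad (n1 + n2)%N; apply.
have [i1 i2 i3 i4] := incl (n1 + n2)%N.
have p2 (k l : nat) : (2 : R) ^+ k <= 2 ^+ (k + l).
  by rewrite exprD ler_peMr ?exprn_ge0// exprn_ege1// ler1n.
apply: He => //.
- rewrite w1; apply: le_lt_trans hn1.
  by rewrite ler_wpM2l ?subr_ge0// lef_pV2 ?posrE ?exprn_gt0.
- rewrite w2; apply: le_lt_trans hn2.
  by rewrite ler_wpM2l ?subr_ge0// lef_pV2 ?posrE ?exprn_gt0// addnC.
Qed.

End RectangleInduction.

(** * Integrals of continuous functions over compact intervals *)

Section IntervalIntegral.
Context {R : realType}.
Implicit Types (f g : R -> R) (a b c m : R).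

Definition itg f a b : R := \int[lebesgue_measure]_(x in `[a, b]) f x.

Definition cont1 f a b := {within `[a, b], continuous (f : R -> R)}.

Lemma cont1P f a b : cont1 f a b <->
  forall x, x \in `[a, b] -> forall e, 0 < e -> exists2 d, 0 < d &
    forall y, y \in `[a, b] -> `|y - x| < d -> `|f y - f x| <= e.
Proof.
split=> [/subspace_continuousP H x xab e e0|H].
  have /cvgrPdist_le/(_ _ e0) := H _ xab.
  rewrite near_withinE => /nbhs_ballP[d /= d0 dP]; exists d => // y yab yx.
  by rewrite distrC; apply: dP => //; rewrite /ball /= distrC.
apply/subspace_continuousP => x xab; apply/cvgrPdist_le => e e0.
have [d d0 dP] := H x xab e e0.
rewrite near_withinE; apply/nbhs_ballP; exists d => // y yx yab.
by rewrite distrC; apply: dP => //; rewrite distrC.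
Qed.

Lemma cont1_integrable f a b : cont1 f a b ->
  lebesgue_measure.-integrable `[a, b] (EFin \o f).
Proof. by move=> fc; apply: continuous_compact_integrable => //; exact: segment_compact. Qed.

Lemma cont1S f a b a' b' : a <= a' -> b' <= b -> cont1 f a b -> cont1 f a' b'.
Proof.
move=> aa bb /cont1P H; apply/cont1P => x; rewrite in_itv /= => /andP[x1 x2] e e0.
have [|d d0 dP] := H x _ e e0; first by rewrite in_itv /=; apply/andP; split; lra.
exists d => // y; rewrite in_itv /= => /andP[y1 y2]; apply: dP.
by rewrite in_itv /=; apply/andP; split; lra.
Qed.

Lemma cont1_cst c a b : cont1 (fun=> c) a b.
Proof. by apply/cont1P => x _ e e0; exists 1 => // y _ _; rewrite subrr normr0 ltW. Qed.

Lemma eq_itg f g a b : (forall x, a <= x <= b -> f x = g x) -> itg f a b = itg g a b.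
Proof.
move=> fg; apply: eq_Rintegral => x; rewrite inE /= in_itv /=; exact: fg.
Qed.

Lemma itgD f g a b : cont1 f a b -> cont1 g a b ->
  itg (fun x => f x + g x) a b = itg f a b + itg g a b.
Proof. by move=> hf hg; rewrite /itg RintegralD//; exact: cont1_integrable. Qed.

Lemma itgB f g a b : cont1 f a b -> cont1 g a b ->
  itg (fun x => f x - g x) a b = itg f a b - itg g a b.
Proof. by move=> hf hg; rewrite /itg RintegralB//; exact: cont1_integrable. Qed.

Lemma itgZ f c a b : cont1 f a b -> itg (fun x => c * f x) a b = c * itg f a b.
Proof. by move=> hf; rewrite /itg RintegralZl//; exact: cont1_integrable. Qed.

Lemma itg_cst c a b : a <= b -> itg (fun=> c) a b = c * (b - a).
Proof.
move=> ab; rewrite /itg Rintegral_cst//; congr (_ * _).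
have /(congr1 fine) /= := @lebesgue_measure_itv R `[a, b].
rewrite lte_fin; case: ltP => //= ba ->; lra.
Qed.

Lemma itg_split f a m b : a <= m -> m <= b -> cont1 f a b ->
  itg f a b = itg f a m + itg f m b.
Proof.
move=> am mb fc; have fi := cont1_integrable fc; rewrite /itg.
have := @Rintegral_itvB _ f (BLeft a) (BRight b) m fi.
rewrite !bnd_simp => /(_ am mb) H.
rewrite -[X in _ = _ + X]Rintegral_itv_obnd_cbnd.
  by rewrite -H addrC subrK.
apply: integrableS fi => //; apply: subset_itvr; by rewrite bnd_simp.
Qed.

Lemma le_itg f g a b : cont1 f a b -> cont1 g a b ->
  (forall x, a <= x <= b -> f x <= g x) -> itg f a b <= itg g a b.
Proof.
by move=> hf hg fg; apply: le_Rintegral => //; exact: cont1_integrable.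
Qed.

Lemma itg_ge0 f a b : (forall x, a <= x <= b -> 0 <= f x) -> 0 <= itg f a b.
Proof. by move=> f0; apply: Rintegral_ge0 => x /=; rewrite in_itv; exact: f0. Qed.

Lemma itg_norm_le f M a b : a <= b -> cont1 f a b ->
  (forall x, a <= x <= b -> `|f x| <= M) -> `|itg f a b| <= M * (b - a).
Proof.
move=> ab hf H; rewrite ler_norml -mulNr -!itg_cst//; apply/andP; split;
  apply: le_itg => //; try exact: cont1_cst; by move=> x /H; rewrite ler_norml => /andP[].
Qed.

End IntervalIntegral.

(** * Goursat's theorem on rectangles *)

Section Goursat.
Context {R : realType}.
Implicit Types (k h : R[i] -> R[i]) (a b c d x y : R).

(** The 1-Lipschitz [phi] stands for the real part, the imaginary part and the modulus, all three of
    which are integrated along sides. *)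
Lemma cont1_horizontal (phi : R[i] -> R) (D : set R[i]) k a b y :
  (forall z w, `|phi z - phi w| <= cmod (z - w)) ->
  (forall x, a <= x <= b -> D (x +i* y)%C /\ ccont D k (x +i* y)%C) ->
  cont1 (fun x => phi (k (x +i* y)%C)) a b.
Proof.
move=> lip H; apply/cont1P => x; rewrite in_itv /= => xab e e0.
have [_ /ccontP/(_ e e0)[r r0 rP]] := H x xab.
exists r => // t; rewrite in_itv /= => tab tx.
apply: le_trans (lip _ _) _; apply: rP; first by case: (H t tab).
apply: le_lt_trans (cmod_le_ReIm _) _.
by rewrite /= subrr normr0 addr0.
Qed.

Lemma cont1_vertical (phi : R[i] -> R) (D : set R[i]) k c d x :
  (forall z w, `|phi z - phi w| <= cmod (z - w)) ->
  (forall y, c <= y <= d -> D (x +i* y)%C /\ ccont D k (x +i* y)%C) ->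
  cont1 (fun y => phi (k (x +i* y)%C)) c d.
Proof.
move=> lip H; apply/cont1P => y; rewrite in_itv /= => ycd e e0.
have [_ /ccontP/(_ e e0)[r r0 rP]] := H y ycd.
exists r => // t; rewrite in_itv /= => tcd ty.
apply: le_trans (lip _ _) _; apply: rP; first by case: (H t tcd).
apply: le_lt_trans (cmod_le_ReIm _) _.
by rewrite /= subrr normr0 add0r.
Qed.

Lemma Re_lipschitz (z w : R[i]) : `|complex.Re z - complex.Re w| <= cmod (z - w).
Proof. by have := cmod_Re (z - w); case: z w => [? ?] [? ?]. Qed.

Lemma Im_lipschitz (z w : R[i]) : `|complex.Im z - complex.Im w| <= cmod (z - w).
Proof. by have := cmod_Im (z - w); case: z w => [? ?] [? ?]. Qed.

Definition boundary_cont (phi : R[i] -> R) k a b c d :=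
  [/\ cont1 (fun x => phi (k (x +i* c)%C)) a b, cont1 (fun x => phi (k (x +i* d)%C)) a b,
      cont1 (fun y => phi (k (a +i* y)%C)) c d & cont1 (fun y => phi (k (b +i* y)%C)) c d].

Lemma boundary_contP (phi : R[i] -> R) (D : set R[i]) k a b c d :
  (forall z w, `|phi z - phi w| <= cmod (z - w)) ->
  (forall x, a <= x <= b -> D (x +i* c)%C /\ D (x +i* d)%C) ->
  (forall y, c <= y <= d -> D (a +i* y)%C /\ D (b +i* y)%C) ->
  (forall w, D w -> ccont D k w) ->
  boundary_cont phi k a b c d.
Proof.
move=> lip Dh Dv H; split; [apply: (@cont1_horizontal phi D)|apply: (@cont1_horizontal phi D)
  |apply: (@cont1_vertical phi D)|apply: (@cont1_vertical phi D)] => // t tt.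
- by have [h _] := Dh t tt; split => //; exact: H.
- by have [_ h] := Dh t tt; split => //; exact: H.
- by have [h _] := Dv t tt; split => //; exact: H.
- by have [_ h] := Dv t tt; split => //; exact: H.
Qed.

(* The imaginary part of the integral of [k] along the boundary of the rectangle. *)
Definition Lam k a b c d : R :=
  itg (fun x => complex.Im (k (x +i* c)%C)) a b
  - itg (fun x => complex.Im (k (x +i* d)%C)) a b
  + itg (fun y => complex.Re (k (b +i* y)%C)) c d
  - itg (fun y => complex.Re (k (a +i* y)%C)) c d.

Lemma Lam_hsplit k a m b c d : a <= m -> m <= b ->
  cont1 (fun x => complex.Im (k (x +i* c)%C)) a b ->
  cont1 (fun x => complex.Im (k (x +i* d)%C)) a b ->
  Lam k a b c d = Lam k a m c d + Lam k m b c d.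
Proof.
move=> am mb h1 h2; rewrite /Lam (itg_split am mb h1) (itg_split am mb h2); ring.
Qed.

Lemma Lam_vsplit k a b c m d : c <= m -> m <= d ->
  cont1 (fun y => complex.Re (k (a +i* y)%C)) c d ->
  cont1 (fun y => complex.Re (k (b +i* y)%C)) c d ->
  Lam k a b c d = Lam k a b c m + Lam k a b m d.
Proof.
move=> cm md h1 h2; rewrite /Lam (itg_split cm md h1) (itg_split cm md h2); ring.
Qed.

Lemma LamB f g a b c d :
  boundary_cont (@complex.Re R) f a b c d -> boundary_cont (@complex.Im R) f a b c d ->
  boundary_cont (@complex.Re R) g a b c d -> boundary_cont (@complex.Im R) g a b c d ->
  Lam (fun z => f z - g z) a b c d = Lam f a b c d - Lam g a b c d.
Proof.
move=> [_ _ f1 f2] [f3 f4 _ _] [_ _ g1 g2] [g3 g4 _ _]; rewrite /Lam.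
have E1 z w : complex.Im (z - w) = complex.Im z - complex.Im w :> R by case: z w => [? ?] [].
have E2 z w : complex.Re (z - w) = complex.Re z - complex.Re w :> R by case: z w => [? ?] [].
under [itg (fun x => complex.Im (f (x +i* c)%C - _)) _ _]eq_itg do rewrite E1.
under [itg (fun x => complex.Im (f (x +i* d)%C - _)) _ _]eq_itg do rewrite E1.
under [itg (fun x => complex.Re (f (a +i* x)%C - _)) _ _]eq_itg do rewrite E2.
under [itg (fun x => complex.Re (f (b +i* x)%C - _)) _ _]eq_itg do rewrite E2.
by rewrite !itgB//; ring.
Qed.

(** On opposite sides the integrands differ by a constant multiple of [Re q]: the horizontal pair
    contributes [Re q (c - d) (b - a)], the vertical pair its opposite. *)
Lemma Lam_affine (p q : R[i]) a b c d : a <= b -> c <= d ->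
  Lam (fun z => p + q * z) a b c d = 0.
Proof.
move=> ab cd; pose k := fun z => p + q * z.
have kc z : ccont setT k z.
  exact: (ccontD (@ccont_cst _ _ _ _) (ccontM (@ccont_cst _ _ _ _) (@ccont_id _ _ _))).
have [_ _ f1 f2] : boundary_cont (@complex.Re R) k a b c d.
  by apply: (@boundary_contP _ setT) => //; exact: Re_lipschitz.
have [f3 f4 _ _] : boundary_cont (@complex.Im R) k a b c d.
  by apply: (@boundary_contP _ setT) => //; exact: Im_lipschitz.
rewrite /Lam -addrA -itgB// -itgB//.
rewrite (@eq_itg _ _ (fun=> complex.Re q * (c - d))); last first.
  by move=> x _; case: p q {k kc f1 f2 f3 f4} => [p1 p2] [q1 q2] /=; ring.
rewrite [X in _ + X](@eq_itg _ _ (fun=> complex.Re q * (b - a))); last first.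
  by move=> x _; case: p q {k kc f1 f2 f3 f4} => [p1 p2] [q1 q2] /=; ring.
by rewrite !itg_cst//; ring.
Qed.

Lemma Lam_norm_le k M a b c d : a <= b -> c <= d ->
  boundary_cont (@complex.Re R) k a b c d -> boundary_cont (@complex.Im R) k a b c d ->
  (forall z, rect a b c d z -> cmod (k z) <= M) ->
  `|Lam k a b c d| <= 2 * M * ((b - a) + (d - c)).
Proof.
move=> ab cd [_ _ f1 f2] [f3 f4 _ _] H.
have hi x : a <= x <= b -> cmod (k (x +i* c)%C) <= M /\ cmod (k (x +i* d)%C) <= M.
  by move=> xab; split; apply: H; split => //=; rewrite lexx ?andbT.
have vi y : c <= y <= d -> cmod (k (a +i* y)%C) <= M /\ cmod (k (b +i* y)%C) <= M.
  by move=> xab; split; apply: H; split => //=; rewrite lexx ?andbT.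
have := itg_norm_le ab f3 (fun x xab => le_trans (cmod_Im _) (proj1 (hi x xab))).
have := itg_norm_le ab f4 (fun x xab => le_trans (cmod_Im _) (proj2 (hi x xab))).
have := itg_norm_le cd f1 (fun x xab => le_trans (cmod_Re _) (proj1 (vi x xab))).
have := itg_norm_le cd f2 (fun x xab => le_trans (cmod_Re _) (proj2 (vi x xab))).
rewrite /Lam !ler_norml => /andP[? ?] /andP[? ?] /andP[? ?] /andP[? ?].
by apply/andP; split; lra.
Qed.

(** The bound [|Lam| <= 2 eta (width + height)^2] passes from the quarters to the whole, and it
    holds on small rectangles around [w] because [k] differs from its affine approximation at [w] by
    at most [eta |z - w|], while affine maps integrate to [0]. *)
Lemma goursat k a b c d : a <= b -> c <= d ->
  (forall w, rect a b c d w -> cdiff (rect a b c d) k w) ->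
  Lam k a b c d = 0.
Proof.
move=> ab cd kd; have kc w (rw : rect a b c d w) := cdiff_ccont (kd w rw).
have bc phi a' b' c' d' : a <= a' -> a' <= b' -> b' <= b -> c <= c' -> c' <= d' -> d' <= d ->
    (forall z w, `|phi z - phi w| <= cmod (z - w)) -> boundary_cont phi k a' b' c' d'.
  move=> aa ab' bb cc cd' dd lip; apply: (@boundary_contP _ (rect a b c d)) => // t /andP[t1 t2];
  by split; (split; apply/andP; split => /=; lra).
suff small e : 0 < e -> `|Lam k a b c d| <= e.
  apply/eqP; rewrite -normr_le0; apply/ler_addgt0Pr => e e0.
  by rewrite add0r; exact: small.
move=> e0; pose L := ((b - a) + (d - c)) ^+ 2; have L0 : 0 <= L by exact: sqr_ge0.
pose eta := e / (2 * L + 1).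
have eta0 : 0 < eta by rewrite divr_gt0//; lra.
suff : a <= a /\ b <= b /\ c <= c /\ d <= d ->
    `|Lam k a b c d| <= 2 * eta * ((b - a) + (d - c)) ^+ 2.
  have E : eta * (2 * L + 1) = e by rewrite /eta divfK//; apply: lt0r_neq0; lra.
  by move=> /(_ ltac:(by rewrite !lexx)) /le_trans; apply; rewrite -/L; lra.
apply: (@rectangle_ind _ (fun a' b' c' d' => a <= a' /\ b' <= b /\ c <= c' /\ d' <= d ->
    `|Lam k a' b' c' d'| <= 2 * eta * ((b' - a') + (d' - c')) ^+ 2)) => //.
  move=> a' b' c' d' ab' cd' m n P1 P2 P3 P4 [aa [bb [cc dd]]].
  have [am mb] : a' <= m /\ m <= b' by rewrite /m; split; lra.
  have [cn nd] : c' <= n /\ n <= d' by rewrite /n; split; lra.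
  have [i1 i2 _ _] := bc _ a' b' c' d' aa ab' bb cc cd' dd Im_lipschitz.
  rewrite (@Lam_hsplit _ a' m b')//.
  have [_ _ i3 i4] := bc _ a' m c' d' aa am (le_trans mb bb) cc cd' dd Re_lipschitz.
  have [_ _ _ i5] := bc _ m b' c' d' (le_trans aa am) mb bb cc cd' dd Re_lipschitz.
  rewrite (@Lam_vsplit _ a' m c' n d')// (@Lam_vsplit _ m b' c' n d')//.
  move: P1 P2 P3 P4 => /(_ ltac:(lra)) P1 /(_ ltac:(lra)) P2 /(_ ltac:(lra)) P3 /(_ ltac:(lra)) P4.
  apply: le_trans (ler_normD _ _) _.
  apply: le_trans (lerD (ler_normD _ _) (ler_normD _ _)) _.
  apply: le_trans (lerD (lerD P1 P3) (lerD P2 P4)) _.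
  (* An equality: each quarter has half the semiperimeter, so four squares of it add up to the
     original one. *)
  rewrite le_eqVlt; apply/orP; left; apply/eqP; by rewrite /m /n; field.
move=> w rw; have [q qc qE] := kd w rw.
have [r r0 rP] := proj1 (ccontP _ _ _) qc eta eta0.
exists (r / 2); first by lra.
move=> a' b' c' d' aa bb cc dd [/andP[wa wb] /andP[wc wd]] br dr _.
have ab' : a' <= b' := le_trans wa wb; have cd' : c' <= d' := le_trans wc wd.
(* The affine approximation of [k] at [w]; the error is [(q z - q w) * (z - w)]. *)
pose g z := (k w - q w * w) + q w * z.
have gc z : ccont setT g z.
  exact: (ccontD (@ccont_cst _ _ _ _) (ccontM (@ccont_cst _ _ _ _) (@ccont_id _ _ _))).
have bg phi : (forall z w, `|phi z - phi w| <= cmod (z - w)) -> boundary_cont phi g a' b' c' d'.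
  move=> lip; exact (@boundary_contP phi setT g _ _ _ _ lip (fun _ _ => conj I I)
    (fun _ _ => conj I I) (fun z _ => gc z)).
have sub z : rect a' b' c' d' z -> rect a b c d z by apply: rectS.
pose s := (b' - a') + (d' - c').
have zs z : rect a' b' c' d' z -> cmod (z - w) <= s.
  move=> [/andP[z1 z2] /andP[z3 z4]]; apply: le_trans (cmod_le_ReIm _) _.
  case: z w wa wb wc wd z1 z2 z3 z4 {g gc bg qc qE rP rw} => [z1 z2] [w1 w2] /= *.
  by apply: lerD; rewrite ler_norml; apply/andP; split; lra.
have kg z : rect a' b' c' d' z -> cmod (k z - g z) <= eta * s.
  move=> rz; have -> : k z - g z = (q z - q w) * (z - w).
    by rewrite mulrBl -(qE z (sub z rz)) /g; ring.
  rewrite cmodM; apply: ler_pM (cmod_ge0 _) (cmod_ge0 _) _ (zs z rz).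
  apply: rP; first exact: sub.
  by apply: le_lt_trans (zs z rz) _; rewrite /s; lra.
have bkg phi : (forall z w, `|phi z - phi w| <= cmod (z - w)) ->
    boundary_cont phi (fun z => k z - g z) a' b' c' d'.
  move=> lip; apply: (@boundary_contP phi (rect a' b' c' d') (fun z => k z - g z) a' b' c' d' lip).
  - by move=> x xab; split; split => //=; rewrite lexx ?andbT.
  - by move=> x xab; split; split => //=; rewrite lexx ?andbT.
  move=> z rz; have kz := ccontS sub (kc z (sub z rz)).
  have gz := ccontS (@subsetT _ (rect a' b' c' d')) (gc z).
  have H := ccontD kz (ccontM (@ccont_cst _ (rect a' b' c' d') (-1) z) gz).
  by apply: (eq_ccont _ _ H) => [t _|] /=; rewrite mulN1r.
have Lg := Lam_affine (k w - q w * w) (q w) ab' cd'.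
have R1 := bc _ _ _ _ _ aa ab' bb cc cd' dd Re_lipschitz.
have I1 := bc _ _ _ _ _ aa ab' bb cc cd' dd Im_lipschitz.
have R2 := bg _ Re_lipschitz; have I2 := bg _ Im_lipschitz.
have := LamB R1 I1 R2 I2; rewrite Lg subr0 => <-.
have -> : 2 * eta * s ^+ 2 = 2 * (eta * s) * s by ring.
apply: Lam_norm_le => //.
- exact: bkg Re_lipschitz.
- exact: bkg Im_lipschitz.
Qed.

End Goursat.

(** * A lower bound replacing Cauchy's integral formula *)

Section CauchyInequality.
Context {R : realType}.
Implicit Types (h : R[i] -> R[i]) (a b c d s : R) (z w u : R[i]).

Lemma exists_phase z : exists2 u, cmod u = 1 & u * z = (cmod z)%:C%C.
Proof.
have [->|z0] := eqVneq z 0; first by exists 1; rewrite ?cmod1// mulr0 cmod0.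
exists ((cmod z)%:C%C / z); last by rewrite divfK.
by rewrite cmodM cmodV cmod_real ger0_norm ?cmod_ge0// divff// cmod_eq0.
Qed.

Lemma ReD z w : complex.Re (z + w) = complex.Re z + complex.Re w.
Proof. by case: z w => [? ?] []. Qed.

Lemma ReB z w : complex.Re (z - w) = complex.Re z - complex.Re w.
Proof. by case: z w => [? ?] []. Qed.

Lemma ImB z w : complex.Im (z - w) = complex.Im z - complex.Im w.
Proof. by case: z w => [? ?] []. Qed.

(** For [z = s + i t] with [|t| <= s], the real part of [1 / z] is [s / (s^2 + t^2) >= 1 / (2 s)],
    and [|1 / z| <= 1 / s] controls the error term. *)
Lemma Re_div_ge (A s e : R) u z : 0 < s -> 0 <= A -> cmod (u - A%:C%C) <= e ->
  complex.Re z = s -> `|complex.Im z| <= s ->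
  A / (2 * s) - e / s <= complex.Re (u / z).
Proof.
move=> s0 A0 ue zs zt; have sz : s <= cmod z.
  by rewrite -zs; apply: le_trans (ler_norm _) _; exact: cmod_Re.
have -> : u / z = A%:C%C / z + (u - A%:C%C) / z by rewrite mulrBl subrKC.
rewrite ReD; apply: lerD.
  case: z zs zt {sz} => x t /= -> ts.
  rewrite [X in _ <= X](_ : _ = A * (s / (s ^+ 2 + t ^+ 2))); last by ring.
  rewrite ler_wpM2l//.
  have ts2 : t ^+ 2 <= s ^+ 2.
    by rewrite -ler_sqrt ?exprn_ge0 ?(ltW s0)// !sqrtr_sqr [X in _ <= X]ger0_norm// ltW.
  rewrite ler_pdivlMr; last by rewrite ltr_pwDl ?sqr_ge0// exprn_gt0.
  by rewrite mulrC ler_pdivrMr; nra.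
rewrite lerNl; apply: le_trans (ler_norm _) _; rewrite normrN.
apply: le_trans (cmod_Re _) _; rewrite cmodM cmodV.
apply: ler_pM; rewrite ?invr_ge0 ?cmod_ge0//.
by rewrite lef_pV2 ?posrE//; exact: lt_le_trans sz.
Qed.

Lemma ReiM z : complex.Re ('i%C * z) = - complex.Im z.
Proof. by case: z => ? ? /=; ring. Qed.

Lemma ImiM z : complex.Im ('i%C * z) = complex.Re z.
Proof. by case: z => ? ? /=; ring. Qed.

Lemma i_neq0 : 'i%C != 0 :> R[i].
Proof. by rewrite eq_complex /= oner_eq0 andbF. Qed.

(* Rotating by a fourth root of unity reduces every side to the right-hand one. *)
Lemma Lam_div_square_ge h w s (A e : R) : 0 < s -> 0 <= A ->
  let a := complex.Re w - s in let b := complex.Re w + s in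
  let c := complex.Im w - s in let d := complex.Im w + s in
  let k := fun z => h z / (z - w) in
  boundary_cont (@complex.Re R) k a b c d -> boundary_cont (@complex.Im R) k a b c d ->
  (forall z, rect a b c d z -> cmod (h z - A%:C%C) <= e) ->
  4 * A - 8 * e <= Lam k a b c d.
Proof.
move=> s0 A0 a b c d k [_ _ r1 r2] [i1 i2 _ _] H.
(* The lower bound on every side; four sides of length [2 s] give [4 (A - 2 e)]. *)
pose m := A / (2 * s) - e / s.
have ab : a <= b by rewrite /a /b; lra.
have cd : c <= d by rewrite /c /d; lra.
have ms : m * (2 * s) = A - 2 * e by rewrite /m; field; apply: lt0r_neq0.
have sideb y : c <= y <= d -> m <= complex.Re (k (b +i* y)%C).
  move=> ycd; apply: Re_div_ge => //.
  - by apply: H; split => //=; rewrite ab lexx.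
  - by rewrite /b; case: (w) => ? ? /=; ring.
  - by move: ycd; rewrite /c /d; case: (w) => ? ? /= ?; rewrite ler_norml; lra.
have sidea y : c <= y <= d -> complex.Re (k (a +i* y)%C) <= - m.
  move=> ycd; rewrite lerNr.
  have -> : - complex.Re (k (a +i* y)%C) = complex.Re (h (a +i* y)%C / - ((a +i* y)%C - w)).
    by rewrite invrN mulrN /k; case: (_ / _).
  apply: Re_div_ge => //.
  - by apply: H; split => //=; rewrite ab lexx.
  - by rewrite /a; case: (w) => ? ? /=; ring.
  - by move: ycd; rewrite /c /d; case: (w) => ? ? /= ?; rewrite ler_norml; lra.
have sidec x : a <= x <= b -> m <= complex.Im (k (x +i* c)%C).
  move=> xab.
  have -> : complex.Im (k (x +i* c)%C) = complex.Re (h (x +i* c)%C / ('i%C * ((x +i* c)%C - w))).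
    rewrite invfM [_^-1 * _]mulrC mulrA -/(k _) -[k _ in LHS](divfK i_neq0).
    by rewrite [_ * 'i%C]mulrC ImiM.
  apply: Re_div_ge => //.
  - by apply: H; split => //=; rewrite cd lexx.
  - by rewrite ReiM /c; case: (w) => ? ? /=; ring.
  - by move: xab; rewrite ImiM /a /b; case: (w) => ? ? /= ?; rewrite ler_norml; lra.
have sided x : a <= x <= b -> complex.Im (k (x +i* d)%C) <= - m.
  move=> xab; rewrite lerNr.
  have -> : - complex.Im (k (x +i* d)%C) =
      complex.Re (h (x +i* d)%C / - ('i%C * ((x +i* d)%C - w))).
    rewrite invrN mulrN invfM [_^-1 * _]mulrC mulrA -/(k _) -[k _ in LHS](divfK i_neq0).
    by rewrite [_ * 'i%C]mulrC ImiM; case: (_ / _).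
  apply: Re_div_ge => //.
  - by apply: H; split => //=; rewrite cd lexx.
  - have -> : complex.Re (- ('i%C * ((x +i* d)%C - w))) = - complex.Re ('i%C * ((x +i* d)%C - w)).
      by case: (_ * _).
    by rewrite ReiM /d; case: (w) => ? ? /=; ring.
  - have -> : complex.Im (- ('i%C * ((x +i* d)%C - w))) = - complex.Im ('i%C * ((x +i* d)%C - w)).
      by case: (_ * _).
    by move: xab; rewrite normrN ImiM /a /b; case: (w) => ? ? /= ?; rewrite ler_norml; lra.
have ba : b - a = 2 * s by rewrite /b /a; ring.
have dc : d - c = 2 * s by rewrite /d /c; ring.
have := le_itg (@cont1_cst _ m c d) r2 sideb.
have := le_itg r1 (@cont1_cst _ (- m) c d) sidea.
have := le_itg (@cont1_cst _ m a b) i1 sidec.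
have := le_itg i2 (@cont1_cst _ (- m) a b) sided.
rewrite !itg_cst// ba dc mulNr ms /Lam; lra.
Qed.

(** By Goursat's theorem the contour can be shrunk to a tiny square around [w], on which [h] is
    nearly the constant [A]. The exact value would be [2 pi A]; the cruder factor [4] comes from
    bounding the integrand below on each side. *)
Lemma Lam_div_ge h w a b c d s (A : R) : 0 < s -> 0 <= A -> h w = A%:C%C ->
  a <= complex.Re w - s -> complex.Re w + s <= b ->
  c <= complex.Im w - s -> complex.Im w + s <= d ->
  (forall z, rect a b c d z -> cdiff (rect a b c d) h z) ->
  let k := fun z => h z / (z - w) in
  [/\ boundary_cont (@complex.Re R) k a b c d, boundary_cont (@complex.Im R) k a b c d &
      4 * A <= Lam k a b c d].
Proof.
move=> s0 A0 hw aw wb cw wd hd k.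
have ab : a <= b by lra.
have cd : c <= d by lra.
have rw : rect a b c d w by split; apply/andP; split; lra.
pose D := rect a b c d `\` [set w].
have DS : D `<=` rect a b c d by move=> z [].
have kd z : D z -> cdiff D k z.
  move=> Dz; have [rz zw] := Dz.
  have n0 t : D t -> t - w != 0 by move=> [_ /eqP]; rewrite subr_eq0.
  have sd : cdiff D (fun t => t + - w) z by exact (cdiffD (@cdiff_id _ _ _) (@cdiff_cst _ _ _ _)).
  exact (cdiffM (cdiffS DS (hd z rz)) (cdiffV n0 (n0 z Dz) sd)).
have kc z (Dz : D z) := cdiff_ccont (kd z Dz).
have neqRe (z : R[i]) : complex.Re z != complex.Re w -> z <> w by move=> /eqP h3 h4; case: h3; rewrite h4.
have neqIm (z : R[i]) : complex.Im z != complex.Im w -> z <> w by move=> /eqP h3 h4; case: h3; rewrite h4.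
have bc phi a' b' c' d' : a <= a' -> a' <= b' -> b' <= b -> c <= c' -> c' <= d' -> d' <= d ->
    a' != complex.Re w -> b' != complex.Re w -> c' != complex.Im w -> d' != complex.Im w ->
    (forall z w, `|phi z - phi w| <= cmod (z - w)) -> boundary_cont phi k a' b' c' d'.
  move=> aa ab' bb cc cd' dd na nb nc nd lip.
  apply: (@boundary_contP _ phi D k _ _ _ _ lip _ _ kc) => t /andP[t1 t2].
    by split; (split; [split; apply/andP; split => /=; lra|exact: neqIm]).
  by split; (split; [split; apply/andP; split => /=; lra|exact: neqRe]).
have bR a' b' c' d' e1 e2 e3 e4 e5 e6 e7 e8 e9 e10 := bc _ a' b' c' d' e1 e2 e3 e4 e5 e6 e7 e8 e9 e10 Re_lipschitz.
have bI a' b' c' d' e1 e2 e3 e4 e5 e6 e7 e8 e9 e10 := bc _ a' b' c' d' e1 e2 e3 e4 e5 e6 e7 e8 e9 e10 Im_lipschitz.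
have zero a' b' c' d' : a <= a' -> a' <= b' -> b' <= b -> c <= c' -> c' <= d' -> d' <= d ->
    (complex.Re w < a' \/ b' < complex.Re w) \/ (complex.Im w < c' \/ d' < complex.Im w) ->
    Lam k a' b' c' d' = 0.
  move=> aa ab' bb cc cd' dd off; apply: goursat => // z rz.
  have sub : rect a' b' c' d' `<=` D.
    move=> t [/andP[t1 t2] /andP[t3 t4]]; split; first by split; apply/andP; split; lra.
    by move=> tw; move: off t1 t2 t3 t4; rewrite tw => -[[]|[]]; lra.
  exact (cdiffS sub (kd z (sub z rz))).
have lower e : 0 < e -> 4 * A - 8 * e <= Lam k a b c d.
  move=> e0; have [r r0 rP] := proj1 (ccontP _ _ _) (cdiff_ccont (hd w rw)) e e0.
  (* [s] keeps the small square inside the rectangle; [r / 4] keeps its points within [2 t < r] of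
     [w]. *)
  pose t := Num.min s (r / 4).
  have t0 : 0 < t by rewrite lt_min s0 divr_gt0.
  have ts : t <= s by rewrite ge_min lexx.
  have tr : t <= r / 4 by rewrite ge_min lexx orbT.
  pose a1 := complex.Re w - t; pose b1 := complex.Re w + t.
  pose c1 := complex.Im w - t; pose d1 := complex.Im w + t.
  (* Around the small square the left and right strips and the blocks below and above it are cut
     off; each misses [w] and contributes [0]. *)
  have -> : Lam k a b c d = Lam k a1 b1 c1 d1.
    have [i1 i2 _ _] : boundary_cont (@complex.Im R) k a b c d.
      by apply: bI => //; apply/eqP; lra.
    rewrite (@Lam_hsplit _ k a a1 b c d) //; [|by rewrite /a1; lra..].
    have [i3 i4 _ _] : boundary_cont (@complex.Im R) k a1 b c d.
      by apply: bI => //; rewrite /a1; try lra; apply/eqP; lra.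
    rewrite (@Lam_hsplit _ k a1 b1 b c d) //; [|by rewrite /a1 /b1; lra..].
    have [_ _ r1 r2] : boundary_cont (@complex.Re R) k a1 b1 c d.
      by apply: bR => //; rewrite /a1 /b1; try lra; apply/eqP; lra.
    rewrite (@Lam_vsplit _ k a1 b1 c c1 d) //; [|by rewrite /c1; lra..].
    have [_ _ r3 r4] : boundary_cont (@complex.Re R) k a1 b1 c1 d.
      by apply: bR => //; rewrite /a1 /b1 /c1; try lra; apply/eqP; lra.
    rewrite (@Lam_vsplit _ k a1 b1 c1 d1 d) //; [|by rewrite /c1 /d1; lra..].
    have -> : Lam k a a1 c d = 0.
      by apply: zero; try (by rewrite /a1; lra); left; right; rewrite /a1; lra.
    have -> : Lam k b1 b c d = 0.
      by apply: zero; try (by rewrite /b1; lra); left; left; rewrite /b1; lra.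
    have -> : Lam k a1 b1 c c1 = 0.
      by apply: zero; try (by rewrite /a1 /b1 /c1; lra); right; right; rewrite /c1; lra.
    have -> : Lam k a1 b1 d1 d = 0.
      by apply: zero; try (by rewrite /a1 /b1 /d1; lra); right; left; rewrite /d1; lra.
    by rewrite addr0 add0r addr0 add0r.
  apply: Lam_div_square_ge => //.
  - by apply: bR => //; try lra; apply/eqP; lra.
  - by apply: bI => //; try lra; apply/eqP; lra.
  move=> z [/andP[z1 z2] /andP[z3 z4]].
  rewrite -hw; apply: rP; first by split; apply/andP; split; lra.
  apply: le_lt_trans (cmod_le_ReIm _) _.
  have : `|complex.Re (z - w)| <= t.
    by rewrite ReB ler_norml; lra.
  have : `|complex.Im (z - w)| <= t.
    by rewrite ImB ler_norml; lra.
  lra.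
split; [by apply: bR => //; apply/eqP; lra|by apply: bI => //; apply/eqP; lra|].
by apply/ler_addgt0Pr => e e0; have := lower (e / 8) (ltac:(lra)); lra.
Qed.

End CauchyInequality.

(** * Cauchy's inequality with the moduli on the four sides *)

Section CauchyInequalitySides.
Context {R : realType}.
Implicit Types (h : R[i] -> R[i]) (a b c d s : R) (z w u : R[i]).

Lemma cont1Z (r : R) (f : R -> R) (p q : R) : cont1 f p q -> cont1 (fun x => r * f x) p q.
Proof. by move=> fc x; apply: cvgM; [exact: cvg_cst|exact: fc]. Qed.

(** A unimodular factor makes [h w] real and nonnegative, so that the imaginary part of the contour
    integral is enough; every side is at distance at least [s] from [w], hence
    [1 / |z - w| <= 1 / s] there. *)
Lemma cauchy_inequality h w a b c d s : 0 < s ->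
  a <= complex.Re w - s -> complex.Re w + s <= b ->
  c <= complex.Im w - s -> complex.Im w + s <= d ->
  (forall z, rect a b c d z -> cdiff (rect a b c d) h z) ->
  4 * s * cmod (h w) <=
    itg (fun x => cmod (h (x +i* c)%C)) a b + itg (fun x => cmod (h (x +i* d)%C)) a b
    + itg (fun y => cmod (h (b +i* y)%C)) c d + itg (fun y => cmod (h (a +i* y)%C)) c d.
Proof.
move=> s0 aw wb cw wd hd.
have ab : a <= b by lra.
have cd : c <= d by lra.
have rw : rect a b c d w by split; apply/andP; split; lra.
have [u u1 uh] := exists_phase (h w).
pose h1 z := u * h z; pose k z := h1 z / (z - w).
have h1d z : rect a b c d z -> cdiff (rect a b c d) h1 z.
  by move=> rz; exact (cdiffM (@cdiff_cst _ _ _ _) (hd z rz)).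
have h1w : h1 w = (cmod (h w))%:C%C by [].
have [[_ _ r1 r2] [i1 i2 _ _] lower] := Lam_div_ge s0 (cmod_ge0 _) h1w aw wb cw wd h1d.
rewrite -/k in r1 r2 i1 i2 lower.
have cl (z t : R[i]) : `|cmod z - cmod t| <= cmod (z - t) by exact: ler_dist_cmod.
have [n1 n2 n3 n4] : boundary_cont (@cmod R) h a b c d.
  apply: (@boundary_contP _ _ (rect a b c d) h a b c d cl).
  - by move=> x xab; split; split => //=; rewrite lexx ?andbT.
  - by move=> x xab; split; split => //=; rewrite lexx ?andbT.
  - by move=> z rz; exact (cdiff_ccont (hd z rz)).
have kle z : s <= `|complex.Re (z - w)| \/ s <= `|complex.Im (z - w)| ->
    cmod (k z) <= s^-1 * cmod (h z).
  move=> sz; have sz' : s <= cmod (z - w).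
    by case: sz => /le_trans; apply; [exact: cmod_Re|exact: cmod_Im].
  rewrite /k /h1 !cmodM u1 mul1r mulrC cmodV ler_wpM2r ?cmod_ge0//.
  by rewrite lef_pV2 ?posrE//; exact: lt_le_trans sz'.
have cZ f p q : cont1 f p q -> cont1 (fun x => s^-1 * f x) p q.
  exact: cont1Z.
have sub2 (x y : R) : complex.Re ((x +i* y)%C - w) = x - complex.Re w
   /\ complex.Im ((x +i* y)%C - w) = y - complex.Im w by case: (w).
have L1 : itg (fun x => complex.Im (k (x +i* c)%C)) a b <= s^-1 * itg (fun x => cmod (h (x +i* c)%C)) a b.
  rewrite -itgZ//; apply: le_itg => //; first exact: cZ.
  move=> x _; apply: le_trans (ler_norm _) (le_trans (cmod_Im _) (kle _ _)); right.
  by rewrite (proj2 (sub2 _ _)) ler0_norm; lra.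
have L2 : - itg (fun x => complex.Im (k (x +i* d)%C)) a b <= s^-1 * itg (fun x => cmod (h (x +i* d)%C)) a b.
  rewrite lerNl -itgZ// -mulN1r -itgZ; last exact: cZ.
  apply: le_itg => //; first by apply: cont1Z; exact: cZ.
  move=> x _; rewrite mulN1r lerNl; apply: le_trans (ler_norm _) _; rewrite normrN.
  apply: (le_trans (cmod_Im _) (kle _ _)); right.
  by rewrite (proj2 (sub2 _ _)) ger0_norm; lra.
have L3 : itg (fun y => complex.Re (k (b +i* y)%C)) c d <= s^-1 * itg (fun y => cmod (h (b +i* y)%C)) c d.
  rewrite -itgZ//; apply: le_itg => //; first exact: cZ.
  move=> x _; apply: le_trans (ler_norm _) (le_trans (cmod_Re _) (kle _ _)); left.
  by rewrite (proj1 (sub2 _ _)) ger0_norm; lra.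
have L4 : - itg (fun y => complex.Re (k (a +i* y)%C)) c d <= s^-1 * itg (fun y => cmod (h (a +i* y)%C)) c d.
  rewrite lerNl -itgZ// -mulN1r -itgZ; last exact: cZ.
  apply: le_itg => //; first by apply: cont1Z; exact: cZ.
  move=> x _; rewrite mulN1r lerNl; apply: le_trans (ler_norm _) _; rewrite normrN.
  apply: (le_trans (cmod_Re _) (kle _ _)); left.
  by rewrite (proj1 (sub2 _ _)) ler0_norm; lra.
rewrite mulrAC [X in X <= _]mulrC -ler_pdivlMl//.
by move: lower L1 L2 L3 L4; rewrite /Lam !mulrDr; lra.
Qed.

End CauchyInequalitySides.

(** * Measurability in the plane *)

Section PlaneMeasurability.
Context {R : realType}.

(** An open set is the union of the rational boxes that it contains, a countable family of
    measurable rectangles of the product sigma-algebra. *)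
Lemma measurable_open_box (U : set (R * R)) :
  (forall u, U u -> exists2 e, 0 < e &
    forall v, `|v.1 - u.1| < e -> `|v.2 - u.2| < e -> U v) ->
  measurable U.
Proof.
move=> H.
pose box (q : (rat * rat) * (rat * rat)) : set (R * R) :=
  `]ratr q.1.1, ratr q.1.2[ `*` `]ratr q.2.1, ratr q.2.2[.
have -> : U = \bigcup_q (if asbool (box q `<=` U) then box q else set0).
  apply/seteqP; split => [u Uu|u [q _]]; last by case: asboolP => // /[apply].
  have [e e0 He] := H u Uu.
  have [q1] := rat_in_itvoo (ltac:(lra) : u.1 - e < u.1).
  have [q2] := rat_in_itvoo (ltac:(lra) : u.1 < u.1 + e).
  have [q3] := rat_in_itvoo (ltac:(lra) : u.2 - e < u.2).
  have [q4] := rat_in_itvoo (ltac:(lra) : u.2 < u.2 + e).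
  rewrite !in_itv /= => /andP[h1 h2] /andP[h3 h4] /andP[h5 h6] /andP[h7 h8].
  exists ((q1, q2), (q3, q4)) => //; case: asboolP => [_|[]].
    by split => /=; rewrite in_itv /=; apply/andP; split.
  move=> v [/=]; rewrite !in_itv /= => /andP[v1 v2] /andP[v3 v4].
  by apply: He; rewrite ltr_norml; apply/andP; split; lra.
apply: countable_bigcupT_measurable; first exact: countableP.
move=> q; case: asboolP => _ //; apply: measurableX; exact: measurable_itv.
Qed.

Lemma measurable_fun_cmod (D : set R[i]) (f : R[i] -> R[i]) :
  measurable (@to_complex R @^-1` D) -> (forall w, D w -> ccont D f w) ->
  measurable_fun (@to_complex R @^-1` D) (fun u => cmod (f (to_complex u))).
Proof.
move=> mD fc _; apply: (measurability _ (RGenOInfty.measurableE R)) => //.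
move=> /= _ [_ [x ->] <-].
(* [f] is continuous only relative to [D]; [U] is an open set of the plane whose trace on [D] is the
   superlevel set. *)
pose U : set (R * R) := [set u | exists2 e, 0 < e & forall v, D (to_complex v) ->
  `|v.1 - u.1| < e -> `|v.2 - u.2| < e -> x < cmod (f (to_complex v))].
have -> : @to_complex R @^-1` D `&` (fun u => cmod (f (to_complex u))) @^-1` `]x, +oo[%classic =
    @to_complex R @^-1` D `&` U.
  apply/seteqP; split => u [Du]; rewrite /= ?in_itv /= ?andbT; last first.
    move=> [e e0 He]; split=> //=.
    by apply: He => //; rewrite subrr normr0.
  move=> xu; split => //.
  have e0 : 0 < (cmod (f (to_complex u)) - x) / 2 by lra.
  have [d d0 dP] := proj1 (ccontP _ _ _) (fc _ Du) _ e0.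
  exists (d / 2); first by lra.
  move=> v Dv v1 v2.
  have : cmod (to_complex v - to_complex u) < d.
    apply: le_lt_trans (cmod_le_ReIm _) _; rewrite ReB ImB /=; lra.
  move=> /(dP _ Dv); have := ler_dist_cmod (f (to_complex v)) (f (to_complex u)).
  rewrite ler_norml => /andP[]; lra.
apply: measurableI => //; apply: measurable_open_box => u [e e0 He].
exists (e / 2); first by lra.
move=> v v1 v2; exists (e / 2); first by lra.
move=> t Dt t1 t2; apply: He => //.
  have -> : t.1 - u.1 = (t.1 - v.1) + (v.1 - u.1) by ring.
  by apply: le_lt_trans (ler_normD _ _) _; lra.
have -> : t.2 - u.2 = (t.2 - v.2) + (v.2 - u.2) by ring.
by apply: le_lt_trans (ler_normD _ _) _; lra.
Qed.

Lemma preimage_rect (a b c d : R) :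
  @to_complex R @^-1` rect a b c d = `[a, b]%classic `*` `[c, d]%classic.
Proof. by apply/seteqP; split => -[x y] [/= ? ?]; split. Qed.

Lemma measurable_preimage_rect (a b c d : R) : measurable (@to_complex R @^-1` rect a b c d).
Proof. by rewrite preimage_rect; apply: measurableX; exact: measurable_itv. Qed.

End PlaneMeasurability.

(** * Mean value inequality over squares *)

Notation area_integral D F :=
  (\int[lebesgue_measure \x lebesgue_measure]_(u in @to_complex _ @^-1` D)
    (F (to_complex u))%:E)%E.

Section AreaMeanValue.
Context {R : realType}.
Notation leb := (@lebesgue_measure R).

Lemma le_of_integral_le (g : R -> \bar R) (X p q I : R) :
  measurable_fun setT g -> (forall x, (0 <= g x)%E) -> p <= q ->
  (\int[leb]_x g x <= I%:E)%E -> (forall x, p <= x <= q -> (X%:E <= g x)%E) ->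
  X * (q - p) <= I.
Proof.
move=> mg g0 pq gI Xg; have [X0|X0] := ltP X 0.
  apply: (@le_trans _ _ 0); first by rewrite nmulr_rle0// subr_ge0.
  by rewrite -lee_fin; apply: le_trans gI; exact: integral_ge0.
have mgA (A : set R) : measurable_fun A g by exact: measurable_funTS.
rewrite -lee_fin; apply: le_trans gI.
apply: (@le_trans _ _ (\int[leb]_(x in `[p, q]) g x)%E); last first.
  by apply: ge0_subset_integral => //; exact: measurable_itv.
have -> : ((X * (q - p))%:E = \int[leb]_(x in `[p, q]) (cst X%:E) x)%E.
  rewrite integral_cst//=; have := @lebesgue_measure_itv R `[p, q].
  rewrite /= lte_fin => ->; case: ltP => // qp.
  by rewrite mule0; congr EFin; rewrite (le_anti (introT andP (conj pq qp))) subrr mulr0.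
apply: ge0_le_integral => //=.
exact: mgA.
Qed.

Lemma itg_subset_le (f : R -> R) (a b a' b' : R) : a <= a' -> a' <= b' -> b' <= b ->
  cont1 f a b -> (forall x, a <= x <= b -> 0 <= f x) -> itg f a' b' <= itg f a b.
Proof.
move=> aa ab bb fc f0; rewrite (itg_split aa (le_trans ab bb) fc).
rewrite (itg_split ab bb (cont1S aa (lexx _) fc)).
have := @itg_ge0 _ f a a' (ltac:(move=> x xx; apply: f0; lra)).
have := @itg_ge0 _ f b' b (ltac:(move=> x xx; apply: f0; lra)).
lra.
Qed.

Lemma EFin_itg (f : R -> R) (a b : R) : cont1 f a b ->
  ((itg f a b)%:E = \int[leb]_(x in `[a, b]) (f x)%:E)%E.
Proof.
move=> fc; rewrite /itg /Rintegral fineK//.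
by apply: integrable_fin_num => //; exact: cont1_integrable.
Qed.

(** Extending [u] by [0] off the rectangle makes Tonelli's theorem applicable on the whole plane.
    The slice integrals come out as functions on the line that are already measurable and agree with
    [itg] where slices meet the rectangle. *)
Lemma fubini_rect (u : R[i] -> R) (a b c d : R) :
  (forall z, 0 <= u z) ->
  measurable_fun (@to_complex R @^-1` rect a b c d) (fun v => u (to_complex v)) ->
  (forall x, a <= x <= b -> cont1 (fun y => u (x +i* y)%C) c d) ->
  (forall y, c <= y <= d -> cont1 (fun x => u (x +i* y)%C) a b) ->
  exists F G : R -> \bar R,
    [/\ measurable_fun setT F /\ measurable_fun setT G,
      (forall x, (0 <= F x)%E) /\ (forall y, (0 <= G y)%E),
      (\int[leb]_x F x = area_integral (rect a b c d) u)%E /\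
        (\int[leb]_y G y = area_integral (rect a b c d) u)%E,
      (forall x, a <= x <= b -> F x = (itg (fun y => u (x +i* y)%C) c d)%:E) /\
        (forall x, ~~ (a <= x <= b) -> F x = 0%E) &
      forall y, c <= y <= d -> G y = (itg (fun x => u (x +i* y)%C) a b)%:E].
Proof.
move=> u0 um uv uh.
pose D := @to_complex R @^-1` rect a b c d.
have mD : measurable D by exact: measurable_preimage_rect.
pose g := (fun v : R * R => (u (to_complex v))%:E) \_ D.
have g0 v : (0 <= g v)%E by rewrite /g patchE; case: ifPn => // _; rewrite lee_fin.
have mg : measurable_fun setT g.
  by apply/(measurable_restrictT _ mD)/measurable_EFinP.
exists (fubini_F leb g), (fubini_G leb g); split.
- by split; [exact: measurable_fun_fubini_tonelli_F|exact: measurable_fun_fubini_tonelli_G].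
- by split => x; apply: integral_ge0.
- have E := fubini_tonelli1 (m1 := leb) (m2 := leb) g mg g0.
  have {}E : (\int[leb]_x fubini_F leb g x = area_integral (rect a b c d) u)%E.
    by rewrite -E [RHS]integral_mkcond.
  split => //; rewrite -E; apply/esym.
  exact: (fubini_tonelli (m1 := leb) (m2 := leb) g mg g0).
- split=> [x xab|x /negbTE xab]; last first.
    rewrite /fubini_F -[RHS](integral0 leb setT); apply: eq_integral => y _.
    rewrite /g patchE ifF//; apply/negbTE/negP; rewrite inE /D /= => -[].
    by rewrite /= xab.
  rewrite EFin_itg; last exact: uv.
  rewrite integral_mkcond /fubini_F; apply: eq_integral => y _.
  rewrite /g !patchE /D.
  have -> : (x, y) \in @to_complex R @^-1` rect a b c d = (y \in `[c, d]%classic).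
    by apply/idP/idP; rewrite !inE /rect /= in_itv /=; [case|split].
  by [].
- move=> y ycd; rewrite EFin_itg; last exact: uh.
  rewrite integral_mkcond /fubini_G; apply: eq_integral => x _.
  rewrite /g !patchE /D.
  have -> : (x, y) \in @to_complex R @^-1` rect a b c d = (x \in `[a, b]%classic).
    by apply/idP/idP; rewrite !inE /rect /= in_itv /=; [case|split].
  by [].
Qed.

(* Cauchy's inequality holds for all rectangles with sides at distance between
   [r / 2] and [r] from [w]; the four sides are averaged one after the other. *)
Lemma area_mean_value (h : R[i] -> R[i]) (w : R[i]) (r I : R) : 0 < r ->
  let Q := rect (complex.Re w - r) (complex.Re w + r) (complex.Im w - r) (complex.Im w + r) in
  (forall z, Q z -> cdiff Q h z) ->
  (area_integral Q (fun z => cmod (h z)) <= I%:E)%E ->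
  r ^+ 2 * cmod (h w) <= 4 * I.
Proof.
move=> r0; set a := complex.Re w - r; set b := complex.Re w + r.
set c := complex.Im w - r; set d := complex.Im w + r => Q hd hI.
have cl (z t : R[i]) : `|cmod z - cmod t| <= cmod (z - t) by exact: ler_dist_cmod.
have hc z (Qz : Q z) := cdiff_ccont (hd z Qz).
have cv x : a <= x <= b -> cont1 (fun y => cmod (h (x +i* y)%C)) c d.
  move=> xab; apply: (@cont1_vertical _ _ Q h c d x cl) => y ycd.
  by have Qxy : Q (x +i* y)%C by []; split => //; exact: hc.
have ch y : c <= y <= d -> cont1 (fun x => cmod (h (x +i* y)%C)) a b.
  move=> ycd; apply: (@cont1_horizontal _ _ Q h a b y cl) => x xab.
  by have Qxy : Q (x +i* y)%C by []; split => //; exact: hc.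
have [F [G [[mF mG] [F0 G0] [iF iG] [FE _] GE]]] := @fubini_rect (fun z => cmod (h z)) a b c d
  (fun z => cmod_ge0 _) (measurable_fun_cmod (measurable_preimage_rect _ _ _ _) hc) cv ch.
rewrite -iF in hI; have hI' := hI; rewrite iF -iG in hI'.
pose V x := itg (fun y => cmod (h (x +i* y)%C)) c d.
pose H y := itg (fun x => cmod (h (x +i* y)%C)) a b.
pose X := 2 * r * cmod (h w).
have key x1 x2 y1 y2 : a <= x1 <= a + r / 2 -> b - r / 2 <= x2 <= b ->
    c <= y1 <= c + r / 2 -> d - r / 2 <= y2 <= d -> X <= H y1 + H y2 + V x2 + V x1.
  move=> hx1 hx2 hy1 hy2.
  have [ax1 x12 x2b] : [/\ a <= x1, x1 <= x2 & x2 <= b].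
    by split; move: hx1 hx2; rewrite /a /b; lra.
  have [cy1 y12 y2d] : [/\ c <= y1, y1 <= y2 & y2 <= d].
    by split; move: hy1 hy2; rewrite /c /d; lra.
  have sub : rect x1 x2 y1 y2 `<=` Q by apply: rectS.
  have r20 : 0 < r / 2 by lra.
  have := @cauchy_inequality R h w x1 x2 y1 y2 (r / 2) r20
    (ltac:(move: hx1; rewrite /a; lra)) (ltac:(move: hx2; rewrite /b; lra))
    (ltac:(move: hy1; rewrite /c; lra)) (ltac:(move: hy2; rewrite /d; lra))
    (fun z rz => cdiffS sub (hd z (sub z rz))).
  have e1 : itg (fun x => cmod (h (x +i* y1)%C)) x1 x2 <= H y1.
    apply: itg_subset_le => // [|? _]; last exact: cmod_ge0.
    by apply: ch; rewrite cy1 (le_trans y12).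
  have e2 : itg (fun x => cmod (h (x +i* y2)%C)) x1 x2 <= H y2.
    apply: itg_subset_le => // [|? _]; last exact: cmod_ge0.
    by apply: ch; rewrite y2d (le_trans cy1).
  have e3 : itg (fun y => cmod (h (x2 +i* y)%C)) y1 y2 <= V x2.
    apply: itg_subset_le => // [|? _]; last exact: cmod_ge0.
    by apply: cv; rewrite x2b (le_trans ax1).
  have e4 : itg (fun y => cmod (h (x1 +i* y)%C)) y1 y2 <= V x1.
    apply: itg_subset_le => // [|? _]; last exact: cmod_ge0.
    by apply: cv; rewrite ax1 (le_trans x12).
  move: e1 e2 e3 e4 => e1 e2 e3 e4 e5.
  have -> : X = 4 * (r / 2) * cmod (h w) by rewrite /X; field.
  apply: le_trans e5 _; clear -e1 e2 e3 e4; lra.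
have hV Y p q : a <= p -> p <= q -> q <= b -> q - p = r / 2 ->
    (forall x, p <= x <= q -> Y <= V x) -> Y * (r / 2) <= I.
  move=> ap pq qb <- HY; apply: (le_of_integral_le mF F0 pq hI) => x /andP[px xq].
  rewrite FE; last by rewrite (le_trans ap) ?(le_trans xq).
  by rewrite lee_fin; apply: HY; rewrite px.
have hH Y p q : c <= p -> p <= q -> q <= d -> q - p = r / 2 ->
    (forall x, p <= x <= q -> Y <= H x) -> Y * (r / 2) <= I.
  move=> ap pq qb <- HY; apply: (le_of_integral_le mG G0 pq hI') => x /andP[px xq].
  rewrite GE; last by rewrite (le_trans ap) ?(le_trans xq).
  by rewrite lee_fin; apply: HY; rewrite px.
(* A quantity below all slice integrals over an interval of length [r / 2] is at most
   [I / (r / 2)]. *)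
pose J := I * (2 / r).
have JE Y : Y * (r / 2) <= I -> Y <= J.
  by move=> YI; rewrite /J -invf_div ler_pdivlMr//; lra.
(* With three sides frozen, [X] minus their contributions is a lower bound for the fourth as it
   sweeps its interval, so that side can be replaced by [J]. The next three steps do the same for
   the other sides. *)
have A1 x1 x2 y2 : a <= x1 <= a + r / 2 -> b - r / 2 <= x2 <= b ->
    d - r / 2 <= y2 <= d -> X <= J + H y2 + V x2 + V x1.
  move=> hx1 hx2 hy2; have : X - H y2 - V x2 - V x1 <= J; last by clear; lra.
  apply/JE/(@hH _ c (c + r / 2)); rewrite /c /d; try (clear -r0; lra).
  by move=> y1 hy1; have := key x1 x2 y1 y2 hx1 hx2 hy1 hy2; clear; lra.
have A2 x1 x2 : a <= x1 <= a + r / 2 -> b - r / 2 <= x2 <= b -> X <= J + J + V x2 + V x1.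
  move=> hx1 hx2; have : X - J - V x2 - V x1 <= J; last by clear; lra.
  apply/JE/(@hH _ (d - r / 2) d); rewrite /c /d; try (clear -r0; lra).
  by move=> y2 hy2; have := A1 x1 x2 y2 hx1 hx2 hy2; clear; lra.
have A3 x1 : a <= x1 <= a + r / 2 -> X <= J + J + J + V x1.
  move=> hx1; have : X - J - J - V x1 <= J; last by clear; lra.
  apply/JE/(@hV _ (b - r / 2) b); rewrite /a /b; try (clear -r0; lra).
  by move=> x2 hx2; have := A2 x1 x2 hx1 hx2; clear; lra.
have A4 : X - J - J - J <= J.
  apply/JE/(@hV _ a (a + r / 2)); rewrite /a /b; try (clear -r0; lra).
  by move=> x1 hx1; have := A3 x1 hx1; clear; lra.
have : X * (r / 2) <= 4 * (J * (r / 2)).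
  by rewrite [4 * _]mulrA; apply: ler_wpM2r; clear -A4 r0; lra.
have -> : J * (r / 2) = I by rewrite /J; field; apply: lt0r_neq0.
by have -> : X * (r / 2) = r ^+ 2 * cmod (h w) by rewrite /X; field.
Qed.

End AreaMeanValue.

(** * Submean value property of [|F|^p] for every [p > 0] *)

Section SubmeanPower.
Context {R : realType}.

Definition square (z : R[i]) (s : R) : set R[i] :=
  rect (complex.Re z - s) (complex.Re z + s) (complex.Im z - s) (complex.Im z + s).

(** The set [E] is separate from the rectangle so that the same compactness argument also covers a
    closed disk inside a square. *)
Lemma locally_bounded_on_rect (f : R[i] -> R[i]) (E : set R[i]) (a b c d : R) :
  a <= b -> c <= d ->
  (forall w, rect a b c d w -> exists M, exists2 e, 0 < e &
     forall z, E z -> cmod (z - w) < e -> cmod (f z) <= M) ->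
  exists M, forall z, rect a b c d z -> E z -> cmod (f z) <= M.
Proof.
move=> ab cd loc.
apply: (@rectangle_ind _ (fun a' b' c' d' =>
  exists M, forall z, rect a' b' c' d' z -> E z -> cmod (f z) <= M)) => //.
  move=> a' b' c' d' _ _ m n [M1 H1] [M2 H2] [M3 H3] [M4 H4].
  exists (Num.max (Num.max M1 M2) (Num.max M3 M4)) => z [/andP[z1 z2] /andP[z3 z4]] rz.
  rewrite !le_max; have [zm|/ltW zm] := leP (complex.Re z) m;
    have [zn|/ltW zn] := leP (complex.Im z) n.
  - by rewrite H1//; split; apply/andP; split.
  - by rewrite H3 ?orbT//; split; apply/andP; split.
  - by rewrite H2 ?orbT//; split; apply/andP; split.
  - by rewrite H4 ?orbT//; split; apply/andP; split.
move=> w rw; have [M [e e0 He]] := loc w rw.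
exists (e / 2); first by lra.
move=> a' b' c' d' _ _ _ _ [/andP[w1 w2] /andP[w3 w4]] ba dc.
exists M => z [/andP[z1 z2] /andP[z3 z4]] Ez; apply: He => //.
apply: le_lt_trans (cmod_le_ReIm _) _; rewrite ReB ImB.
have h1 : `|complex.Re z - complex.Re w| <= b' - a' by rewrite ler_norml; apply/andP; split; lra.
have h2 : `|complex.Im z - complex.Im w| <= d' - c' by rewrite ler_norml; apply/andP; split; lra.
lra.
Qed.

Lemma ccont_locally_bounded (f : R[i] -> R[i]) (E : set R[i]) w : ccont E f w ->
  exists M, exists2 e, 0 < e & forall z, E z -> cmod (z - w) < e -> cmod (f z) <= M.
Proof.
move=> /ccontP/(_ 1 ltr01)[e e0 He]; exists (cmod (f w) + 1), e => // z Ez zw.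
by have := He z Ez zw; have := cmodD (f z - f w) (f w); rewrite subrK; lra.
Qed.

Lemma bounded_on_rect (f : R[i] -> R[i]) (a b c d : R) : a <= b -> c <= d ->
  (forall w, rect a b c d w -> ccont (rect a b c d) f w) ->
  exists M, forall z, rect a b c d z -> cmod (f z) <= M.
Proof.
move=> ab cd fc; have [M HM] := @locally_bounded_on_rect f (rect a b c d) a b c d ab cd
  (fun w rw => ccont_locally_bounded (fc w rw)).
by exists M => z rz; exact: HM.
Qed.

Lemma powRD1 (u m : R) : 0 <= u -> 1 <= m -> u `^ m = u * u `^ (m - 1).
Proof.
move=> u0 m1; have [->|un0] := eqVneq u 0; first by rewrite mul0r powR0// gt_eqF; lra.
rewrite -{2}(powRr1 u0) -powRD; last by apply/implyP => _.
by rewrite addrC subrK.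
Qed.

Lemma square_center (z : R[i]) (s : R) : 0 <= s -> square z s z.
Proof. by move=> s0; split; apply/andP; split; lra. Qed.

(* The Hardy-Littlewood device: the mean value inequality for the power [F ^+ n]
   with [p <= n] is brought down to the exponent [p] by maximizing
   [cmod (F z) `^ p * s ^+ 2] over all squares of half side [s] in the given one. *)
Lemma area_submean_powR (p : R) : 0 < p -> exists2 K : R, 0 < K &
  forall (F : R[i] -> R[i]) (w : R[i]) (r I : R), 0 < r ->
    (forall z, square w r z -> cdiff (square w r) F z) ->
    (area_integral (square w r) (fun z => cmod (F z) `^ p)%R <= I%:E)%E ->
    r ^+ 2 * cmod (F w) `^ p <= K * I.
Proof.
move=> p0; have [n pn] : exists n : nat, p <= n%:R.
  by exists (Num.bound p); rewrite ltW// archi_boundP// ltW.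
pose m := n%:R / p; have m1 : 1 <= m by rewrite ler_pdivlMr// mul1r.
have m0 : 0 < m by lra.
(* [16] is the [4] of [area_mean_value] times the [4] lost by halving the side; [4 ^ (m - 1)] is the
   same halving in the bound [u t <= 4 N / s^2]. *)
pose K := 16 * 4 `^ (m - 1); exists K; first by rewrite mulr_gt0// powR_gt0.
move=> F w r I r0 Fd FI.
pose u z := cmod (F z) `^ p; have u0 z : 0 <= u z by exact: powR_ge0.
have um z : cmod (F z ^+ n) = u z `^ m.
  rewrite cmodX -powR_mulrn ?cmod_ge0// /u -powRrM; congr (_ `^ _).
  by rewrite /m mulrC divfK// gt_eqF.
have Fc z (Qz : square w r z) := cdiff_ccont (Fd z Qz).
have mu1 z s : square z s `<=` square w r ->
    measurable_fun (@to_complex R @^-1` square z s) (fun v => u (to_complex v)).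
  move=> sub; apply: (measurableT_comp (measurable_powR p)).
  apply: measurable_fun_cmod; first exact: measurable_preimage_rect.
  by move=> t st; exact (ccontS sub (Fc t (sub t st))).
have I0 : 0 <= I.
  rewrite -lee_fin; apply: le_trans FI; apply: integral_ge0 => v _.
  by rewrite lee_fin powR_ge0.
(* The square of half side [s] around [z] lies in the given one. *)
pose adm (z : R[i]) s := [/\ 0 < s, `|complex.Re z - complex.Re w| + s <= r
  & `|complex.Im z - complex.Im w| + s <= r].
have adm_sub z s : adm z s -> square z s `<=` square w r.
  move=> [s0 h1 h2]; apply: rectS; move: h1 h2;
  have := ler_norm (complex.Re z - complex.Re w);
  have := ler_norm (- (complex.Re z - complex.Re w));
  have := ler_norm (complex.Im z - complex.Im w);
  have := ler_norm (- (complex.Im z - complex.Im w)); rewrite !normrN; clear; lra.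
have adm_half z s t : adm z s -> square z (s / 2) t -> adm t (s / 2).
  move=> [s0 h1 h2] [/andP[t1 t2] /andP[t3 t4]].
  have e1 : `|complex.Re t - complex.Re z| <= s / 2 by rewrite ler_norml; clear -t1 t2; lra.
  have e2 : `|complex.Im t - complex.Im z| <= s / 2 by rewrite ler_norml; clear -t3 t4; lra.
  split; first by clear -s0; lra.
    have -> : complex.Re t - complex.Re w =
      (complex.Re t - complex.Re z) + (complex.Re z - complex.Re w) by ring.
    by have := ler_normD (complex.Re t - complex.Re z) (complex.Re z - complex.Re w); clear -h1 e1; lra.
  have -> : complex.Im t - complex.Im w =
    (complex.Im t - complex.Im z) + (complex.Im z - complex.Im w) by ring.
  by have := ler_normD (complex.Im t - complex.Im z) (complex.Im z - complex.Im w); clear -h2 e2; lra.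
have admw : adm w r by split => //; rewrite subrr normr0 add0r.
pose S : set R := [set x | exists z s, adm z s /\ x = u z * s ^+ 2].
have Sw : S (u w * r ^+ 2) by exists w, r.
have [M FM] : exists M, forall z, square w r z -> cmod (F z) <= M.
  by apply: bounded_on_rect => //; clear -r0; lra.
have M0 : 0 <= M by apply: le_trans (FM w _); [exact: cmod_ge0|exact/square_center/ltW].
have Sub : has_ubound S.
  exists (M `^ p * r ^+ 2) => _ [z [s [zs ->]]]; have [s0 h1 _] := zs.
  apply: ler_pM => //; first exact: sqr_ge0.
    apply: ge0_ler_powR; rewrite ?nnegrE ?cmod_ge0 ?(ltW p0)//.
    by apply: FM; apply: (adm_sub z s zs); exact/square_center/ltW.
  rewrite ler_sqr ?nnegrE ?(ltW r0) ?(ltW s0)//.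
  by apply: le_trans h1; rewrite lerDr.
pose N := sup S.
have SN x : S x -> x <= N by move=> Sx; exact: ub_le_sup.
have N0 : 0 <= N by apply: le_trans (SN _ Sw); rewrite mulr_ge0// sqr_ge0.
have step x : S x -> x `^ m <= K * I * N `^ (m - 1).
  move=> [z [s [zs ->]]]; have [s0 _ _] := zs.
  have s2 : 0 < s / 2 by clear -s0; lra.
  have sub2 : square z (s / 2) `<=` square w r.
    apply: subset_trans (adm_sub _ _ zs); apply: rectS; clear -s0; lra.
  (* Each [t] in the half-size square is itself the center of an admissible square of half side
     [s / 2], so maximality gives [u t <= 4 N / s^2] and [u^m <= B u]: the power drops from [m] to
     [1]. *)
  pose B := (4 * N / s ^+ 2) `^ (m - 1).
  have ut t : square z (s / 2) t -> u t `^ m <= B * u t.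
    move=> st; rewrite powRD1// mulrC ler_wpM2r//.
    apply: ge0_ler_powR; rewrite ?nnegrE ?subr_ge0//.
      by apply: divr_ge0; [apply: mulr_ge0|exact: sqr_ge0].
    rewrite ler_pdivlMr ?exprn_gt0//.
    have : u t * (s / 2) ^+ 2 <= N.
      by apply: SN; exists t, (s / 2); split => //; exact: (adm_half z s).
    by rewrite expr_div_n; clear; lra.
  have hI : (area_integral (square z (s / 2)) (fun t => cmod (F t ^+ n)) <= (B * I)%:E)%E.
    have -> : (\int[lebesgue_measure \x lebesgue_measure]_(v in @to_complex R @^-1` square z (s / 2))
      (cmod (F (to_complex v) ^+ n))%:E = \int[lebesgue_measure \x lebesgue_measure]_(v in
       @to_complex R @^-1` square z (s / 2)) (u (to_complex v) `^ m)%:E)%E.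
      by apply: eq_integral => v _; rewrite um.
    apply: (@le_trans _ _ (\int[lebesgue_measure \x lebesgue_measure]_(v in
       @to_complex R @^-1` square z (s / 2)) (B%:E * (u (to_complex v))%:E))%E).
      apply: ge0_le_integral => //.
      - exact: measurable_preimage_rect.
      - by move=> v _; rewrite lee_fin powR_ge0.
      - by apply/measurable_EFinP; apply: (measurableT_comp (measurable_powR m)); exact: mu1.
      - by apply/measurable_EFinP; apply: measurable_funM; [exact: measurable_cst|exact: mu1].
      - by move=> v sv; rewrite -EFinM lee_fin; exact: ut.
    rewrite ge0_integralZl_EFin ?powR_ge0//;
      [|exact: measurable_preimage_rect|by move=> v _; rewrite lee_fin|by apply/measurable_EFinP; exact: mu1].
    rewrite EFinM lee_wpmul2l ?lee_fin ?powR_ge0//; apply: le_trans FI.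
    apply: ge0_subset_integral => //.
    - exact: measurable_preimage_rect.
    - exact: measurable_preimage_rect.
    - by apply/measurable_EFinP; exact: mu1.
    - by move=> v _; rewrite lee_fin.
    - by move=> v sv; exact: sub2.
  have hd t : square z (s / 2) t -> cdiff (square z (s / 2)) (fun x => F x ^+ n) t.
    by move=> st; exact (cdiffX n (cdiffS sub2 (Fd t (sub2 t st)))).
  have := area_mean_value s2 hd hI; rewrite um => H.
  have H2 : s ^+ 2 * u z `^ m <= 16 * (B * I) by move: H; rewrite expr_div_n; clear; lra.
  have s20 : 0 < s ^+ 2 by rewrite exprn_gt0.
  rewrite powRM ?(ltW s20)// (powRD1 (ltW s20) m1).
  have -> : K * I * N `^ (m - 1) = 16 * (B * I) * (s ^+ 2) `^ (m - 1).
    have BE : B * (s ^+ 2) `^ (m - 1) = 4 `^ (m - 1) * N `^ (m - 1).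
      have e4N : 0 <= 4 * N / s ^+ 2 by apply: divr_ge0; [apply: mulr_ge0|exact: ltW].
      by rewrite /B -powRM ?(ltW s20)// divfK ?(lt0r_neq0 s20)// powRM.
    rewrite /K (_ : 16 * (B * I) * (s ^+ 2) `^ (m - 1) = 16 * I * (B * (s ^+ 2) `^ (m - 1))); last by ring.
    by rewrite BE; ring.
  by rewrite mulrA [_ * s ^+ 2]mulrC ler_wpM2r ?powR_ge0.
(* The supremum over [step] gives [N^m <= K I N^(m - 1)]. Cancelling needs [N] finite, which is why
   [F] was first bounded on the closed square. *)
have NK : N <= K * I.
  have KI0 : 0 <= K * I by rewrite !mulr_ge0// powR_ge0.
  have [N1|N1] := eqVneq N 0; first by rewrite N1.
  have Npos : 0 < N by rewrite lt_def N1.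
  have Nm : N `^ m <= K * I * N `^ (m - 1).
    have H x : S x -> x <= (K * I * N `^ (m - 1)) `^ m^-1.
      move=> Sx; have x0 : 0 <= x.
        by case: Sx => z [s [_ ->]]; rewrite mulr_ge0// sqr_ge0.
      have -> : x = (x `^ m) `^ m^-1 by rewrite -powRrM divff ?powRr1// gt_eqF.
      apply: ge0_ler_powR; rewrite ?nnegrE ?powR_ge0 ?invr_ge0 ?(ltW m0) ?mulr_ge0 ?powR_ge0//.
      exact: step.
    have -> : K * I * N `^ (m - 1) = ((K * I * N `^ (m - 1)) `^ m^-1) `^ m.
      by rewrite -powRrM mulVf ?powRr1 ?mulr_ge0 ?powR_ge0// gt_eqF.
    apply: ge0_ler_powR; rewrite ?nnegrE ?powR_ge0 ?(ltW m0)//.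
    by apply: ge_sup => //; exists (u w * r ^+ 2).
  by move: Nm; rewrite powRD1// ler_pM2r// powR_gt0.
by rewrite mulrC; exact: le_trans (SN _ Sw) NK.
Qed.

End SubmeanPower.

(** * Decay in the weighted Bergman case *)

Section BergmanDecay.
Context {R : realType}.

(** Dominated convergence: [u] restricted to [E n] tends to [0] pointwise since every point
    eventually leaves [E n], and [u] dominates. *)
Lemma exists_integral_setI_le d (T : measurableType d) (mu : {measure set T -> \bar R})
    (D : set T) (E : nat -> set T) (u : T -> R) (e : R) :
  measurable D -> (forall n, measurable (E n)) -> measurable_fun D u ->
  (forall x, 0 <= u x) -> (\int[mu]_(x in D) (u x)%:E < +oo)%E ->
  (forall x, D x -> exists N, forall n, (N <= n)%N -> ~ E n x) -> 0 < e ->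
  exists n, (\int[mu]_(x in D `&` E n) (u x)%:E <= e%:E)%E.
Proof.
move=> mD mE mu_ u0 ufin Eout e0.
pose f_ n : T -> \bar R := (fun x => (u x)%:E) \_ (E n).
have f_ge0 n x : (0 <= f_ n x)%E by rewrite /f_ patchE; case: ifPn; rewrite // lee_fin.
have H : (\int[mu]_(x in D) f_ n x)%E @[n --> \oo] --> (\int[mu]_(x in D) (cst 0) x)%E.
  apply: (@dominated_cvg _ _ _ mu D mD f_ (cst 0) (fun x => (u x)%:E)) => //.
  - move=> n; apply/measurable_restrict => //.
    by apply: measurable_funS mD _ _; [exact: subIsetl|exact/measurable_EFinP].
  - move=> x Dx; have [N HN] := Eout x Dx.
    apply: cvg_near_cst; near=> n; rewrite /f_ patchE ifF//.
    apply/negbTE/negP; rewrite inE; apply: HN; near: n; exact: nbhs_infty_ge.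
  - apply/integrableP; split; first exact/measurable_EFinP.
    by under eq_integral => x _ do rewrite gee0_abs ?lee_fin//.
  - move=> n x _; rewrite gee0_abs// /f_ patchE; case: ifPn => // _; by rewrite lee_fin.
rewrite integral0 in H; move: H => /fine_cvgP[_ H].
have /cvgrPdist_le/(_ e e0) := H; move=> [N _ HN]; exists N.
have ffin : (\int[mu]_(x in D) f_ N x \is a fin_num)%E.
  rewrite ge0_fin_numE ?integral_ge0//; apply: le_lt_trans ufin.
  apply: ge0_le_integral => //.
  - apply/measurable_restrict => //.
    by apply: measurable_funS mD _ _; [exact: subIsetl|exact/measurable_EFinP].
  - exact/measurable_EFinP.
  - by move=> x _; rewrite /f_ patchE; case: ifPn => // _; rewrite lee_fin.
rewrite integral_mkcondr -/(f_ N) -(fineK ffin) lee_fin.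
by have := HN N (leqnn N); rewrite /= sub0r normrN => /(le_trans (ler_norm _)).
Unshelve. all: by end_near. Qed.

Lemma measurable_cmod_preimage (A : set R) : measurable A ->
  measurable [set u : R * R | A (cmod (to_complex u))].
Proof.
move=> mA; have := @measurable_fun_cmod R setT id measurableT (fun w _ => @ccont_id R setT w).
by move=> /(_ measurableT A mA); rewrite setTI.
Qed.

Lemma holomorphic_cdiff (D : set R[i]) (f : R[i] -> R[i]) (E : set R[i]) w :
  holomorphic_on D f -> D w -> cdiff E f w.
Proof. by move=> fD /fD; exact: derivable_cdiff. Qed.

(** The common outcome of the two cases, used with [b = alpha + 2], which is [1] for the Hardy
    space. *)
Definition power_decay (p b : R) (f : R[i] -> R[i]) := forall e, 0 < e ->
  exists2 s, 0 <= s < 1 & forall z, s < cmod z -> cmod z < 1 ->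
    cmod (f z) `^ p * (1 - cmod z) `^ b <= e.

Lemma lee_EFin_div (J : \bar R) (a b : R) : 0 < a -> (a%:E * J <= b%:E)%E ->
  (J <= (b / a)%:E)%E.
Proof. by move=> a0 H; rewrite mulrC EFinM lee_pdivlMl. Qed.

Lemma square_cmod_le (z t : R[i]) (s : R) : square z s t -> `|cmod t - cmod z| <= 2 * s.
Proof.
move=> [/andP[t1 t2] /andP[t3 t4]]; apply: le_trans (ler_dist_cmod _ _) _.
apply: le_trans (cmod_le_ReIm _) _; rewrite ReB ImB.
have : `|complex.Re t - complex.Re z| <= s by rewrite ler_norml; apply/andP; split; lra.
have : `|complex.Im t - complex.Im z| <= s by rewrite ler_norml; apply/andP; split; lra.
lra.
Qed.

(** The power increases or decreases with the sign of [al]; the minimum of the two extreme constants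
    covers both. *)
Lemma powR_comparable_ge (al x y : R) : 0 < y -> y / 2 <= x <= 3 * y ->
  Num.min (2^-1 `^ al) (3 `^ al) * y `^ al <= x `^ al.
Proof.
move=> y0 /andP[x1 x2]; have x0 : 0 < x by lra.
have [al0|al0] := leP 0 al.
  apply: (@le_trans _ _ (2^-1 `^ al * y `^ al)).
    by rewrite ler_wpM2r ?powR_ge0// ge_min lexx.
  rewrite -powRM ?(ltW y0)//; apply: ge0_ler_powR; rewrite ?nnegrE//; lra.
apply: (@le_trans _ _ (3 `^ al * y `^ al)).
  by rewrite ler_wpM2r ?powR_ge0// ge_min lexx orbT.
rewrite -powRM ?(ltW y0)// -[al]opprK !(powRN _ (- al)).
rewrite lef_pV2 ?posrE ?powR_gt0 ?mulr_gt0//.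
by apply: ge0_ler_powR; rewrite ?nnegrE//; lra.
Qed.

(** On the square of half side [dl / 4] around [z], with [dl = 1 - |z|], the weight is at least a
    constant times [dl ^ al]. The submean inequality then bounds [|f z|^p dl^(al + 2)] by the
    integral over a thin annulus, a tail. *)
Lemma bergman_power_decay (p al : R) (f : R[i] -> R[i]) : 0 < p ->
  weighted_bergman p al f -> power_decay p (al + 2) f.
Proof.
move=> p0 [fh fint] e e0.
have fd (E : set R[i]) w (w1 : cmod w < 1) : cdiff E f w := @holomorphic_cdiff (disk 1) f E w fh w1.
have [K K0 HK] := @area_submean_powR R p p0.
pose k := Num.min (2^-1 `^ al) (3 `^ al).
have k0 : 0 < k by rewrite lt_min !powR_gt0 ?invr_gt0.
pose eta := e * k / (16 * K).
have eta0 : 0 < eta by rewrite divr_gt0 ?mulr_gt0.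
pose u (v : R * R) := cmod (f (to_complex v)) `^ p * (1 - cmod (to_complex v) ^+ 2) `^ al.
have u0 v : 0 <= u v by rewrite mulr_ge0 ?powR_ge0.
pose D := @to_complex R @^-1` disk 1.
have mD : measurable D.
  have -> : D = [set v : R * R | `]-oo, 1[%classic (cmod (to_complex v))].
    by apply/seteqP; split => v; rewrite /D /disk /= in_itv.
  by apply: measurable_cmod_preimage; exact: measurable_itv.
have mcf := measurable_fun_cmod mD (fun w (Dw : disk 1 w) => cdiff_ccont (fd (disk 1) w Dw)).
have mci := @measurable_fun_cmod R (disk 1) id mD (fun w _ => @ccont_id R (disk 1) w).
have mfp A : measurable A -> A `<=` D -> measurable_fun A (fun v => cmod (f (to_complex v)) `^ p).
  move=> mA AD; apply: (measurableT_comp (measurable_powR p)).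
  exact (measurable_funS mD AD mcf).
have mw : measurable_fun D (fun v => (1 - cmod (to_complex v) ^+ 2) `^ al).
  apply: (measurableT_comp (measurable_powR al)); apply: measurable_funB => //.
  by apply: measurable_funX; exact mci.
have mu_ : measurable_fun D u by apply: measurable_funM => //; exact: mfp.
pose E n := [set v : R * R | 1 - n.+1%:R^-1 < cmod (to_complex v)].
have mE n : measurable (E n).
  have -> : E n = [set v : R * R | `]1 - n.+1%:R^-1, +oo[%classic (cmod (to_complex v))].
    by apply/seteqP; split => v; rewrite /E /= in_itv /= andbT.
  by apply: measurable_cmod_preimage; exact: measurable_itv.
have Eout v : D v -> exists N, forall n, (N <= n)%N -> ~ E n v.
  move=> Dv; have v1 : cmod (to_complex v) < 1 := Dv; have c0 : 0 < 1 - cmod (to_complex v) by lra.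
  exists (Num.bound (1 - cmod (to_complex v))^-1) => n hn.
  have : (1 - cmod (to_complex v))^-1 < n.+1%:R.
    apply: (@lt_le_trans _ _ (Num.bound (1 - cmod (to_complex v))^-1)%:R).
      by rewrite archi_boundP// invr_ge0 ltW.
    by rewrite ler_nat ltnW.
  rewrite invf_plt ?posrE// => h Ev.
  have : 1 - n.+1%:R^-1 < cmod (to_complex v) := Ev.
  by move: (n.+1%:R^-1) h => q; lra.
have [n Hn] := @exists_integral_setI_le _ _ (lebesgue_measure \x lebesgue_measure)%E D E u eta mD mE mu_ u0 fint Eout eta0.
have n0 : 0 < n.+1%:R^-1 :> R by rewrite invr_gt0.
have n1 : n.+1%:R^-1 <= 1 :> R by rewrite invf_le1// ler1n.
have En v : 1 - n.+1%:R^-1 < cmod (to_complex v) -> E n v by [].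
move: (n.+1%:R^-1) n0 n1 En => q q0 q1 En.
(* Points [t] of the square satisfy [1 - |t| <= 3 dl / 2 < 3 q / 4], so the whole square lies in the
   annulus carrying the small integral. *)
exists (1 - q / 2); first by lra.
move=> z zs z1; pose dl := 1 - cmod z; have dl0 : 0 < dl by rewrite /dl; lra.
have r0 : 0 < dl / 4 by lra.
have Qd t : square z (dl / 4) t -> dl / 2 <= 1 - cmod t <= 3 / 2 * dl.
  by move=> /square_cmod_le; rewrite ler_norml /dl; lra.
have QD : @to_complex R @^-1` square z (dl / 4) `<=` D `&` E n.
  move=> v /Qd; rewrite /dl => /andP[h1 h2]; split.
    by have : cmod (to_complex v) < 1 by lra.
  by apply: En; lra.
have QD' := subset_trans QD (@subIsetl _ _ _).
have mQ : measurable (@to_complex R @^-1` square z (dl / 4)) by exact: measurable_preimage_rect.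
have fQ : (area_integral (square z (dl / 4)) (fun t => cmod (f t) `^ p)%R <=
    (eta / (k * dl `^ al))%:E)%E.
  have kd0 : 0 < k * dl `^ al by rewrite mulr_gt0// powR_gt0.
  apply: lee_EFin_div => //.
  have f0 v : (@to_complex R @^-1` square z (dl / 4)) v ->
    (0 <= (cmod (f (to_complex v)) `^ p)%:E)%E by rewrite lee_fin powR_ge0.
  have mfE := proj2 (measurable_EFinP _ _) (mfp _ mQ QD').
  rewrite -(ge0_integralZl_EFin (lebesgue_measure \x lebesgue_measure)%E mQ f0 mfE (ltW kd0)).
  apply: le_trans Hn.
  apply: (@le_trans _ _ (\int[lebesgue_measure \x lebesgue_measure]_(v in
     @to_complex R @^-1` square z (dl / 4)) (u v)%:E)%E).
    apply: ge0_le_integral => //.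
    - by move=> v _; rewrite -EFinM lee_fin; apply: mulr_ge0; [exact: ltW|exact: powR_ge0].
    - apply/measurable_EFinP; apply: measurable_funM; [exact: measurable_cst|exact: mfp].
    - by apply/measurable_EFinP; exact: measurable_funS mu_.
    move=> v Qv; rewrite -EFinM lee_fin mulrC ler_wpM2l ?powR_ge0//.
    apply: powR_comparable_ge => //; have := Qd _ Qv; have := cmod_ge0 (to_complex v).
    move: (cmod _) => x x0 /andP[h1 h2]; have x1 : x < 1 by lra.
    (* The factor [1 + x] lies in [[1, 2]], which turns the bounds [dl / 2] and [3 dl / 2] for
       [1 - x] into [dl / 2] and [3 dl]. *)
    have -> : 1 - x ^+ 2 = (1 - x) * (1 + x) by ring.
    by apply/andP; split; nra.
  apply: ge0_subset_integral => //.
  - exact (measurableI _ _ mD (mE n)).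
  - by apply/measurable_EFinP; apply: measurable_funS mu_ => //; exact: subIsetl.
  - by move=> v _; rewrite lee_fin.
have Q1 t : square z (dl / 4) t -> cmod t < 1 by move=> /Qd /andP[]; lra.
have H := HK f z (dl / 4) _ r0 (fun t Qt => fd _ t (Q1 t Qt)) fQ.
rewrite -/dl addrC powRD; last by apply/implyP => _; rewrite gt_eqF.
rewrite (powR_mulrn 2 (ltW dl0)).
have -> : e = 16 * (K * (eta / (k * dl `^ al))) * dl `^ al.
  rewrite /eta; have := powR_gt0 al dl0; move: (dl `^ al) => y y0.
  by field; rewrite !lt0r_neq0.
rewrite mulrA ler_wpM2r ?powR_ge0//.
by move: H; rewrite expr_div_n mulrC; lra.
Qed.

End BergmanDecay.

(** * The complex exponential and a logarithm on the right half plane *)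

Section ComplexExponential.
Context {R : realType}.
Implicit Types (z w : R[i]) (x y : R).

(** Built on [circle_pt], so that the vertical line at [s] carries the very parametrization of the
    circle of radius [expR s] used in [hardy]. *)
Definition cexp z : R[i] := circle_pt (expR (complex.Re z)) (complex.Im z).

Lemma ImD z w : complex.Im (z + w) = complex.Im z + complex.Im w.
Proof. by case: z w => [? ?] []. Qed.

Lemma cexpD z w : cexp (z + w) = cexp z * cexp w.
Proof.
rewrite /cexp ReD ImD /circle_pt expRD cosD sinD.
by apply/eqP; rewrite eq_complex /=; apply/andP; split; apply/eqP; ring.
Qed.

Lemma cmod_circle_pt x y : 0 <= x -> cmod (circle_pt x y) = x.
Proof.
move=> x0; rewrite cmodE /circle_pt /= !exprMn -mulrDr cos2Dsin2 mulr1.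
by rewrite sqrtr_sqr ger0_norm.
Qed.

Lemma cmod_cexp z : cmod (cexp z) = expR (complex.Re z).
Proof. by rewrite cmod_circle_pt ?expR_ge0. Qed.

Lemma cexp_neq0 z : cexp z != 0.
Proof. by rewrite -cmod_gt0 cmod_cexp expR_gt0. Qed.

Lemma cexpB z w : cexp (z - w) = cexp z / cexp w.
Proof. by apply: (mulIf (cexp_neq0 w)); rewrite -cexpD subrK divfK ?cexp_neq0. Qed.

Lemma is_derive_estimate (f : R -> R) (a l e : R) : is_derive a 1 f l -> 0 < e ->
  exists2 d, 0 < d & forall x, `|x| < d -> `|f (x + a) - f a - l * x| <= e * `|x|.
Proof.
move=> [df fl] e0; have : (fun h => h^-1 *: (f (h *: (1 : R) + a) - f a)) @ 0^' --> l.
  by rewrite -fl; exact: df.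
move=> /cvgrPdist_le /(_ e e0); rewrite near_withinE => /nbhs_ballP[d /= d0 dP].
exists d => // x xd; have [->|x0] := eqVneq x 0.
  by rewrite add0r subrr mulr0 subrr normr0 mulr0.
have := dP x; rewrite /ball /= sub0r normrN => /(_ xd x0).
have -> : f (x + a) - f a - l * x = - (x * (l - x^-1 *: (f (x *: (1 : R) + a) - f a))).
  by rewrite /GRing.scale /= mulr1; field.
by rewrite normrN normrM => H; rewrite mulrC ler_wpM2r.
Qed.

Lemma cexp_estimate (e : R) : 0 < e -> exists2 d, 0 < d &
  forall z, cmod z < d -> cmod (cexp z - 1 - z) <= e * cmod z.
Proof.
(* The errors of the real and imaginary parts come to [4 e1 r] and [5 e1 r], whence the [9]. *)
move=> e0; have [e1 [e10 e18 e1l]] : exists e1, [/\ 0 < e1, e1 <= e / 9 & e1 <= 1].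
  by exists (Num.min (e / 9) 1); rewrite lt_min ltr01 divr_gt0// !ge_min !lexx orbT.
have [d1 d10 H1] := is_derive_estimate (is_derive_expR 0) e10.
have [d2 d20 H2] := is_derive_estimate (is_derive_cos 0) e10.
have [d3 d30 H3] := is_derive_estimate (is_derive_sin 0) e10.
exists (Num.min (Num.min d1 d2) (Num.min d3 e1)); first by rewrite !lt_min d10 d20 d30 e10.
move=> z; rewrite !lt_min => /andP[/andP[zd1 zd2] /andP[zd3 ze]].
have hx := cmod_Re z; have hy := cmod_Im z.
apply: le_trans (cmod_le_ReIm _) _.
rewrite !ReB !ImB /cexp /circle_pt /=.
move: (complex.Re z) (complex.Im z) hx hy => x y hx hy.
have := H1 x (le_lt_trans hx zd1); have := H2 y (le_lt_trans hy zd2).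
have := H3 y (le_lt_trans hy zd3).
rewrite !addr0 expR0 cos0 sin0 oppr0 !mul0r !mul1r !subr0 !addr0.
move: (cmod z) hx hy zd1 zd2 zd3 ze => r hx hy _ _ _ re.
set E := expR x; set C := cos y; set S := sin y => hS hC hE.
have r0 : 0 <= r := le_trans (normr_ge0 x) hx.
have er : e1 * r <= r by rewrite ler_piMl.
have k1 : `|E - 1 - x| <= e1 * r by apply: le_trans hE _; rewrite ler_wpM2l // ltW.
have k2 : `|C - 1| <= e1 * r by apply: le_trans hC _; rewrite ler_wpM2l // ltW.
have k3 : `|S - y| <= e1 * r by apply: le_trans hS _; rewrite ler_wpM2l // ltW.
have kE : `|E - 1| <= 2 * r.
  have -> : E - 1 = (E - 1 - x) + x by ring.
  by apply: le_trans (ler_normD _ _) _; lra.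
have kE3 : `|E| <= 3.
  have -> : E = (E - 1) + 1 by ring.
  by apply: le_trans (ler_normD _ _) _; rewrite normr1; lra.
have kS : `|S| <= 2 * r.
  have -> : S = (S - y) + y by ring.
  by apply: le_trans (ler_normD _ _) _; lra.
have a1 : `|E * C - 1 - x| <= 4 * (e1 * r).
  have -> : E * C - 1 - x = E * (C - 1) + (E - 1 - x) by ring.
  apply: le_trans (ler_normD _ _) _; rewrite normrM.
  have : `|E| * `|C - 1| <= 3 * (e1 * r) by apply: ler_pM.
  lra.
have a2 : `|E * S - y| <= 2 * r * (2 * e1) + e1 * r.
  have -> : E * S - y = (E - 1) * S + (S - y) by ring.
  apply: le_trans (ler_normD _ _) _; rewrite normrM.
  have : `|E - 1| * `|S| <= 2 * r * (2 * e1) by apply: ler_pM => //; lra.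
  lra.
have : 9 * (e1 * r) <= e * r by rewrite mulrA ler_wpM2r//; lra.
have : 0 <= e1 * r by rewrite mulr_ge0// ltW.
lra.
Qed.

Lemma cdiff_of_estimate (D : set R[i]) (f : R[i] -> R[i]) w (l : R[i]) :
  (forall e, 0 < e -> exists2 d, 0 < d & forall z, D z -> cmod (z - w) < d ->
     cmod (f z - f w - l * (z - w)) <= e * cmod (z - w)) ->
  exists2 q : R[i] -> R[i], q w = l /\ ccont D q w &
    forall z, D z -> f z - f w = q z * (z - w).
Proof.
move=> H; exists (fun z => if z == w then l else (f z - f w) / (z - w)); last first.
  move=> z Dz; case: eqVneq => [->|zw]; first by rewrite !subrr mulr0.
  by rewrite divfK// subr_eq0.
split; first by rewrite eqxx.
apply/ccontP => e e0; have [d d0 dP] := H e e0; exists d => // z Dz zd; rewrite eqxx.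
case: eqVneq => [_|zw]; first by rewrite subrr cmod0 ltW.
have z0 : z - w != 0 by rewrite subr_eq0.
have -> : (f z - f w) / (z - w) - l = (f z - f w - l * (z - w)) / (z - w).
  by rewrite [RHS]mulrBl mulfK.
by rewrite cmodM cmodV ler_pdivrMr ?cmod_gt0//; exact: dP.
Qed.

(** The value of the quotient at [w] is recorded because its being nonzero is what later permits
    differentiating a logarithm. *)
Lemma cexp_cdiff (D : set R[i]) w : exists2 q : R[i] -> R[i],
  q w = cexp w /\ ccont D q w & forall z, D z -> cexp z - cexp w = q z * (z - w).
Proof.
apply: cdiff_of_estimate => e e0.
have ew0 : 0 < e / cmod (cexp w) by rewrite divr_gt0// cmod_gt0 cexp_neq0.
have [d d0 dP] := cexp_estimate ew0; exists d => // z _ /dP.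
have -> : cexp z - cexp w - cexp w * (z - w) = cexp w * (cexp (z - w) - 1 - (z - w)).
  by rewrite cexpB !mulrBr mulrCA divff ?cexp_neq0// !mulr1.
by rewrite cmodM mulrAC ler_pdivlMr ?cmod_gt0 ?cexp_neq0// [cmod (cexp w) * _]mulrC.
Qed.

Lemma cdiff_cexp (D : set R[i]) w : cdiff D cexp w.
Proof. by have [q [_ qc] qE] := cexp_cdiff D w; exists q. Qed.

Lemma polar_right (z : R[i]) : z != 0 -> 0 <= complex.Re z ->
  let t := asin (complex.Im z / cmod z) in
  z = circle_pt (cmod z) t /\ - (pi / 2) <= t <= pi / 2.
Proof.
move=> z0 rz t; have m0 : 0 < cmod z by rewrite cmod_gt0.
have bnd : -1 <= complex.Im z / cmod z <= 1.
  by rewrite -ler_norml normrM normfV [X in _ / X]gtr0_norm// ler_pdivrMr// mul1r cmod_Im.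
split; last by rewrite asin_geNpi2//= asin_lepi2.
have st : sin t = complex.Im z / cmod z by rewrite /t asinK// in_itv.
have ct : cos t = complex.Re z / cmod z.
  rewrite /t cos_asin//.
  have -> : 1 - (complex.Im z / cmod z) ^+ 2 = (complex.Re z / cmod z) ^+ 2.
    rewrite !expr_div_n -[1](@divff _ (cmod z ^+ 2)) ?expf_neq0 ?gt_eqF//.
    by rewrite -mulrBl sqr_cmod addrK.
  by rewrite sqrtr_sqr ger0_norm// divr_ge0// ltW.
rewrite /circle_pt ct st; apply/eqP; rewrite eq_complex /=.
have E x : cmod z * (x / cmod z) = x by rewrite mulrC divfK// gt_eqF.
by rewrite !E !eqxx.
Qed.

(** The arcsine gives the angle when [Re z >= 0]; otherwise it is applied to [- z] and the angle is
    shifted by [pi]. *)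
Lemma exists_polar (z : R[i]) : z != 0 ->
  exists2 t, - (pi / 2) <= t <= pi + pi / 2 & z = circle_pt (cmod z) t.
Proof.
move=> z0; have [rz|rz] := leP 0 (complex.Re z).
  have [zE /andP[t1 t2]] := polar_right z0 rz.
  exists (asin (complex.Im z / cmod z)) => //.
  by rewrite t1 /= (le_trans t2)// lerDr pi_ge0.
have [] := @polar_right (- z); rewrite ?oppr_eq0 ?cmodN//; first by case: (z) rz => ? ? /=; lra.
move: (asin _) => t zE /andP[t1 t2]; exists (t + pi).
  by have := pi_gt0 R; move: t1 t2; lra.
rewrite -[LHS]opprK zE /circle_pt cosDpi sinDpi.
by apply/eqP; rewrite eq_complex /= !mulrN; apply/andP; split; apply/eqP.
Qed.

(** The principal logarithm, but only on the closed right half plane without [0]: the arcsine does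
    not distinguish [z] from its reflection in the imaginary axis. *)
Definition clog z : R[i] := (ln (cmod z) +i* asin (complex.Im z / cmod z))%C.

Lemma cexp_clog z : z != 0 -> 0 <= complex.Re z -> cexp (clog z) = z.
Proof.
move=> z0 rz; rewrite /cexp /clog /= lnK ?posrE ?cmod_gt0//.
by have [<-] := polar_right z0 rz.
Qed.

Lemma exists_cexp z : z != 0 -> exists w, cexp w = z.
Proof.
move=> z0; have [t _ zE] := exists_polar z0.
exists (ln (cmod z) +i* t)%C; rewrite /cexp /= lnK ?posrE ?cmod_gt0//.
Qed.

Lemma ccont_clog (D : set R[i]) w : 0 < complex.Re w -> ccont D clog w.
Proof.
move=> w0; have m0 : 0 < cmod w by apply: lt_le_trans w0 (le_trans (ler_norm _) (cmod_Re _)).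
have lip (phi : R[i] -> R) : (forall z t, `|phi z - phi t| <= cmod (z - t)) ->
    phi z @[z --> within D (nbhs (w : R[i]^o))] --> phi w.
  move=> H; apply/cvgrPdist_le => e e0.
  have /ccontP/(_ e e0)[d d0 dP] := @ccont_id R D w.
  rewrite near_withinE; apply/nbhs_ballP; exists d%:C%C => /=; first by rewrite ltcR.
  move=> z; rewrite /ball /= normCE ltcR => zd Dz.
  by apply: le_trans (H _ _) _; rewrite cmod_distC; apply: dP => //; rewrite cmod_distC.
have cl : cmod z @[z --> within D (nbhs (w : R[i]^o))] --> cmod w by apply/lip/ler_dist_cmod.
have ci : complex.Im z @[z --> within D (nbhs (w : R[i]^o))] --> complex.Im w by apply/lip/Im_lipschitz.
have c1 : ln (cmod z) @[z --> within D (nbhs (w : R[i]^o))] --> ln (cmod w).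
  by apply: continuous_cvg cl; exact: continuous_ln.
have c2 : asin (complex.Im z / cmod z) @[z --> within D (nbhs (w : R[i]^o))] -->
    asin (complex.Im w / cmod w).
  apply: continuous_cvg; last by apply: cvgM => //; apply: cvgV => //; rewrite gt_eqF.
  apply: continuous_asin.
  rewrite -ltr_norml normrM normfV [X in _ / X]gtr0_norm// ltr_pdivrMr// mul1r.
  rewrite -ltr_sqr ?nnegrE ?(ltW m0)// sqr_cmod real_normK ?num_real//.
  by rewrite ltrDr exprn_gt0.
apply/ccontP => e e0; have e20 : 0 < e / 2 by lra.
have eps (phi : R[i] -> R) : phi z @[z --> within D (nbhs (w : R[i]^o))] --> phi w ->
    exists2 d, 0 < d & forall z, D z -> cmod (z - w) < d -> `|phi z - phi w| <= e / 2.
  move=> /cvgrPdist_le/(_ _ e20); rewrite near_withinE => /nbhs_ballP[d /= d0 dP].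
  have [Re0 Ed] : 0 < complex.Re d /\ d = (complex.Re d)%:C%C.
    by move: d0; case: (d) => a b; rewrite ltcE /= => /andP[/eqP -> ->].
  exists (complex.Re d) => // z Dz zd; rewrite distrC.
  by have := dP z; rewrite /ball /= Ed normCE ltcR (cmod_distC w) => /(_ zd Dz).
have [d1 d10 H1] := eps (fun z => ln (cmod z)) c1.
have [d2 d20 H2] := eps (fun z => asin (complex.Im z / cmod z)) c2.
exists (Num.min d1 d2); first by rewrite lt_min d10.
move=> z Dz; rewrite lt_min => /andP[/(H1 z Dz) h1 /(H2 z Dz) h2].
by apply: le_trans (cmod_le_ReIm _) _; rewrite ReB ImB /=; lra.
Qed.

End ComplexExponential.

(** * Logarithms and power roots on rectangles *)

Section ContinuousLogarithm.
Context {R : realType}.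

Lemma cont1B (f g : R -> R) a b : cont1 f a b -> cont1 g a b -> cont1 (fun x => f x - g x) a b.
Proof. by move=> fc gc x; apply: cvgB; [exact: fc|exact: gc]. Qed.

Lemma cexp_eq1 (z : R[i]) : cexp z = 1 ->
  [/\ complex.Re z = 0, cos (complex.Im z) = 1 & sin (complex.Im z) = 0].
Proof.
move=> z1; have rz : complex.Re z = 0.
  by apply: expR_inj; rewrite expR0 -cmod_cexp z1 cmod1.
by move: z1; rewrite /cexp rz expR0 /circle_pt !mul1r => -[].
Qed.

(** The kernel of the exponential is discrete. If the imaginary part moved, the intermediate value
    theorem would reach a value at a distance [|s|] in []0, 1]] from the initial one; there
    [cos s = 1], which injectivity of the cosine on [[0, pi]] forbids. *)
Lemma cexp_eq1_segment (k : R -> R[i]) (c d : R) :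
  cont1 (fun y => complex.Im (k y)) c d ->
  (forall y, c <= y <= d -> cexp (k y) = 1) ->
  forall y, c <= y <= d -> k y = k c.
Proof.
move=> kc k1 y /andP[cy yd].
have cd : c <= d := le_trans cy yd.
have [r1 _ _] := cexp_eq1 (k1 y (introT andP (conj cy yd))).
have [r2 _ _] := cexp_eq1 (k1 c (introT andP (conj (lexx c) cd))).
suff E : complex.Im (k y) = complex.Im (k c).
  by move: r1 r2 E; case: (k y) (k c) => [? ?] [? ?] /= -> -> ->.
apply: contrapT => /eqP neq.
pose A := complex.Im (k c); pose B := complex.Im (k y).
pose s : R := if B <= A then - Num.min (A - B) 1 else Num.min (B - A) 1.
have neq' : B != A by [].
have [sn0 s1 sb] : [/\ s != 0, `|s| <= 1 & Num.min A B <= A + s <= Num.max A B].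
  rewrite /s; case: (leP B A) => BA.
    have BA' : B < A by rewrite lt_neqAle neq'.
    rewrite normrN oppr_eq0 ger0_norm; last by rewrite le_min subr_ge0 BA ler01.
    split; first by rewrite gt_eqF// lt_min subr_gt0 BA' ltr01.
      by rewrite ge_min lexx orbT.
    have h1 : Num.min (A - B) 1 <= A - B by rewrite ge_min lexx.
    have h2 : 0 <= Num.min (A - B) 1 by rewrite le_min subr_ge0 BA ler01.
    by move: h1 h2; set mm := Num.min _ _ => h1 h2; apply/andP; split; lra.
  rewrite ger0_norm; last by rewrite le_min subr_ge0 (ltW BA) ler01.
  split; first by rewrite gt_eqF// lt_min subr_gt0 BA ltr01.
    by rewrite ge_min lexx orbT.
  have h1 : Num.min (B - A) 1 <= B - A by rewrite ge_min lexx.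
  have h2 : 0 <= Num.min (B - A) 1 by rewrite le_min subr_ge0 (ltW BA) ler01.
  by move: h1 h2; set mm := Num.min _ _ => h1 h2; apply/andP; split; lra.
have [y' y'cy y'E] := IVT cy (cont1S (lexx c) yd kc) sb.
move: y'cy; rewrite in_itv /= => /andP[cy' y'y].
have /cexp_eq1[_ c1 _] : cexp (k y' - k c) = 1.
  by rewrite cexpB !k1 ?divr1// ?lexx ?cd// cy' (le_trans y'y).
move: c1; rewrite ImB y'E addrAC subrr add0r -cos_norm -cos0 => /cos_inj.
rewrite !in_itv /= normr_ge0 lexx pi_ge0 (le_trans s1) ?(le_trans _ (pi_ge2 _)) ?ler1n//.
by move=> /(_ isT isT)/eqP; rewrite normr_eq0 (negbTE sn0).
Qed.

Definition log_on (F L : R[i] -> R[i]) (E : set R[i]) :=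
  forall w, E w -> ccont E L w /\ cexp (L w) = F w.

(** Shifting [L2] by a period [k] makes the branches agree on the seam [phi = m]; away from the seam
    the other piece is at positive distance, since [phi] is Lipschitz. [phi] is the real or the
    imaginary part. *)
Lemma log_on_glue (F L1 L2 : R[i] -> R[i]) (E : set R[i]) (phi : R[i] -> R) (m : R) (k : R[i]) :
  (forall z w, `|phi z - phi w| <= cmod (z - w)) ->
  log_on F L1 (E `&` [set z | phi z <= m]) -> log_on F L2 (E `&` [set z | m <= phi z]) ->
  cexp k = 1 -> (forall z, E z -> phi z = m -> L1 z = L2 z + k) ->
  exists L, log_on F L E.
Proof.
move=> lip H1 H2 k1 HE; exists (fun z => if phi z <= m then L1 z else L2 z + k) => w Ew.
have L2E z : E z -> m <= phi z -> (if phi z <= m then L1 z else L2 z + k) = L2 z + k.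
  by move=> Ez mz; case: ifP => // zm; apply: HE => //; apply/eqP; rewrite eq_le zm.
split; last first.
  have [wm|/ltW mw] := leP (phi w) m; first by have [] := H1 w (conj Ew wm).
  by rewrite cexpD k1 mulr1; have [] := H2 w (conj Ew mw).
apply/ccontP => e e0.
have [d1 d10 P1] : exists2 d, 0 < d & forall z, E z -> phi z <= m -> cmod (z - w) < d ->
    cmod (L1 z - (if phi w <= m then L1 w else L2 w + k)) <= e.
  have [wm|mw] := leP (phi w) m.
    have [/ccontP/(_ e e0)[d d0 P] _] := H1 w (conj Ew wm).
    by exists d => // z Ez zm; apply: P.
  exists (phi w - m); first by rewrite subr_gt0.
  move=> z Ez zm; rewrite cmod_distC => zd; have := le_lt_trans (lip w z) zd.
  by rewrite ltr_norml => /andP[]; lra.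
have [d2 d20 P2] : exists2 d, 0 < d & forall z, E z -> m <= phi z -> cmod (z - w) < d ->
    cmod (L2 z + k - (if phi w <= m then L1 w else L2 w + k)) <= e.
  have [mw|wm] := leP m (phi w).
    have [/ccontP/(_ e e0)[d d0 P] _] := H2 w (conj Ew mw).
    exists d => // z Ez zm zd; rewrite L2E// (_ : _ - _ = L2 z - L2 w); first exact: P.
    by rewrite opprD addrACA subrr addr0.
  exists (m - phi w); first by rewrite subr_gt0.
  move=> z Ez zm zd; have := le_lt_trans (lip z w) zd.
  by rewrite ltr_norml => /andP[]; lra.
exists (Num.min d1 d2); first by rewrite lt_min d10.
move=> z Ez; rewrite lt_min => /andP[zd1 zd2].
have [zm|/ltW mz] := leP (phi z) m; [exact: P1|exact: P2].
Qed.

Lemma exists_log_hglue (F : R[i] -> R[i]) (a m b c d : R) : a <= m -> m <= b -> c <= d ->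
  (exists L, log_on F L (rect a m c d)) -> (exists L, log_on F L (rect m b c d)) ->
  (forall w, rect a b c d w -> F w != 0) ->
  exists L, log_on F L (rect a b c d).
Proof.
move=> am mb cd [L1 H1] [L2 H2] F0.
have E1 : rect a b c d `&` [set z | complex.Re z <= m] = rect a m c d.
  apply/seteqP; split => z [].
    by move=> [/andP[z1 z2] z3] z4; split => //; apply/andP.
  by move=> /andP[z1 z2] z3; split => //; split => //; apply/andP; split => //; exact: le_trans mb.
have E2 : rect a b c d `&` [set z | m <= complex.Re z] = rect m b c d.
  apply/seteqP; split => z [].
    by move=> [/andP[z1 z2] z3] z4; split => //; apply/andP.
  by move=> /andP[z1 z2] z3; split => //; split => //; apply/andP; split => //; exact: le_trans z1.
have r1 y : c <= y <= d -> rect a m c d (m +i* y)%C by split => //=; rewrite am lexx.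
have r2 y : c <= y <= d -> rect m b c d (m +i* y)%C by split => //=; rewrite mb lexx.
pose k y := L1 (m +i* y)%C - L2 (m +i* y)%C.
have k1 y : c <= y <= d -> cexp (k y) = 1.
  move=> ycd; rewrite cexpB; have [_ ->] := H1 _ (r1 y ycd); have [_ ->] := H2 _ (r2 y ycd).
  rewrite divff// F0//; split => //=; by rewrite am mb.
have kc : cont1 (fun y => complex.Im (k y)) c d.
  have h1 := cont1_vertical Im_lipschitz (fun y ycd => conj (r1 y ycd) (proj1 (H1 _ (r1 y ycd)))).
  have h2 := cont1_vertical Im_lipschitz (fun y ycd => conj (r2 y ycd) (proj1 (H2 _ (r2 y ycd)))).
  have := cont1B h1 h2; congr (cont1 _ c d); apply/funext => y; by rewrite /k ImB.
have kE := cexp_eq1_segment kc k1.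
apply: (@log_on_glue F L1 L2 _ (@complex.Re R) m (k c)); rewrite ?E1 ?E2//.
- exact: Re_lipschitz.
- by apply: k1; rewrite lexx.
move=> z [_ z2] zm; have -> : z = (m +i* complex.Im z)%C by rewrite -zm; case: (z).
by rewrite -(kE (complex.Im z) z2) /k subrKC.
Qed.

Lemma exists_log_vglue (F : R[i] -> R[i]) (a b c m d : R) : a <= b -> c <= m -> m <= d ->
  (exists L, log_on F L (rect a b c m)) -> (exists L, log_on F L (rect a b m d)) ->
  (forall w, rect a b c d w -> F w != 0) ->
  exists L, log_on F L (rect a b c d).
Proof.
move=> ab cm md [L1 H1] [L2 H2] F0.
have E1 : rect a b c d `&` [set z | complex.Im z <= m] = rect a b c m.
  apply/seteqP; split => z [].
    by move=> [z3 /andP[z1 z2]] z4; split => //; apply/andP.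
  by move=> z3 /andP[z1 z2]; split => //; split => //; apply/andP; split => //; exact: le_trans md.
have E2 : rect a b c d `&` [set z | m <= complex.Im z] = rect a b m d.
  apply/seteqP; split => z [].
    by move=> [z3 /andP[z1 z2]] z4; split => //; apply/andP.
  by move=> z3 /andP[z1 z2]; split => //; split => //; apply/andP; split => //; exact: le_trans z1.
have r1 x : a <= x <= b -> rect a b c m (x +i* m)%C by split => //=; rewrite cm lexx.
have r2 x : a <= x <= b -> rect a b m d (x +i* m)%C by split => //=; rewrite md lexx.
pose k x := L1 (x +i* m)%C - L2 (x +i* m)%C.
have k1 x : a <= x <= b -> cexp (k x) = 1.
  move=> xab; rewrite cexpB; have [_ ->] := H1 _ (r1 x xab); have [_ ->] := H2 _ (r2 x xab).
  rewrite divff// F0//; split => //=; by rewrite cm md.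
have kc : cont1 (fun x => complex.Im (k x)) a b.
  have h1 := cont1_horizontal Im_lipschitz (fun y ycd => conj (r1 y ycd) (proj1 (H1 _ (r1 y ycd)))).
  have h2 := cont1_horizontal Im_lipschitz (fun y ycd => conj (r2 y ycd) (proj1 (H2 _ (r2 y ycd)))).
  have := cont1B h1 h2; congr (cont1 _ a b); apply/funext => y; by rewrite /k ImB.
have kE := cexp_eq1_segment kc k1.
apply: (@log_on_glue F L1 L2 _ (@complex.Im R) m (k a)); rewrite ?E1 ?E2//.
- exact: Im_lipschitz.
- by apply: k1; rewrite lexx.
move=> z [z2 _] zm; have -> : z = (complex.Re z +i* m)%C by rewrite -zm; case: (z).
by rewrite -(kE (complex.Re z) z2) /k subrKC.
Qed.

Lemma exists_log (F : R[i] -> R[i]) (a b c d : R) : a <= b -> c <= d ->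
  (forall w, rect a b c d w -> ccont (rect a b c d) F w) ->
  (forall w, rect a b c d w -> F w != 0) ->
  exists L, log_on F L (rect a b c d).
Proof.
move=> ab cd Fc F0.
suff : (forall w, rect a b c d w -> rect a b c d w) -> exists L, log_on F L (rect a b c d) by apply.
apply: (@rectangle_ind _ (fun a' b' c' d' =>
  (forall w, rect a' b' c' d' w -> rect a b c d w) -> exists L, log_on F L (rect a' b' c' d'))) => //.
  move=> a' b' c' d' ab' cd' m n P1 P2 P3 P4 sub.
  have [am mb] : a' <= m /\ m <= b' by rewrite /m; split; lra.
  have [cn nd] : c' <= n /\ n <= d' by rewrite /n; split; lra.
  have F0' w : rect a' b' c' d' w -> F w != 0 by move=> /sub; exact: F0.
  have s1 : rect a' b' c' n `<=` rect a' b' c' d' by apply: rectS.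
  have s2 : rect a' b' n d' `<=` rect a' b' c' d' by apply: rectS.
  apply: (@exists_log_vglue _ a' b' c' n d') => //.
    apply: (@exists_log_hglue _ a' m b') => //.
    - by apply: P1 => w rw; apply: sub; apply: rectS rw.
    - by apply: P2 => w rw; apply: sub; apply: rectS rw.
    - by move=> w /s1; exact: F0'.
  apply: (@exists_log_hglue _ a' m b') => //.
  - by apply: P3 => w rw; apply: sub; apply: rectS rw.
  - by apply: P4 => w rw; apply: sub; apply: rectS rw.
  - by move=> w /s2; exact: F0'.
move=> w rw; have Fw0 : 0 < cmod (F w) by rewrite cmod_gt0 F0.
have Fw2 : 0 < cmod (F w) / 2 by rewrite divr_gt0.
have [e e0 He] := proj1 (ccontP _ _ _) (Fc w rw) _ Fw2.
exists (e / 2); first by rewrite divr_gt0.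
move=> a' b' c' d' _ _ _ _ [/andP[w1 w2] /andP[w3 w4]] ba dc sub.
have [L0 L0E] := exists_cexp (F0 w rw).
(* On a small piece [|F z - F w| <= |F w| / 2], so the quotient has real part at least [1 / 2] and
   [clog] applies to it. *)
have near z : rect a' b' c' d' z -> 0 < complex.Re (F z / F w).
  move=> rz; have [/andP[z1 z2] /andP[z3 z4]] := rz.
  have /(He z (sub z rz)) : cmod (z - w) < e.
    apply: le_lt_trans (cmod_le_ReIm _) _; rewrite ReB ImB.
    have h1 : `|complex.Re z - complex.Re w| <= b' - a' by rewrite ler_norml; apply/andP; split; lra.
    have h2 : `|complex.Im z - complex.Im w| <= d' - c' by rewrite ler_norml; apply/andP; split; lra.
    lra.
  have -> : F z / F w = 1 + (F z - F w) / F w by rewrite mulrBl divff ?F0// subrKC.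
  move=> h; rewrite ReD /=.
  have : cmod ((F z - F w) / F w) <= 1 / 2.
    by rewrite cmodM cmodV ler_pdivrMr//; move: h; clear; lra.
  have := cmod_Re ((F z - F w) / F w); rewrite ler_norml => /andP[h1 _] h2; lra.
exists (fun z => L0 + clog (F z / F w)) => z rz; split; last first.
  rewrite cexpD L0E cexp_clog ?(ltW (near z rz))//.
    by rewrite mulrCA divff ?mulr1// F0.
  by rewrite mulf_neq0 ?invr_eq0 ?F0//; exact: sub.
have Fz := ccontM (ccontS sub (Fc z (sub z rz))) (@ccont_cst _ (rect a' b' c' d') (F w)^-1 z).
have Cl := @ccont_comp _ _ setT _ clog z (fun _ _ => I) Fz (ccont_clog _ (near z rz)).
exact (ccontD (@ccont_cst _ _ L0 z) Cl).
Qed.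

Lemma cdiff_local (D : set R[i]) (f : R[i] -> R[i]) w (e : R) : 0 < e ->
  cdiff (D `&` [set z | cmod (z - w) < e]) f w -> cdiff D f w.
Proof.
move=> e0 [q /ccontP qc qE].
exists (fun z => if cmod (z - w) < e then q z else (f z - f w) / (z - w)).
  apply/ccontP => e' /qc[d d0 P]; exists (Num.min d e); first by rewrite lt_min d0.
  move=> z Dz; rewrite lt_min => /andP[zd ze]; rewrite ze subrr cmod0 e0.
  exact: P.
move=> z Dz; case: ifPn => ze; first exact: qE.
by rewrite divfK//; apply: contra ze => /eqP ->; rewrite cmod0.
Qed.

(** From [F z - F w = r (L z) (L z - L w)], with [r (L z)] close to [exp (L w) != 0] near [w], the
    difference quotient of [L] is that of [F] divided by [r (L z)]. *)
Lemma log_on_cdiff (F L : R[i] -> R[i]) (D : set R[i]) w :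
  log_on F L D -> D w -> cdiff D F w -> cdiff D L w.
Proof.
move=> HL Dw [q qc qE].
have [r [rw rc] rE] := cexp_cdiff setT (L w).
have Lc := proj1 (HL w Dw).
have rLc := @ccont_comp _ D setT L r w (fun _ _ => I) Lc rc.
have m0 : 0 < cmod (cexp (L w)) by rewrite cmod_gt0 cexp_neq0.
have m2 : 0 < cmod (cexp (L w)) / 2 by rewrite divr_gt0.
have [e e0 He] := proj1 (ccontP _ _ _) rLc _ m2.
apply: (cdiff_local e0); set D' := _ `&` _.
have DD : D' `<=` D by move=> z [].
have rn0 z : D' z -> r (L z) != 0.
  move=> [Dz ze]; apply/negP => /eqP r0.
  by have := He z Dz ze; rewrite /= r0 sub0r cmodN rw leNgt ltr_pdivrMr// ltr_pMr ?ltr1n.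
have rw0 : r (L w) != 0 by rewrite rw cexp_neq0.
exists (fun z => q z * (r (L z))^-1).
  exact (ccontM (ccontS DD qc) (ccontV rw0 (ccontS DD rLc))).
move=> z D'z; have Dz := DD z D'z.
have := rE (L z) I; have [_ ->] := HL z Dz; have [_ ->] := HL w Dw.
by rewrite mulrAC -(qE z Dz) => ->; rewrite mulrAC divff ?rn0// mul1r.
Qed.

(** [G = exp ((p / 2) L)] for a logarithm [L] of [F]. Over one period [L] changes by a constant in
    the kernel of the exponential, which is purely imaginary, so [G] is multiplied by a unimodular
    [k], in general not [1]. *)
Lemma exists_power_root (p : R) (F : R[i] -> R[i]) (a b c d : R) : a <= b -> c <= d ->
  (forall w, rect a b c d w -> cdiff (rect a b c d) F w) ->
  (forall w, rect a b c d w -> F w != 0) ->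
  (forall x, a <= x <= b -> F (x +i* d)%C = F (x +i* c)%C) ->
  exists G, [/\ forall w, rect a b c d w -> cdiff (rect a b c d) G w,
    forall w, rect a b c d w -> cmod (G w) ^+ 2 = cmod (F w) `^ p &
    exists2 k, cmod k = 1 & forall x, a <= x <= b -> G (x +i* d)%C = k * G (x +i* c)%C].
Proof.
move=> ab cd Fd F0 per.
have [L HL] := exists_log ab cd (fun w rw => cdiff_ccont (Fd w rw)) F0.
pose q : R[i] := (p / 2)%:C%C.
have Req z : complex.Re (q * z) = p / 2 * complex.Re z by case: z => ? ? /=; ring.
exists (fun z => cexp (q * L z)); split.
- move=> w rw; have Ld := log_on_cdiff HL rw (Fd w rw).
  have qL := cdiffM (@cdiff_cst _ (rect a b c d) q w) Ld.
  exact (@cdiff_comp _ _ setT _ cexp w (fun _ _ => I) qL (cdiff_cexp _ _)).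
- move=> w rw; have [_ <-] := HL w rw.
  rewrite !cmod_cexp Req -expRM_natl /powR gt_eqF ?expR_gt0// expRK; congr expR.
  by rewrite mulr_natl; field.
have r1 x : a <= x <= b -> rect a b c d (x +i* d)%C by split => //=; rewrite cd lexx.
have r2 x : a <= x <= b -> rect a b c d (x +i* c)%C by split => //=; rewrite cd lexx.
pose k x := L (x +i* d)%C - L (x +i* c)%C.
have k1 x : a <= x <= b -> cexp (k x) = 1.
  move=> xab; rewrite cexpB; have [_ ->] := HL _ (r1 x xab); have [_ ->] := HL _ (r2 x xab).
  by rewrite per// divff// F0//; exact: r2.
have kc : cont1 (fun x => complex.Im (k x)) a b.
  have h1 := cont1_horizontal Im_lipschitz (fun y ycd => conj (r1 y ycd) (proj1 (HL _ (r1 y ycd)))).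
  have h2 := cont1_horizontal Im_lipschitz (fun y ycd => conj (r2 y ycd) (proj1 (HL _ (r2 y ycd)))).
  have := cont1B h1 h2; congr (cont1 _ a b); apply/funext => y; by rewrite /k ImB.
have kE := cexp_eq1_segment kc k1.
exists (cexp (q * k a)).
  have [rk _ _] := cexp_eq1 (k1 a (introT andP (conj (lexx a) ab))).
  by rewrite cmod_cexp Req rk mulr0 expR0.
by move=> x xab; rewrite -(kE x xab) -cexpD -mulrDr /k subrK.
Qed.

End ContinuousLogarithm.

(** * Comparison of the means on two vertical lines *)

Section QuadraticMeans.
Context {R : realType}.

Lemma cont1M (f g : R -> R) a b : cont1 f a b -> cont1 g a b -> cont1 (fun x => f x * g x) a b.
Proof. by move=> fc gc x; apply: cvgM; [exact: fc|exact: gc]. Qed.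

Lemma cont1D (f g : R -> R) a b : cont1 f a b -> cont1 g a b -> cont1 (fun x => f x + g x) a b.
Proof. by move=> fc gc x; apply: cvgD; [exact: fc|exact: gc]. Qed.

Lemma eq_cont1 (f g : R -> R) a b : (forall x, a <= x <= b -> f x = g x) ->
  cont1 f a b -> cont1 g a b.
Proof.
move=> fg /cont1P H; apply/cont1P => x xab e /(H x xab)[d d0 P]; exists d => // y yab.
by rewrite -!fg//; exact: P.
Qed.

Definition reflect_Re (m : R) (z : R[i]) : R[i] := Complex (2 * m - complex.Re z) (complex.Im z).

Lemma reflect_ReB m (z w : R[i]) : reflect_Re m z - reflect_Re m w = - conjc (z - w).
Proof.
case: z w => [x y] [x' y']; apply/eqP; rewrite eq_complex /=.
by apply/andP; split; apply/eqP; ring.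
Qed.

Lemma ccont_reflect (D : set R[i]) m w : ccont D (reflect_Re m) w.
Proof.
apply/ccontP => e e0; exists e => // z _ zw.
by rewrite reflect_ReB cmodN cmod_conj ltW.
Qed.

Lemma ccont_conj (D : set R[i]) (f : R[i] -> R[i]) w : ccont D f w -> ccont D (fun z => conjc (f z)) w.
Proof.
move=> /ccontP H; apply/ccontP => e /H[d d0 P]; exists d => // z Dz zd.
by rewrite -rmorphB cmod_conj; exact: P.
Qed.

(** Conjugation and reflection are both antiholomorphic, so applying one before and the other after
    [f] is holomorphic; the factor [-1] comes from [reflect_ReB]. *)
Lemma cdiff_conj_reflect (D : set R[i]) (f : R[i] -> R[i]) m w :
  (forall z, D z -> D (reflect_Re m z)) -> cdiff D f (reflect_Re m w) ->
  cdiff D (fun z => conjc (f (reflect_Re m z))) w.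
Proof.
move=> DD [q qc qE]; exists (fun z => -1 * conjc (q (reflect_Re m z))).
  have h := ccont_comp DD (@ccont_reflect D m w) qc.
  exact (ccontM (@ccont_cst _ _ (-1) _) (ccont_conj h)).
move=> z Dz; rewrite -rmorphB qE; last exact: DD.
by rewrite reflect_ReB rmorphM rmorphN /= conjcK mulN1r mulNr mulrN.
Qed.

Lemma sqr_cmodB (z w : R[i]) :
  cmod (z - w) ^+ 2 = cmod z ^+ 2 + cmod w ^+ 2 - 2 * complex.Re (z * conjc w).
Proof. by rewrite !sqr_cmod; case: z w => [? ?] [? ?] /=; ring. Qed.

Lemma Re_mul_conj (z : R[i]) : complex.Re (z * conjc z) = cmod z ^+ 2.
Proof. by rewrite sqr_cmod; case: z => ? ? /=; ring. Qed.

(* With [cmod G ^+ 2 = cmod F `^ p], the function [G z * (G (2 m - z^* ))^*] is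
   holomorphic, equals [cmod F `^ p] on the line [Re z = m], and has the same
   integral over all vertical lines. *)
Lemma power_mean_defect (p : R) (F : R[i] -> R[i]) (a b c d : R) : a <= b -> c <= d ->
  (forall w, rect a b c d w -> cdiff (rect a b c d) F w) ->
  (forall w, rect a b c d w -> F w != 0) ->
  (forall x, a <= x <= b -> F (x +i* d)%C = F (x +i* c)%C) ->
  let u s y := cmod (F (s +i* y)%C) `^ p in
  let E := itg (u a) c d + itg (u b) c d - 2 * itg (u ((a + b) / 2)) c d in
  0 <= E /\ forall t1 t2, c <= t1 -> t1 <= t2 -> t2 <= d ->
    itg (u b) t1 t2 <= 2 * E + 2 * itg (u a) t1 t2.
Proof.
move=> ab cd Fd F0 per u E.
have [G [Gd GF [k k1 kG]]] := exists_power_root p ab cd Fd F0 per.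
pose m := (a + b) / 2; have [am mb] : a <= m /\ m <= b by rewrite /m; split; lra.
have cl (z t : R[i]) : `|cmod z - cmod t| <= cmod (z - t) by exact: ler_dist_cmod.
pose D := rect a b c d.
pose g s y := cmod (G (s +i* y)%C) ^+ 2.
have Dp s y : a <= s <= b -> c <= y <= d -> D (s +i* y)%C by [].
have gu s y : a <= s <= b -> c <= y <= d -> u s y = g s y.
  by move=> sab ycd; rewrite /u /g GF//; exact: Dp.
have Gc w (Dw : D w) := cdiff_ccont (Gd w Dw).
have gc s : a <= s <= b -> cont1 (g s) c d.
  move=> sab; have h := cont1_vertical cl (fun y ycd => conj (Dp s y sab ycd) (Gc _ (Dp s y sab ycd))).
  by have := cont1M h h; congr (cont1 _ c d); apply/funext => y; rewrite /g expr2.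
have itgu s t1 t2 : a <= s <= b -> c <= t1 -> t2 <= d -> itg (u s) t1 t2 = itg (g s) t1 t2.
  move=> sab ct td; apply: eq_itg => y /andP[y1 y2]; apply: gu => //.
  by rewrite (le_trans ct)//= (le_trans y2).
have aab : a <= a <= b by rewrite lexx.
have bab : a <= b <= b by rewrite lexx ab.
have mab : a <= m <= b by rewrite am.
have DD z : D z -> D (reflect_Re m z).
  by move=> [/andP[z1 z2] z3]; split => //=; rewrite /m; apply/andP; split; lra.
pose H z := G z * conjc (G (reflect_Re m z)).
have Hd z : D z -> cdiff D H z.
  by move=> Dz; exact (cdiffM (Gd z Dz) (cdiff_conj_reflect DD (Gd _ (DD z Dz)))).
have Hc z (Dz : D z) := cdiff_ccont (Hd z Dz).
have sub : rect m b c d `<=` D by apply: rectS.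
(* The two multipliers combine to [k * conjc k = 1]. The horizontal sides then cancel in Goursat's
   theorem, and the integrals along the lines at [m] and at [b] agree. *)
have Hper x : a <= x <= b -> H (x +i* d)%C = H (x +i* c)%C.
  move=> xab; rewrite /H /reflect_Re /= !kG//; last by rewrite /m; apply/andP; split; lra.
  have kk : k * conjc k = 1.
    have := sqr_cmod k; rewrite k1 expr1n => kE; apply/eqP; rewrite eq_complex /=.
    by move: kE; case: (k) => x' y' /= kE; apply/andP; split; apply/eqP; rewrite ?kE; ring.
  by rewrite rmorphM mulrACA kk mul1r.
have := goursat mb cd (fun w rw => cdiffS sub (Hd w (sub w rw))).
rewrite /Lam (@eq_itg _ _ (fun x => complex.Im (H (x +i* d)%C)) m b); last first.
  by move=> x /andP[x1 x2]; rewrite Hper// (le_trans am).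
rewrite subrr add0r => /eqP; rewrite subr_eq0 => /eqP HE.
have HmE : itg (fun y => complex.Re (H (m +i* y)%C)) c d = itg (u m) c d.
  rewrite itgu//; apply: eq_itg => y ycd; rewrite /H /g -Re_mul_conj /reflect_Re /=.
  by rewrite (_ : 2 * m - m = m)//; ring.
pose v y := cmod (G (b +i* y)%C - G (a +i* y)%C) ^+ 2.
have Hbc : cont1 (fun y => complex.Re (H (b +i* y)%C)) c d.
  exact (cont1_vertical Re_lipschitz (fun y ycd => conj (Dp b y bab ycd) (Hc _ (Dp b y bab ycd)))).
(* The reflection in [Re z = m] exchanges the lines at [a] and [b], so the cross term of the square
   is [H]. *)
have vE y : v y = g b y + g a y - 2 * complex.Re (H (b +i* y)%C).
  rewrite /v sqr_cmodB /g /H /reflect_Re /=.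
  by rewrite (_ : 2 * m - b = a)// /m; field.
have vc : cont1 v c d.
  have := cont1B (cont1D (gc b bab) (gc a aab)) (@cont1Z _ 2 _ _ _ Hbc).
  by congr (cont1 _ c d); apply/funext => y; rewrite vE.
have v0 y : 0 <= v y by rewrite sqr_ge0.
have EE : itg v c d = E.
  rewrite (@eq_itg _ v (fun y => g b y + g a y - 2 * complex.Re (H (b +i* y)%C))); last by move=> y _.
  rewrite itgB; [|by apply: cont1D; exact: gc|exact: cont1Z].
  rewrite itgD; [|exact: gc|exact: gc].
  rewrite (itgZ 2 Hbc) HE HmE /E -/m (itgu a c d aab (lexx _) (lexx _)).
  by rewrite (itgu b c d bab (lexx _) (lexx _)) [itg (g b) c d + _]addrC.
split; first by rewrite -EE; apply: itg_ge0.
move=> t1 t2 ct t12 td; rewrite !itgu//.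
have vc' := cont1S ct td vc.
have gac := cont1S ct td (gc a aab); have gbc := cont1S ct td (gc b bab).
(* Pointwise this is [(x + y)^2 <= 2 x^2 + 2 y^2] applied to the triangle inequality. *)
apply: (@le_trans _ _ (itg (fun y => 2 * v y + 2 * g a y) t1 t2)).
  apply: le_itg => //; first by apply: cont1D; apply: cont1Z.
  move=> y _; rewrite /v /g.
  have := cmodD (G (b +i* y)%C - G (a +i* y)%C) (G (a +i* y)%C); rewrite subrK.
  have := cmod_ge0 (G (b +i* y)%C); have := cmod_ge0 (G (a +i* y)%C).
  have := cmod_ge0 (G (b +i* y)%C - G (a +i* y)%C).
  move: (cmod _) (cmod _) (cmod _) => x1 x2 x3 h1 h2 h3 h4.
  apply: (@le_trans _ _ ((x3 + x2) ^+ 2)); first by rewrite ler_sqr ?nnegrE ?addr_ge0.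
  by rewrite -subr_ge0 (_ : _ - _ = (x3 - x2) ^+ 2) ?sqr_ge0//; ring.
rewrite itgD; [|exact: cont1Z|exact: cont1Z].
rewrite !itgZ// lerD2r ler_wpM2l// -EE.
by apply: itg_subset_le.
Qed.

End QuadraticMeans.

(** * Bounded midpoint convex functions near an endpoint *)

Section MidpointConvexity.
Context {R : realType}.

(** Every point of [[m1, m2]] is the midpoint of an endpoint and another point of the interval, so
    [I <= (M + sup I) / 2] throughout. As [sup I] is finite, [sup I <= M]; continuity is replaced by
    boundedness. *)
Lemma midconvex_le_max (I : R -> R) (m1 m2 B b : R) :
  (forall s, m1 <= s <= m2 -> I s <= B) ->
  (forall s t, m1 <= s -> s <= t -> t <= m2 -> 2 * I ((s + t) / 2) <= I s + I t) ->
  m1 <= b <= m2 -> I b <= Num.max (I m1) (I m2).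
Proof.
move=> IB Imid bm; set M := Num.max _ _.
pose S : set R := [set I s | s in [set s | m1 <= s <= m2]].
have Sb : S (I b) by exists b.
have Sub : has_ubound S by exists B => _ [s sm <-]; exact: IB.
have M1 : I m1 <= M by rewrite le_max lexx.
have M2 : I m2 <= M by rewrite le_max lexx orbT.
have half s : m1 <= s <= m2 -> I s <= (M + sup S) / 2.
  move=> /andP[s1 s2]; have [h|h] := leP s ((m1 + m2) / 2).
    have h1 : m1 <= 2 * s - m1 by lra.
    have h2 : 2 * s - m1 <= m2 by lra.
    have := Imid m1 (2 * s - m1) (lexx _) h1 h2.
    have -> : (m1 + (2 * s - m1)) / 2 = s by field.
    have : I (2 * s - m1) <= sup S by apply: ub_le_sup => //; exists (2 * s - m1) => //=; apply/andP.
    lra.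
  have h1 : m1 <= 2 * s - m2 by lra.
  have h2 : 2 * s - m2 <= m2 by lra.
  have := Imid (2 * s - m2) m2 h1 h2 (lexx _).
  have -> : (2 * s - m2 + m2) / 2 = s by field.
  have : I (2 * s - m2) <= sup S by apply: ub_le_sup => //; exists (2 * s - m2) => //=; apply/andP.
  lra.
have SM : sup S <= (M + sup S) / 2.
  by apply: ge_sup; [exists (I b)|move=> _ [s sm <-]; exact: half].
by have := half b bm; lra.
Qed.

(** Let [l] be the upper limit of [I] at [0] from the left. Dips below [l - n] arbitrarily close to
    [0] would enclose a point with [I > l - n], against quasiconvexity. So [I] ends up within [n] of
    [l], and the defect is at most [4 n = e]. *)
Lemma midconvex_defect_lt (I : R -> R) (A B e : R) : A < 0 ->
  (forall s, A < s -> s < 0 -> 0 <= I s <= B) ->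
  (forall s t, A < s -> s <= t -> t < 0 -> 2 * I ((s + t) / 2) <= I s + I t) ->
  0 < e -> exists s1, [/\ A < s1, s1 < 0 & forall s, s1 <= s -> s < 0 ->
    I s1 + I s - 2 * I ((s1 + s) / 2) <= e].
Proof.
move=> A0 IB Imid e0.
have quasi m1 b m2 : A < m1 -> m1 <= b -> b <= m2 -> m2 < 0 -> I b <= Num.max (I m1) (I m2).
  move=> Am mb bm m0; apply: (@midconvex_le_max I m1 m2 B b); last by apply/andP.
    by move=> s /andP[s1 s2]; have /andP[] := IB s (lt_le_trans Am s1) (le_lt_trans s2 m0).
  by move=> s t s1 st t2; apply: Imid => //; [exact: lt_le_trans s1|exact: le_lt_trans m0].
(* The eventual upper bounds of [I] at [0]; their infimum is the upper limit. *)
pose S : set R := [set M | exists2 d, A <= d < 0 & forall s, d < s -> s < 0 -> I s <= M].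
have SB : S B.
  exists A; first by rewrite lexx.
  by move=> s As s0; have /andP[] := IB s As s0.
have Slb : lbound S 0.
  move=> M [d /andP[Ad d0] HM].
  have h1 : d < d / 2 by lra.
  have h2 : d / 2 < 0 by lra.
  by apply: le_trans (HM _ h1 h2); have /andP[] := IB (d / 2) (le_lt_trans Ad h1) h2.
have Sinf : has_inf S by split; [exists B|exists 0].
pose l := inf S; pose n := e / 4; have n0 : 0 < n by rewrite divr_gt0.
have [M [d /andP[Ad d0] HM] Ml] := inf_adherent n0 Sinf.
have often d' : A <= d' -> d' < 0 -> exists s, [/\ d' < s, s < 0 & l - n < I s].
  move=> Ad' d'0; apply: contrapT => nex.
  have : S (l - n).
    exists d'; first by rewrite Ad'.
    by move=> s d's s0; rewrite leNgt; apply/negP => h; apply: nex; exists s.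
  by move=> /(ge_inf (ex_intro _ 0 Slb)); rewrite -/l; lra.
have [s0 [Hs0 s00 low]] : exists s0, [/\ d <= s0, s0 < 0 & forall s, s0 < s -> s < 0 -> l - n <= I s].
  apply: contrapT => nex.
  have bad s0 : d <= s0 -> s0 < 0 -> exists s, [/\ s0 < s, s < 0 & I s < l - n].
    move=> ds0 s00; apply: contrapT => nb; apply: nex; exists s0; split => // s h1 h2.
    by rewrite leNgt; apply/negP => h; apply: nb; exists s.
  have [m1 [dm1 m10 I1]] := bad d (lexx _) d0.
  have [b [mb b0 Ib]] := often m1 (le_trans Ad (ltW dm1)) m10.
  have [m2 [bm2 m20 I2]] := bad b (le_trans (ltW dm1) (ltW mb)) b0.
  have := quasi m1 b m2 (le_lt_trans Ad dm1) (ltW mb) (ltW bm2) m20.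
  by rewrite le_max => /orP[]; lra.
exists (s0 / 2); split; [|lra|].
  by apply: le_lt_trans (le_trans Ad Hs0) _; lra.
move=> s s1 sn; have h1 : s0 < s0 / 2 by lra.
have h2 : s0 / 2 < 0 by lra.
have h3 : s0 < (s0 / 2 + s) / 2 by lra.
have h4 : (s0 / 2 + s) / 2 < 0 by lra.
have := low _ h3 h4.
have := HM _ (le_lt_trans Hs0 h1) h2.
have := HM s (le_lt_trans Hs0 (lt_le_trans h1 s1)) sn.
by rewrite -/l in Ml *; move: Ml; rewrite /n; lra.
Qed.

End MidpointConvexity.

(** * Translation of the variable of integration *)

Section Shift.
Context {R : realType}.

Lemma itg_shift (g : R -> R) (a b c : R) : a <= b -> cont1 g (a + c) (b + c) ->
  itg g (a + c) (b + c) = itg (fun t => g (t + c)) a b.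
Proof.
move=> ab gc; rewrite /itg /Rintegral; congr fine.
pose F t := t + c.
have dF x : derivable F x 1.
  by apply: derivableD; [exact: derivable_id|exact: derivable_cst].
have F1 : derive1 F = cst 1.
  apply/funext => x; rewrite derive1E deriveD ?derive_id ?derive_cst ?addr0//.
have := @integration_by_substitution_increasing R F g a b ab.
rewrite F1 => -> //.
- by apply: eq_integral => x _ /=; rewrite mulr1.
- by move=> x y _ _; rewrite ltrD2r.
- by move=> x _; exact: cvg_cst.
- exact: is_cvg_cst.
- exact: is_cvg_cst.
- have cF x : {for x, continuous F} by apply: differentiable_continuous; apply/derivable1_diffP.
  split => //.
  + by apply: cvg_at_right_filter; exact: cF.
  + by apply: cvg_at_left_filter; exact: cF.
Qed.

End Shift.

(** * The Hardy case in logarithmic coordinates *)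

Section HardyDecay.
Context {R : realType}.

Lemma cont1_powR (f : R -> R) (p a b : R) : (forall x, 0 < f x) -> cont1 f a b ->
  cont1 (fun x => f x `^ p) a b.
Proof.
move=> f0 fc.
have E : (fun x => f x `^ p) = (fun x => expR (p * ln (f x))).
  by apply/funext => x; rewrite /powR gt_eqF.
rewrite E => x; apply: continuous_cvg; first exact: continuous_expR.
apply: cvgM; first exact: cvg_cst.
by apply: continuous_cvg; [exact: continuous_ln|exact: fc].
Qed.

Lemma circle_pt_periodic (r t : R) : circle_pt r (t + 2 * pi) = circle_pt r t.
Proof. by rewrite /circle_pt mulr_natl cosD2pi sinD2pi. Qed.

(* [f] is read in logarithmic coordinates, [A < ln `|z| < 0] being an annulus
   where it has no zeros. *)
Context (f : R[i] -> R[i]) (p A B : R) (p0 : 0 < p) (A0 : A < 0).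
Let F z := f (cexp z).
Let u s t := cmod (F (s +i* t)%C) `^ p.
Context (Fd : forall D w, complex.Re w < 0 -> cdiff D F w).
Context (F0 : forall w, A < complex.Re w -> complex.Re w < 0 -> F w != 0).
Context (uB : forall s, A < s -> s < 0 -> itg (u s) 0 (2 * pi) <= B).

Lemma periodicF x y : F (x +i* (y + 2 * pi))%C = F (x +i* y)%C.
Proof. by rewrite /F /cexp /= circle_pt_periodic. Qed.

Lemma cont1_u s c d : A < s -> s < 0 -> cont1 (u s) c d.
Proof.
move=> As s0; apply: cont1_powR => [t|]; first by rewrite cmod_gt0 F0.
have cl (z t : R[i]) : `|cmod z - cmod t| <= cmod (z - t) by exact: ler_dist_cmod.
by apply: (@cont1_vertical _ _ setT F c d s cl) => y _; split => //; apply/cdiff_ccont/Fd.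
Qed.

Lemma itg_u_shift s : A < s -> s < 0 -> itg (u s) (- pi) (- pi + 2 * pi) = itg (u s) 0 (2 * pi).
Proof.
move=> As s0; have pi0 := pi_ge0 R.
have uc c d := @cont1_u s c d As s0.
rewrite (@itg_split _ _ (- pi) 0) //; [|by lra|by lra].
rewrite (@itg_split _ (u s) 0 pi (2 * pi)) //; [|by lra].
rewrite (_ : - pi + 2 * pi = pi); last by ring.
rewrite addrC; congr (_ + _).
have := @itg_shift _ (u s) (- pi) 0 (2 * pi) (ltac:(lra)) (uc _ _).
rewrite (_ : - pi + 2 * pi = pi); last by ring.
rewrite add0r => ->; apply: eq_itg => t _; by rewrite /u periodicF.
Qed.

(** Uniform integrability: on the reference line [s1] the density is at most [C], and passing to any
    later line costs twice the defect. The period is cut at [tau]; two cuts are provided since a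
    square around a point near one cut would cross it. *)
Lemma u_window_bound tau (e : R) : tau = 0 \/ tau = - pi -> 0 < e ->
  exists s1 C, [/\ A < s1, s1 < 0, 0 <= C & forall s t1 t2, s1 <= s -> s < 0 ->
    tau <= t1 -> t1 <= t2 -> t2 <= tau + 2 * pi ->
    itg (u s) t1 t2 <= 2 * e + 2 * (C * (t2 - t1))].
Proof.
move=> tauE e0; have pi0 := pi_ge0 R.
pose I s := itg (u s) tau (tau + 2 * pi).
have tt : tau <= tau + 2 * pi by lra.
have IB s : A < s -> s < 0 -> 0 <= I s <= B.
  move=> As s0; rewrite itg_ge0/=; last by move=> t _; exact: powR_ge0.
  by rewrite /I; case: tauE => ->; [rewrite add0r|rewrite itg_u_shift//]; exact: uB.
have defect s t : A < s -> s <= t -> t < 0 ->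
    0 <= I s + I t - 2 * I ((s + t) / 2) /\ forall t1 t2, tau <= t1 -> t1 <= t2 ->
      t2 <= tau + 2 * pi ->
      itg (u t) t1 t2 <= 2 * (I s + I t - 2 * I ((s + t) / 2)) + 2 * itg (u s) t1 t2.
  move=> As st t0; apply: (@power_mean_defect R p F s t tau (tau + 2 * pi) st tt).
  - by move=> w [/andP[_ w2] _]; apply: Fd; exact: le_lt_trans w2 t0.
  - by move=> w [/andP[w1 w2] _]; apply: F0; [exact: lt_le_trans w1|exact: le_lt_trans w2 t0].
  - by move=> x _; exact: periodicF.
have Imid s t : A < s -> s <= t -> t < 0 -> 2 * I ((s + t) / 2) <= I s + I t.
  by move=> As st t0; have [E0 _] := defect s t As st t0; rewrite -subr_ge0.
have [s1 [As1 s10 Hs1]] := midconvex_defect_lt A0 IB Imid e0.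
have Rd w : rect s1 s1 tau (tau + 2 * pi) w -> ccont (rect s1 s1 tau (tau + 2 * pi)) F w.
  by move=> [/andP[_ w2] _]; apply/cdiff_ccont/Fd; exact: le_lt_trans w2 s10.
have [M HM] := bounded_on_rect (lexx s1) tt Rd.
have rt t : tau <= t <= tau + 2 * pi -> rect s1 s1 tau (tau + 2 * pi) (s1 +i* t)%C.
  by split => //=; rewrite lexx.
exists s1, (M `^ p); split => //; first exact: powR_ge0.
move=> s t1 t2 s1s s0 tt1 t12 t2t.
have [_ H] := defect s1 s As1 s1s s0.
apply: le_trans (H t1 t2 tt1 t12 t2t) _.
have E1 := Hs1 s s1s s0.
have E2 : itg (u s1) t1 t2 <= M `^ p * (t2 - t1).
  rewrite -(itg_cst _ t12); apply: (le_itg (@cont1_u s1 t1 t2 As1 s10) (@cont1_cst _ _ _ _)).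
  move=> t /andP[h1 h2]; have ht : tau <= t <= tau + 2 * pi by rewrite (le_trans tt1 h1) (le_trans h2 t2t).
  have := HM _ (rt t ht) => h; apply: ge0_ler_powR; rewrite ?nnegrE ?cmod_ge0 ?(ltW p0)//.
  exact: le_trans (cmod_ge0 _) h.
by apply: lerD; rewrite ler_wpM2l.
Qed.

(** The square around [s + i t] has half side [r = - s / 2], and each vertical slice of it has
    length [2 r] and mass at most [2 eta + 4 C r]. The submean inequality bounds [r^2 u] by [2 r K]
    times this, so [r u] is small. *)
Lemma u_window_decay tau (e : R) : tau = 0 \/ tau = - pi -> 0 < e ->
  exists2 d, 0 < d & forall s t, - d < s -> s < 0 -> tau + 1 <= t -> t <= tau + 2 * pi - 1 ->
    u s t * - s <= e.
Proof.
move=> tauE e0; have [K K0 HK] := @area_submean_powR R p p0.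
have eta0 : 0 < e / (16 * K) by rewrite divr_gt0 ?mulr_gt0.
have [s1 [C [As1 s10 C0 H]]] := u_window_bound tauE eta0.
have c0 : 0 < e / (16 * K * (C + 1)) by rewrite divr_gt0 ?mulr_gt0//; lra.
(* The bound [2] gives [r <= 1], so the square stays in the window; [- s1 (2 / 3)] gives
   [s - r = 3 s / 2 >= s1]; the last term makes the contribution of [C] at most [e / 2]. *)
exists (Num.min (Num.min 2 (- s1 * (2 / 3))) (e / (16 * K * (C + 1)))).
  by rewrite !lt_min c0 andbT ltr0n /=; lra.
move=> s t; rewrite ltrNl !lt_min => /andP[/andP[h1 h2] h3] s0 t1 t2.
pose r := - s / 2; have r0 : 0 < r by rewrite /r; lra.
have r1 : r <= 1 by rewrite /r; lra.
have Q z : square (s +i* t)%C r z -> [/\ s1 <= complex.Re z, complex.Re z < 0,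
   tau <= complex.Im z & complex.Im z <= tau + 2 * pi].
  by rewrite /square /= => -[/andP[z1 z2] /andP[z3 z4]]; move: z1 z2 z3 z4; rewrite /r => *; split; lra.
have Qd z : square (s +i* t)%C r z -> cdiff (square (s +i* t)%C r) F z.
  by move=> /Q[_ z0 _ _]; exact: Fd.
pose J := 2 * r * (2 * (e / (16 * K)) + 2 * (C * (2 * r))).
have HJ : (area_integral (square (s +i* t)%C r) (fun z => cmod (F z) `^ p)%R <= J%:E)%E.
  have um : measurable_fun (@to_complex R @^-1` square (s +i* t)%C r)
      (fun v => cmod (F (to_complex v)) `^ p).
    apply: (measurableT_comp (measurable_powR p)).
    exact (measurable_fun_cmod (measurable_preimage_rect _ _ _ _) (fun w Qw => cdiff_ccont (Qd w Qw))).
  have uv x : s - r <= x <= s + r -> cont1 (u x) (t - r) (t + r).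
    by rewrite /r => /andP[x1 x2]; apply: cont1_u; lra.
  have uh y : t - r <= y <= t + r -> cont1 (fun x => cmod (F (x +i* y)%C) `^ p) (s - r) (s + r).
    move=> yy; have cl (z w : R[i]) : `|cmod z - cmod w| <= cmod (z - w) by exact: ler_dist_cmod.
    (* [cont1_powR] asks for positivity on the whole line, so [x] is clamped to the interval where
       [F] has no zeros. *)
    have h : cont1 (fun x => cmod (F (Num.max (s - r) (Num.min x (s + r)) +i* y)%C)) (s - r) (s + r).
      apply: (@eq_cont1 _ (fun x => cmod (F (x +i* y)%C))).
        by move=> x /andP[x1 x2]; rewrite (min_idPl x2) (max_idPr x1).
      apply: (@cont1_horizontal _ _ setT F _ _ y cl) => x /andP[x1 x2]; split => //.
      by apply/cdiff_ccont/Fd => /=; move: x2; rewrite /r; lra.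
    have pos x : 0 < cmod (F (Num.max (s - r) (Num.min x (s + r)) +i* y)%C).
      rewrite cmod_gt0 F0//=.
        by rewrite lt_max; apply/orP; left; move: h2; rewrite /r; lra.
      rewrite gt_max; apply/andP; split; first by lra.
      by rewrite gt_min; apply/orP; right; rewrite /r; lra.
    have hp := cont1_powR (p := p) pos h; refine (eq_cont1 _ hp) => x /andP[x1 x2].
    by rewrite (min_idPl x2) (max_idPr x1).
  have [G [_ [[mG _] [G0 _] [iG _] [GE Gout] _]]] := @fubini_rect R (fun z => cmod (F z) `^ p)
    (s - r) (s + r) (t - r) (t + r) (fun z => powR_ge0 _ _) um uv uh.
  rewrite -iG.
  have -> : (\int[lebesgue_measure]_x G x = \int[lebesgue_measure]_(x in `[(s - r)%R, (s + r)%R]) G x)%E.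
    rewrite [RHS]integral_mkcond; apply: eq_integral => x _; rewrite patchE; case: ifPn => //.
    by rewrite notin_setE /= in_itv /= => /negP/Gout.
  pose N := 2 * (e / (16 * K)) + 2 * (C * (2 * r)).
  have N0 : 0 <= N.
    apply: addr_ge0; apply: mulr_ge0 => //; first exact: ltW.
    by apply: mulr_ge0 => //; apply: mulr_ge0 => //; exact: ltW.
  apply: (@le_trans _ _ (\int[lebesgue_measure]_(x in `[(s - r)%R, (s + r)%R]) (cst N%:E) x)%E).
    apply: ge0_le_integral => //.
    - by apply: measurable_funTS.
    - move=> x; rewrite /= in_itv /= => xr; rewrite GE// lee_fin.
      have /andP[x1 x2] := xr.
      have := H x (t - r) (t + r); rewrite (_ : t + r - (t - r) = 2 * r); last by ring.
      by apply; move: h2 x1 x2; rewrite /r => *; lra.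
  rewrite integral_cst//=; have := @lebesgue_measure_itv R `[s - r, s + r].
  rewrite /= lte_fin => ->; rewrite ifT; last by lra.
  by rewrite -EFinD -EFinM lee_fin /J -/N le_eqVlt; apply/orP; left; apply/eqP; ring.
have := HK F (s +i* t)%C r J r0 Qd HJ; rewrite -/(u s t) => HU.
have HU2 : r * u s t <= K * (2 * (2 * (e / (16 * K)) + 2 * (C * (2 * r)))).
  rewrite -(ler_pM2l r0) [X in X <= _](_ : _ = r ^+ 2 * u s t); last by ring.
  apply: le_trans HU _.
  by rewrite /J le_eqVlt; apply/orP; left; apply/eqP; ring.
have h4 : 8 * K * C * (2 * r) <= e / 2.
  have C1 : 0 < C + 1 by lra.
  have : - s * (16 * K * (C + 1)) < e by rewrite -ltr_pdivlMr ?mulr_gt0.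
  have : 0 <= - s * (16 * K) by rewrite !mulr_ge0 ?(ltW K0)// oppr_ge0 ltW.
  by rewrite /r; nra.
have h5 : 4 * K * (e / (16 * K)) = e / 4 by field; apply: lt0r_neq0.
have -> : u s t * - s = 2 * (r * u s t) by rewrite /r; field.
by move: HU2 h4 h5; lra.
Qed.

End HardyDecay.

(** * The Hardy case back on the disk *)

Section HardyPowerDecay.
Context {R : realType}.

Lemma hardy_power_decay (p : R) (f : R[i] -> R[i]) : 0 < p ->
  hardy p f -> set_inj (disk 1) f -> power_decay p 1 f.
Proof.
move=> p0 [fh fsup] finj e e0.
pose F (z : R[i]) := f (cexp z).
have cexp1 (w : R[i]) : complex.Re w < 0 -> cmod (cexp w) < 1.
  by move=> w0; rewrite cmod_cexp -expR0 ltr_expR.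
have Fd D w : complex.Re w < 0 -> cdiff D F w.
  move=> w0; have hf := @holomorphic_cdiff _ (disk 1) f setT _ fh (cexp1 w w0).
  exact (@cdiff_comp _ D setT cexp f w (fun _ _ => I) (cdiff_cexp D w) hf).
have [A A0 FA] : exists2 A, A < 0 & forall w, A < complex.Re w -> complex.Re w < 0 -> F w != 0.
  have [[z0 [z01 fz0]]|nz] := pselect (exists z0, disk 1 z0 /\ f z0 = 0); last first.
    exists (-1) => [|w _ w0]; first by rewrite ltrN10.
    by apply/negP => /eqP Fw; apply: nz; exists (cexp w); split => //; exact: cexp1.
  (* Beyond the modulus of the only zero [z0] nothing vanishes; [1 / 2] keeps [ln M] meaningful when
     [z0 = 0]. *)
  pose M := Num.max (cmod z0) (2^-1); have M0 : 0 < M by rewrite lt_max invr_gt0 ltr0n orbT.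
  have M1 : M < 1 by rewrite gt_max invf_lt1 ?ltr1n// andbT; exact: z01.
  exists (ln M) => [|w wM w0]; first by rewrite ln_lt0// M0.
  apply/negP => /eqP Fw; have E : cexp w = z0.
    apply: finj; rewrite ?inE//; first exact: cexp1.
    by rewrite fz0; exact: Fw.
  have : M < cmod (cexp w) by rewrite cmod_cexp -[X in X < _]lnK ?posrE// ltr_expR.
  by rewrite E ltNge le_max lexx.
set S := ereal_sup _ in fsup.
have HS r : 0 < r -> r < 1 ->
    (\int[lebesgue_measure]_(t in `[0%R, (2 * pi)%R]) (cmod (f (circle_pt r t)) `^ p)%:E <= S)%E.
  move=> r0 r1; apply: ereal_sup_ubound; exists r => //=.
  by rewrite in_itv /= r0.
have uB s : A < s -> s < 0 -> itg (fun t => cmod (F (s +i* t)%C) `^ p) 0 (2 * pi) <= fine S.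
  move=> As s0; have uc := @cont1_u R f p A Fd FA s 0 (2 * pi) As s0.
  have h := HS (expR s) (expR_gt0 _) (ltac:(by rewrite -expR0 ltr_expR)).
  rewrite -lee_fin EFin_itg// fineK; first exact: h.
  rewrite ge0_fin_numE//; apply: le_trans h; apply: integral_ge0 => t _.
  by rewrite lee_fin powR_ge0.
have [d1 d10 H1] := @u_window_decay R f p A (fine S) p0 A0 Fd FA uB 0 e (or_introl erefl) e0.
have [d2 d20 H2] := @u_window_decay R f p A (fine S) p0 A0 Fd FA uB (- pi) e (or_intror erefl) e0.
pose d := Num.min d1 d2; have d0 : 0 < d by rewrite lt_min d10.
exists (expR (- d)).
  by rewrite expR_ge0 /= -expR0 ltr_expR oppr_lt0.
move=> z dz z1; have z0 : 0 < cmod z by apply: lt_trans dz; exact: expR_gt0.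
have zn0 : z != 0 by rewrite -cmod_gt0.
have [t tb zE] := exists_polar zn0.
pose s := ln (cmod z); have sd : - d < s by rewrite -ltr_expR lnK ?posrE.
have s0 : s < 0 by rewrite ln_lt0// z0.
have zc : cexp (s +i* t)%C = z by rewrite /cexp /= lnK ?posrE// -zE.
have pi2 := pi_ge2 R.
have sd1 : - d1 < s by apply: le_lt_trans sd; rewrite lerN2 ge_min lexx.
have sd2 : - d2 < s by apply: le_lt_trans sd; rewrite lerN2 ge_min lexx orbT.
(* The angle lies in [[- pi / 2, 3 pi / 2]]. Up to [pi / 2] the window starting at [- pi] is used,
   beyond it the one starting at [0]; the distance to the ends is at least [pi / 2 >= 1]. *)
have Hu : cmod (f z) `^ p * - s <= e.
  rewrite -zc; have [tp|tp] := leP t (pi / 2).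
    by apply: H2 => //; move: tb => /andP[]; lra.
  by apply: H1 => //; move: tb => /andP[]; lra.
rewrite powRr1 ?subr_ge0 ?(ltW z1)//; apply: le_trans Hu.
(* Reduces to [1 - |z| <= - ln |z|], an instance of [1 + x <= expR x]. *)
rewrite ler_wpM2l ?powR_ge0// lerNr opprB lerBrDl.
by rewrite -[X in _ <= X](lnK (x := cmod z)) ?posrE//; exact: expR_ge1Dx.
Qed.

End HardyPowerDecay.

(** * From pointwise decay to the maximum modulus and the area *)

Section DiskGrowth.
Context {R : realType}.

Lemma bergman_power_decay_all (p alpha : R) (f : R[i] -> R[i]) : 0 < p ->
  bergman p alpha f -> set_inj (disk 1) f -> power_decay p (alpha + 2) f.
Proof.
rewrite /bergman => p0; case: eqVneq => [-> hf finj|_ hf _]; last exact: bergman_power_decay.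
by rewrite (_ : -1 + 2 = 1); [exact: hardy_power_decay|ring].
Qed.

Lemma bounded_on_closed_disk (f : R[i] -> R[i]) (s : R) : 0 <= s ->
  (forall w, cmod w <= s -> ccont [set z | cmod z <= s] f w) ->
  exists M, forall z, cmod z <= s -> cmod (f z) <= M.
Proof.
move=> s0 fc; have ss : - s <= s by lra.
have loc w : rect (- s) s (- s) s w -> exists M, exists2 e, 0 < e &
    forall z, [set z | cmod z <= s] z -> cmod (z - w) < e -> cmod (f z) <= M.
  move=> _; have [ws|ws] := leP (cmod w) s; first exact: ccont_locally_bounded (fc w ws).
  exists 0, (cmod w - s); first by rewrite subr_gt0.
  move=> z /= zs; rewrite cmod_distC => zw.
  by have := cmodD (w - z) z; rewrite subrK; lra.
have [M HM] := locally_bounded_on_rect ss ss loc.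
exists M => z zs; apply: HM => //.
by split; rewrite -ler_norml; apply: le_trans zs; [exact: cmod_Re|exact: cmod_Im].
Qed.

(** Near the circle [1 - r <= 1 - |z|] reduces to the given decay; on the remaining fixed disk
    [|z| <= s] the function is bounded and [(1 - r)^b] alone is small. *)
Lemma power_decay_disk (p b : R) (f : R[i] -> R[i]) : 0 < p -> 0 < b ->
  holomorphic_on (disk 1) f -> power_decay p b f ->
  forall e, 0 < e -> exists2 r0, 0 <= r0 < 1 & forall r z, r0 < r -> r < 1 -> cmod z <= r ->
    cmod (f z) `^ p * (1 - r) `^ b <= e.
Proof.
move=> p0 b0 fh fd e e0; have [s /andP[s0 s1] Hs] := fd e e0.
have [M HM] : exists M, forall z, cmod z <= s -> cmod (f z) <= M.
  apply: bounded_on_closed_disk => // w ws; apply/cdiff_ccont.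
  exact: (@holomorphic_cdiff _ (disk 1) f _ w fh (le_lt_trans ws s1)).
have M0 : 0 <= M `^ p by exact: powR_ge0.
have M1 : 0 < M `^ p + 1 by lra.
pose c := (e / (M `^ p + 1)) `^ b^-1.
have c0 : 0 < c by rewrite powR_gt0// divr_gt0.
exists (Num.max s (1 - c)).
  by rewrite le_max s0 /= gt_max s1 /= gtrBl.
move=> r z; rewrite gt_max => /andP[sr cr] r1 zr.
have [zs|zs] := leP (cmod z) s; last first.
  apply: le_trans (Hs z zs (le_lt_trans zr r1)); rewrite ler_wpM2l ?powR_ge0//.
  apply: ge0_ler_powR; rewrite ?nnegrE ?(ltW b0) ?subr_ge0 ?(ltW r1) ?(ltW (le_lt_trans zr r1))//.
  by rewrite lerD2l lerN2.
have h1 : cmod (f z) `^ p <= M `^ p.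
  have := HM z zs => h; apply: ge0_ler_powR; rewrite ?nnegrE ?cmod_ge0 ?(ltW p0)//.
  exact: le_trans (cmod_ge0 _) h.
have h2 : (1 - r) `^ b <= e / (M `^ p + 1).
  have -> : e / (M `^ p + 1) = c `^ b.
    by rewrite /c -powRrM mulVf ?gt_eqF// powRr1// divr_ge0 ?ltW.
  by apply: ge0_ler_powR; rewrite ?nnegrE ?(ltW b0) ?(ltW c0)//; lra.
apply: le_trans (ler_pM (powR_ge0 _ _) (powR_ge0 _ _) h1 h2) _.
by rewrite mulrA ler_pdivrMr// mulrC ler_wpM2l ?(ltW e0)//; lra.
Qed.

Lemma le_of_powR_mul_le (p b x y e : R) : 0 < p -> 0 < b -> 0 <= x -> 0 < y -> 0 < e ->
  x `^ p * y `^ b <= e `^ b -> x <= (e / y) `^ (b / p).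
Proof.
move=> p0 b0 x0 y0 e0; rewrite -ler_pdivlMr ?powR_gt0// => H.
have E : e `^ b / y `^ b = (e / y) `^ b.
  by apply: (mulIf (lt0r_neq0 (powR_gt0 b y0))); rewrite divfK ?gt_eqF ?powR_gt0// -powRM
    ?divfK ?gt_eqF// ?divr_ge0 ?ltW.
rewrite E in H; rewrite powRrM -[X in X <= _](powRr1 x0) -[1](divff (lt0r_neq0 p0)) powRrM.
by apply: ge0_ler_powR; rewrite ?nnegrE ?powR_ge0 ?invr_ge0 ?(ltW p0).
Qed.

(** The integral of a nonnegative function is a supremum over the simple functions below it, and
    enlarging the function enlarges this family. It is meant for measures of sections of a set whose
    measurability is not known. *)
Lemma ge0_le_integralT d (T : measurableType d) (mu : {measure set T -> \bar R})
    (g h : T -> \bar R) : (forall x, 0 <= g x)%E -> (forall x, g x <= h x)%E ->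
  (\int[mu]_x g x <= \int[mu]_x h x)%E.
Proof.
move=> g0 gh; rewrite !ge0_integralTE//; last by move=> x; exact: le_trans (gh x).
by apply: le_ereal_sup => _ [k kg <-]; exists k => // x; exact: le_trans (gh x).
Qed.

Lemma le_lebesgue_measure (A B : set R) : A `<=` B ->
  (lebesgue_measure A <= lebesgue_measure B)%E.
Proof. by move=> AB; exact: le_mu_ext. Qed.

Lemma area_ge0 (A : set R[i]) : (0 <= area A)%E.
Proof. by apply: integral_ge0 => x _; exact: measure_ge0. Qed.

(* The product measure integrates the outer measures of the sections; outer measures
   and integrals of nonnegative functions are monotone without measurability. *)
Lemma area_le_square (A : set R[i]) (N : R) : 0 <= N -> (forall z, A z -> cmod z <= N) ->
  (area A <= ((2 * N) ^+ 2)%:E)%E.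
Proof.
move=> N0 AN; rewrite /area /product_measure1.
pose h : R -> \bar R := (cst (2 * N)%:E) \_ `[- N, N]%classic.
have leb_itv : lebesgue_measure (`[- N, N]%classic : set R) = (2 * N)%:E.
  have := @lebesgue_measure_itv R `[- N, N]; rewrite /= lte_fin => ->.
  case: ltP => [_|NN]; first by congr EFin; ring.
  by congr EFin; lra.
apply: (@le_trans _ _ (\int[lebesgue_measure]_x h x)%E).
  apply: ge0_le_integralT => x; first exact: measure_ge0.
  rewrite /h patchE; case: ifPn => [_|xN]; rewrite /=.
    rewrite -leb_itv; apply: le_lebesgue_measure => y; rewrite /xsection /= inE => /AN Ay.
    by rewrite in_itv /= -ler_norml; apply: le_trans Ay; exact: (cmod_Im (to_complex (x, y))).
  rewrite (_ : xsection _ _ = set0) ?measure0//.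
  apply/seteqP; split => // y; rewrite /xsection /= inE => /AN Ay.
  move: xN; rewrite notin_setE /= in_itv /= -ler_norml; apply.
  by apply: le_trans Ay; exact: (cmod_Re (to_complex (x, y))).
rewrite /h -integral_mkcond integral_cst//= leb_itv -EFinM lee_fin expr2.
exact: lexx.
Qed.

End DiskGrowth.

Theorem corollary1p6 (R : realType) (p alpha : R) (f : R[i] -> R[i])
    (hp : 0 < p) (halpha : -1 <= alpha)
    (hf : bergman p alpha f) (hconf : conformal_on (disk 1) f) :
  (1 - r) * max_modulus f r `^ (p / (alpha + 2)) @[r --> (1 : R)^'-] --> (0 : R)
  /\
  ((1 - r)%:E * image_area f r `^ (p / (2 * (alpha + 2))))%E
    @[r --> (1 : R)^'-] --> (0%E : \bar R).
Proof.
have [fh finj] := hconf; set b := alpha + 2.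
have b0 : 0 < b by rewrite /b; lra.
have p'0 : p != 0 by rewrite gt_eqF.
have b'0 : b != 0 by rewrite gt_eqF.
have decay := power_decay_disk hp b0 fh (bergman_power_decay_all hp hf finj).
(* The decay is used with [e ^ b], so that raising this bound to the power [p / b] returns exactly
   [e / (1 - r)]. *)
have bound e : 0 < e -> exists2 r0, 0 <= r0 < 1 & forall r z, r0 < r -> r < 1 -> cmod z <= r ->
    cmod (f z) <= (e / (1 - r)) `^ (b / p).
  move=> e0; have [r0 r01 Hr0] := decay (e `^ b) (powR_gt0 b e0).
  exists r0 => // r z rr r1 zr; apply: le_of_powR_mul_le => //.
  - exact: cmod_ge0.
  - by rewrite subr_gt0.
  - exact: Hr0.
have powE (x : R) : 0 <= x -> (x `^ (b / p)) `^ (p / b) = x.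
  move=> x0; rewrite -powRrM (_ : b / p * (p / b) = 1) ?powRr1//.
  by field; rewrite p'0 b'0.
split.
  apply/cvgrPdist_le => e e0; have [r0 /andP[r00 r01] Hr0] := bound e e0.
  near=> r; have rr0 : r0 < r by near: r; exact: nbhs_left_gt.
  have r1 : r < 1 by near: r; exact: nbhs_left_lt.
  have r'0 : 0 < 1 - r by rewrite subr_gt0.
  have rpos : 0 <= r by exact: le_trans r00 (ltW rr0).
  have er : 0 <= e / (1 - r) by rewrite divr_ge0 ?ltW.
  rewrite sub0r normrN ger0_norm; last by rewrite mulr_ge0 ?powR_ge0// ltW.
  rewrite mulrC -ler_pdivlMr// -[leRHS](powE _ er).
  set S := [set cmod (f z) | z in [set z | cmod z = r]].
  (* A witness that the circle is not empty, since [sup] is only controlled on nonempty sets. *)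
  have Sr : S (cmod (f r%:C%C)) by exists r%:C%C => //; exact: etrans (cmod_real r) (ger0_norm rpos).
  have Sub : ubound S ((e / (1 - r)) `^ (b / p)).
    by move=> _ [z /= zr <-]; apply: Hr0 => //; rewrite zr.
  apply: ge0_ler_powR; rewrite ?nnegrE ?powR_ge0//.
  - by rewrite divr_ge0 ?ltW.
  - apply: le_trans (cmod_ge0 (f r%:C%C)) _; apply: ub_le_sup => //.
    by exists ((e / (1 - r)) `^ (b / p)).
  - by apply: ge_sup => //; exists (cmod (f r%:C%C)).
pose q := p / (2 * b).
have area_bound e : 0 < e -> exists2 r0, 0 <= r0 < 1 & forall r, r0 < r -> r < 1 ->
    (image_area f r <= ((2 * (e / (1 - r)) `^ (b / p)) ^+ 2)%:E)%E.
  move=> e0; have [r0 r01 Hr0] := bound e e0; exists r0 => // r rr0 r1.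
  apply: area_le_square; first exact: powR_ge0.
  by move=> _ [z zr <-]; apply: Hr0 => //; exact: ltW.
have fin_area e r : (image_area f r <= e%:E)%E -> image_area f r = (fine (image_area f r))%:E.
  move=> h; rewrite fineK// ge0_fin_numE ?area_ge0//; exact: le_lt_trans h (ltry _).
(* Convergence in the extended reals amounts to eventual finiteness, for which any tolerance such as
   [1] serves, and convergence of the real values. *)
apply/fine_cvgP; split.
  have [r0 /andP[_ r01] Hr0] := area_bound 1 ltr01.
  near=> r; have rr0 : r0 < r by near: r; exact: nbhs_left_gt.
  have r1 : r < 1 by near: r; exact: nbhs_left_lt.
  by rewrite (fin_area _ _ (Hr0 r rr0 r1)) poweR_EFin.
(* The image lies in a square of side [2 N]; the factor [2] becomes [2 ^ (p / b)] in the final power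
   and is absorbed here. *)
apply/cvgrPdist_le => e e0; pose e' := e / 2 `^ (p / b).
have tp : 0 < 2 `^ (p / b) :> R by rewrite powR_gt0.
have e'0 : 0 < e' by rewrite divr_gt0.
have [r0 /andP[r00 r01] Hr0] := area_bound e' e'0.
near=> r; have rr0 : r0 < r by near: r; exact: nbhs_left_gt.
have r1 : r < 1 by near: r; exact: nbhs_left_lt.
have r'0 : 0 < 1 - r by rewrite subr_gt0.
have er : 0 <= e' / (1 - r) by rewrite divr_ge0 ?ltW.
have H := Hr0 r rr0 r1; have aE := fin_area _ _ H.
rewrite /comp aE poweR_EFin /=; rewrite aE lee_fin in H.
have a0 : 0 <= fine (image_area f r) by rewrite fine_ge0// area_ge0.
move: (fine _) a0 H => a a0 H.
rewrite sub0r normrN ger0_norm; last by rewrite mulr_ge0 ?powR_ge0// ltW.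
have q0 : 0 <= p / (2 * b) by rewrite divr_ge0 ?mulr_ge0 ?ltW.
have : a `^ (p / (2 * b)) <= ((2 * (e' / (1 - r)) `^ (b / p)) ^+ 2) `^ (p / (2 * b)).
  by apply: ge0_ler_powR; rewrite ?nnegrE ?sqr_ge0.
have -> : ((2 * (e' / (1 - r)) `^ (b / p)) ^+ 2) `^ (p / (2 * b)) = 2 `^ (p / b) * (e' / (1 - r)).
  rewrite -powR_mulrn ?mulr_ge0 ?powR_ge0// -powRrM (_ : 2%:R * (p / (2 * b)) = p / b); last by field.
  by rewrite powRM ?powR_ge0// powE.
have -> : 2 `^ (p / b) * (e' / (1 - r)) = e / (1 - r).
  by rewrite /e' mulrA mulrCA divff ?gt_eqF// mulr1.
by rewrite ler_pdivlMr// mulrC.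
Unshelve. all: by end_near. Qed.
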